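(* Let $E\in M_{2\times 2}(\mathbb{Z})$ be a matrix that is not a homothety (i.e. $E\neq k\cdot\mathrm{Id}$ for every $k\in\mathbb{Z}$) and such that $\det(E)>4$. Then the intersection $[E]\cap\mathcal{U}$ is non-empty, and in fact it contains maps that are real analytically homotopic to $E$.
   Context: $\mathbb{T}^2=\mathbb{R}^2/\mathbb{Z}^2$ and $\mu$ is Lebesgue (Haar) measure on $\mathbb{T}^2$. An integer matrix $E$ with non-zero determinant induces a linear endomorphism $E:\mathbb{T}^2\to\mathbb{T}^2$, denoted by the same letter, and $[E]$ denotes the homotopy class of this map. ''Real analytically homotopic to $E$'' means real analytic and homotopic to $E$ through real analytic maps. Fix a regularity $r\ge 1$. $\mathrm{End}^r_\mu(\mathbb{T}^2)$ is the set of $\mathcal{C}^r$ local diffeomorphisms $f:\mathbb{T}^2\to\mathbb{T}^2$ that preserve $\mu$ (i.e. $\mu(f^{-1}(A))=\mu(A)$ for every Borel set $A$) and are not invertible. $T^1\mathbb{T}^2$ is the unit tangent bundle (for a fixed translation-invariant norm $\|\cdot\|$ on tangent spaces). For $f\in \mathrm{End}^r_\mu(\mathbb{T}^2)$, $(x,v)\in T^1\mathbb{T}^2$ and $n\in\mathbb{N}$, $n\ge 1$, define $$I(x,v;f^n)=\sum_{y\in f^{-n}(x)}\frac{\log\|(D_yf^n)^{-1}v\|}{\det(D_yf^n)},\qquad C_{\mathcal{X}}(f)=\sup_{n\ge 1}\frac1n\inf_{(x,v)\in T^1\mathbb{T}^2} I(x,v;f^n),$$ and $$\mathcal{U}=\{f\in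 \mathrm{End}^r_\mu(\mathbb{T}^2): C_{\mathcal{X}}(f)>0\}.$$ *)

(* Defs.v *)
From HB Require Import structures.
From mathcomp Require Import all_boot all_order all_algebra.
From mathcomp Require Import all_classical all_reals all_analysis.

Set Implicit Arguments.
Unset Strict Implicit.
Unset Printing Implicit Defensive.

Import Order.TTheory GRing.Theory Num.Theory.
Import numFieldNormedType.Exports.

Local Open Scope classical_set_scope.
Local Open Scope ring_scope.
Local Open Scope quotient_scope.

(* Tangent vectors are row vectors, and matrices act on them on the right: the
   Jacobian ['J F p] of the library is such that the differential of [F] at [p]
   is [v |-> v *m 'J F p], i.e. it is the transpose of the matrix acting on
   columns. *)
Definition plane (R : realType) : normedModType R := 'rV[R]_2.

Definition mkplane (R : realType) (z : R * R) : plane R :=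
  \row_(i < 2) if i == 0 then z.1 else z.2.

Definition lattice (R : realType) : pred 'rV[R]_2 :=
  fun x => x \is a mxOver (@Num.int R).

Fact lattice_zmod_closed (R : realType) : zmod_closed (@lattice R).
Proof.
split=> [|x y xZ yZ]; first by apply/mxOverP => i j; rewrite mxE rpred0.
by apply/mxOverP => i j; rewrite !mxE rpredB ?(mxOverP xZ) ?(mxOverP yZ).
Qed.
HB.instance Definition _ (R : realType) :=
  GRing.isZmodClosed.Build 'rV[R]_2 (@lattice R) (@lattice_zmod_closed R).

Definition torus (R : realType) : Type :=
  quotient_topology (Quotient.quot (GRing.ZmodClosed.clone _ (@lattice R) _)).
HB.instance Definition _ (R : realType) := Topological.on (torus R).
HB.instance Definition _ (R : realType) := Quotient.on (torus R).

Definition tproj (R : realType) (x : plane R) : torus R := \pi_(torus R) x.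

Section TorusMaps.
Context {R : realType}.
Local Notation V := (plane R).
Local Notation T2 := (torus R).
Implicit Types (f : T2 -> T2) (F G : V -> V) (U W : set V).

Definition torus_endo (E : 'M[int]_2) : T2 -> T2 :=
  fun q => tproj (repr q *m (map_mx intr E)^T).

Definition torus_borel : set (set T2) := <<s [set A : set T2 | open A] >>.

(* The Haar measure, computed on the fundamental domain [0, 1[ x [0, 1[. *)
Definition torus_measure (A : set T2) : \bar R :=
  ((@lebesgue_measure R) \x (@lebesgue_measure R))%E
    [set z : R * R | [/\ 0 <= z.1 < 1, 0 <= z.2 < 1 & A (tproj (mkplane z))]].

Definition preserves_measure f : Prop :=
  forall A, torus_borel A -> torus_measure (f @^-1` A) = torus_measure A.

(* Class C^(k + a) on the open set [U]: the derivatives up to order [k] exist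
   and are continuous, and those of order [k] are locally [a]-Hoelder. For
   [a = 0] the Hoelder condition follows from continuity, as [t `^ 0 = 1] for
   every [t], so that this is the usual class C^k. *)
Fixpoint class_on (k : nat) (a : R) U F : Prop :=
  match k with
  | 0 => forall p, U p -> {for p, continuous F} /\
      exists C : R, \forall x \near p & y \near p,
        `|F x - F y| <= C * `|x - y| `^ a
  | k'.+1 => (forall p, U p -> differentiable F p) /\
      forall v : V, class_on k' a U ('D_v F)
  end.

Definition Cr_on (r : \bar R) U F : Prop :=
  match r with
  | s%:E => class_on (Num.truncn s) (s - (Num.truncn s)%:R) U F
  | +oo%E => forall k, class_on k 0 U F
  | -oo%E => False
  end.

Definition lifts_on U f F : Prop := forall x, U x -> f (tproj x) = tproj (F x).

Definition Cr_diffeo (r : \bar R) U W F : Prop :=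
  [/\ open U, open W, set_bij U W F, Cr_on r U F &
      exists2 G, {in U, cancel F G} & Cr_on r W G].

(* A C^r diffeomorphism between open sets in the charts given by [tproj]. *)
Definition local_Cr_diffeo (r : \bar R) f : Prop :=
  forall x : V, exists U W F, [/\ U x, lifts_on U f F & Cr_diffeo r U W F].

(* Power series in two variables around [p], absolutely convergent on a
   polydisc; [`|h|] is the sup norm. *)
Definition analytic_at F (p : V) : Prop :=
  exists (c : nat -> nat -> V) (rho : R), [/\ 0 < rho,
    cvgn (series (fun n => \sum_(i < n.+1) `|c i (n - i)%N| * rho ^+ n)) &
    forall h : V, `|h| < rho ->
      series (fun n => \sum_(i < n.+1)
        (h 0 0 ^+ i * h 0 1 ^+ (n - i)) *: c i (n - i)%N) @ \oo --> F (p + h)].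

Definition real_analytic f : Prop :=
  forall x : V, exists F,
    (\forall y \near x, f (tproj y) = tproj (F y)) /\ analytic_at F x.

(* [P] constrains each [H t] separately; joint regularity in [(t, x)] is only
   continuity. *)
Definition homotopic_through (P : set (T2 -> T2)) f g : Prop :=
  exists H : R -> T2 -> T2,
    [/\ {within `[0%R, 1%R] `*` [set: T2],
          continuous (fun z : R * T2 => H z.1 z.2)},
        H 0 = f, H 1 = g & forall t : R, 0 <= t <= 1 -> P (H t)].

Definition homotopy_class f : set (T2 -> T2) :=
  [set g | homotopic_through setT f g].

(* The tangent spaces of the torus are identified with the plane. Two local
   lifts of [f] continuous at a point differ by a constant near it, and so the
   differential does not depend on the lift. *)
Definition is_torus_jacobian f (q : T2) (A : 'M[R]_2) : Prop :=
  exists F, [/\ \forall x \near (repr q : V), f (tproj x) = tproj (F x),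
    differentiable F (repr q : V) & 'J F (repr q) = A].

Definition torus_jacobian f (q : T2) : 'M[R]_2 := get (is_torus_jacobian f q).

Definition End_mu (r : \bar R) : set (T2 -> T2) :=
  [set f | [/\ local_Cr_diffeo r f, preserves_measure f & ~ bijective f]].

Definition is_norm (N : V -> R) : Prop :=
  [/\ forall u v, N (u + v) <= N u + N v,
      forall (a : R) u, N (a *: u) = `|a| * N u &
      forall u, N u = 0 -> u = 0].

Definition unit_tangent (N : V -> R) : set (T2 * V) := [set xv | N xv.2 = 1].

Definition fiber_sum (N : V -> R) (g : T2 -> T2) (xv : T2 * V) : R :=
  \sum_(y \in g @^-1` [set xv.1])
    ln (N (xv.2 *m invmx (torus_jacobian g y))) / \det (torus_jacobian g y).

(* Extended reals, so that no boundedness is presupposed. *)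
Definition C_X (N : V -> R) f : \bar R :=
  ereal_sup [set (n%:R^-1)%:E *
      ereal_inf [set (fiber_sum N (iter n f) xv)%:E | xv in unit_tangent N]
    | n in [set n : nat | (0 < n)%N]]%E.

Definition calU (N : V -> R) (r : \bar R) : set (T2 -> T2) :=
  [set f | End_mu r f /\ (0 < C_X N f)%E].

End TorusMaps.

(* Main.v *)
Require Import Defs.
From HB Require Import structures.
From mathcomp Require Import all_boot all_order all_algebra.
From mathcomp Require Import all_classical all_reals all_analysis.
From mathcomp Require Import measurable_realfun ring lra zify.
Set Implicit Arguments.
Unset Strict Implicit.
Unset Printing Implicit Defensive.
Import Order.TTheory GRing.Theory Num.Theory.
Import numFieldNormedType.Exports.
Local Open Scope classical_set_scope.
Local Open Scope ring_scope.

(** Write [E^T = L *m D *m S] with [L] and [S] unimodular and [D] diagonal with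
   entries [p %| m], so that [p * m = \det E]. Conjugating by a further
   unimodular matrix gives [E^T = P1 *m P2] with [P1] unimodular, and the map
   is induced by the lift
     [x |-> hshear (tau_h eta) (vshear (tau_v T) (x *m P1)) *m P2],
   a linear map interrupted by a strong vertical shear ([T] is large) and a weak
   horizontal one. Scaling both shears by [t] in the unit interval joins it to
   the endomorphism. The coordinates of all these lifts are built from affine
   functions by sums, products, sines and cosines ([elementary]), and such
   functions are smooth and real analytic. The measure is preserved by the
   shears because rotations of a circle preserve length ([square_measure_shear1],
   [square_measure_shear2]), and by the endomorphisms because translations
   preserve the measure ([square_measure_endo]).

   For the growth of vectors, consider the [p * m] inverse branches at a point,
   indexed by [(i, j)]. In the coordinates of the shears the inverse derivative
   along a branch takes [w] to [r *m transfer], where [r.1] is close to [w.1] and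
   [r.2 = w.2 - T * s * r.1]; here [s] is the value of a fixed function, [slope],
   at a point that depends on [j] through the summand [j / m]. If [w] is not
   nearly vertical (it is [good]) and [s] is not small, then [r] is long and
   nearly vertical. Its image is good again, because [transfer 1 0 != 0]: this
   means that the vertical direction is not invariant under the linear part, and
   it can be arranged exactly because [E] is not a homothety
   ([twisted_factorization]). If [w] is not good, the image is still good, and
   not much shorter than [w], unless [T * s * r.1] is close to [w.2], that is,
   unless [s] is close to a value prescribed by [w].

   It remains to count exceptional branches: [k0] of them where the slope is
   nearly [0], [k1] where it is near a prescribed value, and what is needed is
   [k0 + k1 < p * m] ([slope_counting]). The slope takes a value at most twice on
   a coset of the group of [m]-th parts of the integers, so that both numbers are
   at most [2 * p], which suffices for [m >= 5]. The second harmonic in [slope]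
   brings [k0] down to [p] when [m] is [3] or [4], which suffices for [m = 4].
   For [m = 3] one has [p = 3], and the horizontal shear, which displaces the
   cosets with different [i] by different amounts, brings [k1] down to [5]. The
   hypothesis [4 < \det E] excludes [m <= 2].

   Let then the potential of [w] be the logarithm of its length plus a reward
   proportional to [ln T] if [w] is good. For a large [T], its average over the
   branches exceeds its value at [w] by a positive constant ([average_growth],
   [expanding_parameters]), and this adds up along the tree of preimages
   ([potential_growth]). All Jacobians have the same determinant, so that the
   sums over the fibres are these averages up to a bounded error, and they are
   bounded below by a positive number for a suitable [n] ([positive_exponent]). *)

(** * Triangular summation of series *)

Lemma sum_tail_small (R : realType) (M : nat -> R) (B e : R) :
  (forall k, 0 <= M k) -> (forall n, \sum_(k < n) M k <= B) -> 0 < e ->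
  \forall K \near \oo, forall n, (K <= n)%N -> \sum_(K <= k < n) M k <= e.
Proof.
move=> M0 MB e0.
have ndM : nondecreasing_seq (series M).
  apply/nondecreasing_seqP => n; rewrite seriesSr lerDl; exact: M0.
have bM : has_ubound (range (series M)).
  by exists B => _ [n _ <-]; rewrite /series /= big_mkord.
have cM : cvgn (series M) by apply: nondecreasing_is_cvgn.
have /cvgrPdist_lt/(_ _ e0) := cM.
apply: filterS => K hK n Kn.
have := nondecreasing_cvgn_le ndM cM n.
have := sub_series_geq M Kn => /= <-.
have := nondecreasing_cvgn_le ndM cM K.
move: hK; rewrite ltr_distlC => /andP[h1 h2] h3 h4.
by rewrite lerBlDl; apply: le_trans h4 _; rewrite -lerBlDr ltW.
Qed.

Lemma sum_triangular (R : nmodType) (a : nat -> nat -> R) N :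
    (forall k n, (n < k)%N -> a k n = 0) ->
  \sum_(n < N) \sum_(k < n.+1) a k n = \sum_(k < N) \sum_(n < N) a k n.
Proof.
move=> a0; rewrite [RHS]exchange_big; apply: eq_bigr => n _.
rewrite (big_ord_widen N (fun k => a k n)) // big_mkcond /=.
apply: eq_bigr => k _; case: ifPn => //.
by rewrite -leqNgt => nk; rewrite a0.
Qed.

Lemma sum_delayed (R : nmodType) (y : nat -> R) k N :
  \sum_(n < N) (if (k <= n)%N then y (n - k)%N else 0) = \sum_(j < N - k) y j.
Proof.
elim: N => [|N IH]; first by rewrite sub0n !big_ord0.
rewrite big_ord_recr IH /=; case: leqP => kN.
  by rewrite subSn // big_ord_recr.
by rewrite addr0; move: (kN); rewrite /leq => /eqP ->;
  rewrite (eqP (_ : N - k == 0)%N) // subn_eq0 ltnW.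
Qed.

(** Triangular summation: both the Cauchy product of two series and the
   re-expansion of a power series in a power series without constant term sum
   a family [a k n] supported on [k <= n] by columns instead of by rows. *)
Lemma cvg_triangular_series (R : realType) (a : nat -> nat -> R)
    (b M : nat -> R) (B s : R) :
    (forall k n, \sum_(i < n) `|a k i| <= M k) ->
    (forall n, \sum_(k < n) M k <= B) ->
    (forall k, series (a k) @ \oo --> b k) -> series b @ \oo --> s ->
    (forall k n, (n < k)%N -> a k n = 0) ->
  series (fun n => \sum_(k < n.+1) a k n) @ \oo --> s.
Proof.
move=> aM MB ab bs a0.
have M0 k : 0 <= M k by have := aM k 0%N; rewrite big_ord0.
have sumE N : series (fun n => \sum_(k < n.+1) a k n) N =
    \sum_(k < N) series (a k) N.
  rewrite seriesEord /= sum_triangular//.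
  by apply: eq_bigr => k _; rewrite seriesEord.
apply/cvgrPdist_le => e e0.
have e3 : 0 < e / 3 by rewrite divr_gt0.
have [K [/(_ _)/= tK bK]] : exists K, (forall n, (K <= n)%N ->
    \sum_(K <= k < n) M k <= e / 3) /\ `|s - series b K| <= e / 3.
  near \oo => K; exists K; split.
    by near: K; apply: sum_tail_small MB e3.
  near: K; move/cvgrPdist_le: bs; exact.
have : (\sum_(k < K) series (a k) N) @[N --> \oo] --> series b K.
  elim: K {tK bK} => [|K IH].
    under eq_fun do rewrite big_ord0; rewrite seriesEord /= big_ord0.
    exact: cvg_cst.
  under eq_fun do rewrite big_ord_recr; rewrite seriesSr.
  exact: cvgD IH (ab K).
move/cvgrPdist_le => /(_ _ e3) h.
near=> N.
have KN : (K <= N)%N by near: N; apply: nbhs_infty_ge.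
have hN : `|series b K - \sum_(k < K) series (a k) N| <= e / 3 by near: N.
rewrite sumE -[X in `|_ - X|](@big_mkord _ _ _ N xpredT (fun k => series (a k) N)).
rewrite (big_cat_nat (leq0n K) KN) //= big_mkord.
have tl : `|\sum_(K <= k < N) series (a k) N| <= e / 3.
  apply: le_trans (tK _ KN); apply: le_trans (ler_norm_sum _ _ _) _.
  apply: ler_sum => k _; rewrite seriesEord; apply: le_trans (aM k N).
  exact: ler_norm_sum.
move: bK hN tl; set S1 := series b K; set S2 := \sum_(k < K) _; set S3 := bigop.body _ _ _.
move=> h1 h2 h3.
rewrite (_ : s - (S2 + S3) = (s - S1) + (S1 - S2) - S3); last by ring.
apply: le_trans (ler_normB _ _) _; apply: le_trans (lerD (ler_normD _ _) (lexx _)) _.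
lra.
Unshelve. all: by end_near.
Qed.

(** * Real analytic functions of two variables *)

Section AnalyticAlgebra.
Variable R : realType.
Local Notation V := (plane R).
Implicit Types (h p : V) (f g : V -> R) (u : V -> R).

Lemma norm_coord_le h i j : `|h i j| <= `|h|.
Proof.
rewrite [leRHS]mx_normrE.
exact: (le_bigmax _ (fun x : 'I_1 * 'I_2 => `|h x.1 x.2|) (i, j)).
Qed.

(** Homogeneous polynomials of degree [n]. The bound is put on the sum of the
   absolute values of the coefficients because this sum is submultiplicative. *)
Definition hform n (M : R) u := exists2 a : nat -> R,
  \sum_(i < n.+1) `|a i| <= M &
  forall h, u h = \sum_(i < n.+1) a i * (h 0 0 ^+ i * h 0 1 ^+ (n - i)).

Lemma hform_ge0 n M u : hform n M u -> 0 <= M.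
Proof. by case=> a h _; apply: le_trans h; apply: sumr_ge0. Qed.

Lemma hform_le n M M' u : M <= M' -> hform n M u -> hform n M' u.
Proof. by move=> MM [a h hu]; exists a => //; apply: le_trans MM. Qed.

Lemma hform_norm n M u h : hform n M u -> `|u h| <= M * `|h| ^+ n.
Proof.
case=> a aM ->; apply: le_trans (ler_norm_sum _ _ _) _.
apply: le_trans (ler_wpM2r (exprn_ge0 _ (normr_ge0 _)) aM).
rewrite mulr_suml; apply: ler_sum => i _; rewrite normrM ler_wpM2l //.
have le_in : (i <= n)%N by rewrite -ltnS.
rewrite normrM !normrX -[in leRHS](subnKC le_in) exprD ler_pM ?exprn_ge0 //.
- by rewrite lerXn2r ?nnegrE// norm_coord_le.
- by rewrite lerXn2r ?nnegrE// norm_coord_le.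
Qed.

Lemma hform0 n : hform n 0 (fun=> 0).
Proof.
exists (fun=> 0); first by rewrite big1 // => i _; rewrite normr0.
by move=> h; rewrite big1 // => i _; rewrite mul0r.
Qed.

Lemma hformD n M M' u u' : hform n M u -> hform n M' u' ->
  hform n (M + M') (fun h => u h + u' h).
Proof.
move=> [a aM au] [b bM bu]; exists (fun i => a i + b i).
  by apply: le_trans (lerD aM bM); rewrite -big_split; apply: ler_sum => i _;
    exact: ler_normD.
by move=> h; rewrite au bu -big_split; apply: eq_bigr => i _; rewrite mulrDl.
Qed.

Lemma hformZ n M u c : hform n M u -> hform n (`|c| * M) (fun h => c * u h).
Proof.
move=> [a aM au]; exists (fun i => c * a i).
  apply: le_trans (ler_wpM2l (normr_ge0 c) aM).
  by rewrite mulr_sumr; apply: ler_sum => i _; rewrite normrM.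
by move=> h; rewrite au mulr_sumr; apply: eq_bigr => i _; rewrite mulrA.
Qed.

Lemma hform_sum n m (M : nat -> R) (u : nat -> V -> R) :
  (forall k, (k < m)%N -> hform n (M k) (u k)) ->
  hform n (\sum_(k < m) M k) (fun h => \sum_(k < m) u k h).
Proof.
elim: m => [|m IH] H.
  have -> : (fun h => \sum_(k < 0) u k h) = fun=> 0.
    by apply/funext => h; rewrite big_ord0.
  by rewrite big_ord0; exact: hform0.
have -> : (fun h => \sum_(k < m.+1) u k h) =
    fun h => \sum_(k < m) u k h + u m h.
  by apply/funext => h; rewrite big_ord_recr.
rewrite big_ord_recr; apply: hformD.
  by apply: IH => k km; apply: H; rewrite ltnS ltnW.
exact: H.
Qed.

Lemma hform_monomial n i c : (i <= n)%N ->
  hform n `|c| (fun h => c * (h 0 0 ^+ i * h 0 1 ^+ (n - i))).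
Proof.
move=> le_in; have lt_in : (i < n.+1)%N by [].
exists (fun j => if j == i then c else 0).
  by rewrite (bigD1 (Ordinal lt_in)) //= eqxx big1 ?addr0 // => j;
    rewrite -val_eqE /= => /negPf ->; rewrite normr0.
by move=> h; rewrite (bigD1 (Ordinal lt_in)) //= eqxx big1 ?addr0 // => j;
  rewrite -val_eqE /= => /negPf ->; rewrite mul0r.
Qed.

Lemma hform_mul n m M M' u u' : hform n M u -> hform m M' u' ->
  hform (n + m) (M * M') (fun h => u h * u' h).
Proof.
move=> hu hu'; have M0 := hform_ge0 hu; case: hu => a aM au.
case: hu' => b bM bu.
apply: (@hform_le _ (\sum_(i < n.+1) \sum_(j < m.+1) `|a i * b j|)).
  apply: (@le_trans _ _ (M * \sum_(j < m.+1) `|b j|)); last exact: ler_wpM2l.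
  apply: (@le_trans _ _ ((\sum_(i < n.+1) `|a i|) * \sum_(j < m.+1) `|b j|)).
    2: by apply: ler_wpM2r aM; exact: sumr_ge0.
  rewrite mulr_suml; apply: ler_sum => i _; rewrite mulr_sumr.
  by apply: ler_sum => j _; rewrite normrM.
rewrite (_ : (fun h => _) = fun h => \sum_(i < n.+1) \sum_(j < m.+1)
    a i * b j * (h 0 0 ^+ (i + j) * h 0 1 ^+ ((n + m) - (i + j)))).
  apply: (@hform_sum _ _ (fun i => \sum_(j < m.+1) `|a i * b j|)
    (fun i h => \sum_(j < m.+1) a i * b j *
      (h 0 0 ^+ (i + j) * h 0 1 ^+ (n + m - (i + j))))) => i ltin.
  apply: (@hform_sum _ _ (fun j => `|a i * b j|)
    (fun j h => a i * b j *
      (h 0 0 ^+ (i + j) * h 0 1 ^+ (n + m - (i + j))))) => j ltjm.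
  by apply: hform_monomial; rewrite leq_add.
apply/funext => h; rewrite au bu mulr_suml; apply: eq_bigr => i _.
rewrite mulr_sumr; apply: eq_bigr => j _.
have [iN jM] : (i <= n /\ j <= m)%N by split; rewrite -ltnS ltn_ord.
rewrite (_ : n + m - (i + j) = (n - i) + (m - j))%N; last by lia.
by rewrite !exprD; ring.
Qed.

(** The expansion of [f] at [p] in homogeneous polynomials. The bound on the
   majorant at radius [rho] is part of the data: products multiply it, so that
   the powers of [f] have expansions on one common disc. *)
Definition expansion p f (rho B : R) (u : nat -> V -> R) (M : nat -> R) :=
  [/\ forall n, hform n (M n) (u n),
      forall N, \sum_(n < N) M n * rho ^+ n <= B &
      forall h, `|h| < rho -> series (u^~ h) @ \oo --> f (p + h)].

Definition analytic_fun p f :=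
  exists rho B (u : nat -> V -> R) M, 0 < rho /\ expansion p f rho B u M.

Lemma expansion_le p f rho rho' B (u : nat -> V -> R) M : 0 <= rho' -> rho' <= rho ->
  expansion p f rho B u M -> expansion p f rho' B u M.
Proof.
move=> r0 rr [uM MB uf]; split=> // [N|h hr]; last first.
  by apply: uf; apply: lt_le_trans rr.
apply: le_trans (MB N); apply: ler_sum => n _.
rewrite ler_wpM2l ?(hform_ge0 (uM n)) // lerXn2r ?nnegrE//.
exact: le_trans rr.
Qed.

Lemma expansionD p f g rho B C (u v : nat -> V -> R) M L :
  expansion p f rho B u M -> expansion p g rho C v L ->
  expansion p (fun x => f x + g x) rho (B + C) (fun n h => u n h + v n h)
    (fun n => M n + L n).
Proof.
move=> [uM MB uf] [vL LC vg]; split=> [n|N|h hr].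
- exact: hformD.
- apply: le_trans (lerD (MB N) (LC N)); rewrite -big_split /=.
  by apply: ler_sum => n _; rewrite mulrDl.
- by rewrite (seriesD (u^~ h) (v^~ h)); apply: cvgD; [exact: uf|exact: vg].
Qed.

Definition convol (u v : nat -> V -> R) n h := \sum_(k < n.+1) u k h * v (n - k)%N h.

Lemma expansionM p f g rho B C (u v : nat -> V -> R) M L : 0 <= rho ->
  expansion p f rho B u M -> expansion p g rho C v L ->
  expansion p (fun x => f x * g x) rho (B * C) (convol u v)
    (fun n => \sum_(k < n.+1) M k * L (n - k)%N).
Proof.
move=> r0 [uM MB uf] [vL LC vg].
have M0 n := hform_ge0 (uM n); have L0 n := hform_ge0 (vL n).
have C0 : 0 <= C by have := LC 0%N; rewrite big_ord0.
split=> [n|N|h hr].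
- apply: (@hform_sum _ _ (fun k => M k * L (n - k)%N)
    (fun k h => u k h * v (n - k)%N h)) => k; rewrite ltnS => kn.
  by have := hform_mul (uM k) (vL (n - k)%N); rewrite subnKC.
- pose a k n := (M k * rho ^+ k) *
    (if (k <= n)%N then L (n - k)%N * rho ^+ (n - k) else 0).
  rewrite (_ : \sum_(n < N) _ = \sum_(n < N) \sum_(k < n.+1) a k n).
    rewrite sum_triangular => [|k n nk]; last first.
      by rewrite /a leqNgt nk mulr0.
    apply: (@le_trans _ _ (\sum_(k < N) M k * rho ^+ k * C)).
      apply: ler_sum => k _; rewrite -mulr_sumr.
      rewrite (sum_delayed (fun j => L j * rho ^+ j)) ler_wpM2l //.
      by rewrite mulr_ge0 ?exprn_ge0.
    by rewrite -mulr_suml ler_wpM2r.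
  apply: eq_bigr => n _; rewrite mulr_suml; apply: eq_bigr => k _.
  have kn : (k <= n)%N by rewrite -ltnS.
  have -> : rho ^+ n = rho ^+ k * rho ^+ (n - k) by rewrite -exprD subnKC.
  by rewrite /a kn; ring.
- pose a k n := u k h * (if (k <= n)%N then v (n - k)%N h else 0).
  have ru n : `|u n h| <= M n * rho ^+ n.
    apply: le_trans (hform_norm h (uM n)) _; rewrite ler_wpM2l //.
    by rewrite lerXn2r ?nnegrE// ltW.
  have rv n : `|v n h| <= L n * rho ^+ n.
    apply: le_trans (hform_norm h (vL n)) _; rewrite ler_wpM2l //.
    by rewrite lerXn2r ?nnegrE// ltW.
  rewrite (_ : convol u v ^~ h = fun n => \sum_(k < n.+1) a k n).
    apply: (@cvg_triangular_series _ a (fun k => u k h * g (p + h))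
      (fun k => M k * rho ^+ k * C) (B * C)).
    + move=> k N.
      under eq_bigr do rewrite /a normrM.
      rewrite -mulr_sumr; apply: ler_pM => //; first exact: sumr_ge0.
      under eq_bigr => i _ do rewrite (fun_if (fun x : R => `|x|)) normr0.
      rewrite (sum_delayed (fun j => `|v j h|)).
      by apply: le_trans (LC (N - k)%N); apply: ler_sum => j _.
    + by move=> n; rewrite -mulr_suml ler_wpM2r.
    + move=> k; rewrite -(cvg_shiftn k).
      rewrite (_ : (fun n => _) = fun n => u k h * series (v^~ h) n).
        exact: cvgMl_tmp (vg _ hr).
      apply/funext => n; rewrite seriesEord /a /= -mulr_sumr.
      by rewrite (sum_delayed (v^~ h)) addnK seriesEord.
    + rewrite (_ : series _ = fun n => series (u^~ h) n * g (p + h)).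
        exact: cvgMr_tmp (uf _ hr).
      by apply/funext => n; rewrite !seriesEord /= mulr_suml.
    + by move=> k n nk; rewrite /a leqNgt nk mulr0.
  apply/funext => n; apply: eq_bigr => k _.
  by have kn : (k <= n)%N by [rewrite -ltnS]; rewrite /a kn.
Qed.

Lemma expansion_affine p (a b c : R) :
  expansion p (fun x => a + b * x 0 0 + c * x 0 1) 1
    (`|a + b * p 0 0 + c * p 0 1| + (`|b| + `|c|))
    (fun n h => if n == 0%N then a + b * p 0 0 + c * p 0 1
       else if n == 1%N then b * h 0 0 + c * h 0 1 else 0)
    (fun n => if n == 0%N then `|a + b * p 0 0 + c * p 0 1|
       else if n == 1%N then `|b| + `|c| else 0).
Proof.
split=> [[|[|n]] /=|N|h _].
- exists (fun=> a + b * p 0 0 + c * p 0 1); first by rewrite big_ord1.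
  by move=> h; rewrite big_ord1 /= !expr0 !mulr1.
- exists (fun i => if i == 0%N then c else b).
    by rewrite !big_ord_recl big_ord0 /= addr0 addrC.
  move=> h; rewrite !big_ord_recl big_ord0 /= !expr0 !expr1 mul1r mulr1.
  by rewrite addr0 addrC.
- exact: hform0.
- under eq_bigr do rewrite expr1n mulr1.
  case: N => [|[|N]]; rewrite ?big_ord0 ?big_ord1 /=.
  + by rewrite !addr_ge0.
  + by rewrite lerDl addr_ge0.
  + by rewrite !big_ord_recl /= big1 // addr0.
- apply: cvg_near_cst; exists 2%N => // -[//|[//|n _]].
  by rewrite seriesEord /= !big_ord_recl /= big1 // !mxE; ring.
Qed.

Lemma analytic_affine p (a b c : R) :
  analytic_fun p (fun x => a + b * x 0 0 + c * x 0 1).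
Proof.
by exists 1; do 3 eexists; split; [exact: ltr01|exact: expansion_affine].
Qed.

Lemma analytic_common p f g : analytic_fun p f -> analytic_fun p g ->
  exists rho B C (u v : nat -> V -> R) M L, [/\ 0 < rho, expansion p f rho B u M &
    expansion p g rho C v L].
Proof.
move=> [r [B [u [M [r0 hf]]]]] [s [C [v [L [s0 hg]]]]].
exists (Num.min r s), B, C, u, v, M, L.
have rs0 : 0 < Num.min r s by rewrite lt_min r0.
split=> //; [apply: expansion_le hf|apply: expansion_le hg];
  by [exact: ltW|rewrite ge_min lexx ?orbT].
Qed.

Lemma analyticD p f g : analytic_fun p f -> analytic_fun p g ->
  analytic_fun p (fun x => f x + g x).
Proof.
move=> /analytic_common H /H[r [B [C [u [v [M [L [r0 hf hg]]]]]]]].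
by exists r; do 3 eexists; split; [|exact: expansionD hf hg].
Qed.

Lemma analyticM p f g : analytic_fun p f -> analytic_fun p g ->
  analytic_fun p (fun x => f x * g x).
Proof.
move=> /analytic_common H /H[r [B [C [u [v [M [L [r0 hf hg]]]]]]]].
by exists r; do 3 eexists; split; [|exact: expansionM (ltW r0) hf hg].
Qed.

Lemma analytic_cst p (a : R) : analytic_fun p (fun=> a).
Proof.
have := analytic_affine p a 0 0.
by rewrite (_ : (fun x => _) = fun=> a) //; apply/funext => x; ring.
Qed.

Fixpoint upow (u : nat -> V -> R) k : nat -> V -> R :=
  if k is k'.+1 then convol (upow u k') u
  else fun n => if n == 0%N then fun=> 1 else fun=> 0.

Fixpoint mpow (M : nat -> R) k : nat -> R :=
  if k is k'.+1 then fun n => \sum_(j < n.+1) mpow M k' j * M (n - j)%N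
  else fun n => if n == 0%N then 1 else 0.

Lemma expansionX p f rho B (u : nat -> V -> R) M k : 0 <= rho -> expansion p f rho B u M ->
  expansion p (fun x => f x ^+ k) rho (B ^+ k) (upow u k) (mpow M k).
Proof.
move=> r0 hf; elim: k => [|k IH].
  split=> [[|n] /=|N|h _].
  - exists (fun=> 1); first by rewrite big_ord1 normr1.
    by move=> h; rewrite big_ord1 !expr0 !mulr1.
  - exact: hform0.
  - case: N => [|N]; first by rewrite big_ord0 expr0.
    by rewrite big_ord_recl /= big1 ?addr0 ?mulr1 // => i _; rewrite mul0r.
  - apply: cvg_near_cst; exists 1%N => // -[//|n _].
    by rewrite seriesEord /= big_ord_recl /= big1 // addr0 expr0.
rewrite exprSr; under eq_fun do rewrite exprSr.
exact: expansionM.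
Qed.

Lemma upow_lt (u : nat -> V -> R) k n h : (forall h, u 0%N h = 0) -> (n < k)%N -> upow u k n h = 0.
Proof.
move=> u0; elim: k n h => // k IH n h; rewrite ltnS => nk /=.
rewrite /convol big1 // => j _.
have [jk|kj] := ltnP j k; first by rewrite IH // mul0r.
by rewrite (_ : n - j = 0)%N ?u0 ?mulr0 //; have := ltn_ord j; lia.
Qed.

Lemma mpow_lt M k n : M 0%N = 0 -> (n < k)%N -> mpow M k n = 0.
Proof.
move=> M0; elim: k n => // k IH n; rewrite ltnS => nk /=.
rewrite big1 // => j _.
have [jk|kj] := ltnP j k; first by rewrite IH // mul0r.
by rewrite (_ : n - j = 0)%N ?M0 ?mulr0 //; have := ltn_ord j; lia.
Qed.

Lemma sum_exp_coeff_le (x : R) N : 0 <= x ->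
  \sum_(k < N) x ^+ k / k`!%:R <= expR x.
Proof.
move=> x0.
have nd : nondecreasing_seq (series (exp_coeff x)).
  apply/nondecreasing_seqP => n; rewrite seriesSr lerDl.
  by rewrite divr_ge0 // exprn_ge0.
have := nondecreasing_cvgn_le nd (is_cvg_series_exp_coeff x) N.
by rewrite {1}/series /= big_mkord.
Qed.

(** Normalising the inner function to vanish at the centre makes each
   coefficient of the composite a finite sum. *)
Lemma analytic_comp p f (e : nat -> R) (S : R -> R) :
    (forall k, `|e k| <= k`!%:R^-1) ->
    (forall x, series (fun k => e k * x ^+ k) @ \oo --> S x) ->
  (exists rho B (u : nat -> V -> R) M, [/\ 0 < rho, expansion p f rho B u M, forall h, u 0%N h = 0
     & M 0%N = 0]) ->
  analytic_fun p (fun x => S (f x)).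
Proof.
move=> e1 eS [rho [B [u [M [r0 hf u0 M0]]]]].
have B0 : 0 <= B by case: hf => _ /(_ 0%N); rewrite big_ord0.
have hX k := expansionX k (ltW r0) hf.
have mp0 k n : 0 <= mpow M k n by case: (hX k) => /(_ n)/hform_ge0.
have eB N : \sum_(k < N) `|e k| * B ^+ k <= expR B.
  apply: le_trans (sum_exp_coeff_le N B0); apply: ler_sum => k _.
  by rewrite mulrC ler_wpM2l ?exprn_ge0.
exists rho, (expR B), (fun n h => \sum_(k < n.+1) e k * upow u k n h),
  (fun n => \sum_(k < n.+1) `|e k| * mpow M k n); split=> //; split.
- move=> n; apply: (@hform_sum _ _ (fun k => `|e k| * mpow M k n)
    (fun k h => e k * upow u k n h)) => k _.
  by apply: hformZ; case: (hX k).
- move=> N; apply: le_trans (eB N).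
  pose a k n := `|e k| * (mpow M k n * rho ^+ n).
  rewrite (_ : \sum_(n < N) _ = \sum_(n < N) \sum_(k < n.+1) a k n).
    rewrite sum_triangular => [|k n nk]; last by rewrite /a mpow_lt // mul0r mulr0.
    apply: ler_sum => k _; rewrite -mulr_sumr ler_wpM2l //.
    by case: (hX k).
  by apply: eq_bigr => n _; rewrite mulr_suml; apply: eq_bigr => k _;
    rewrite /a mulrA.
- move=> h hr.
  apply: (@cvg_triangular_series _ (fun k n => e k * upow u k n h)
    (fun k => e k * f (p + h) ^+ k) (fun k => `|e k| * B ^+ k) (expR B)) => //.
  + move=> k N; under eq_bigr do rewrite normrM.
    rewrite -mulr_sumr ler_wpM2l //.
    case: (hX k) => hk hB _; apply: le_trans (hB N); apply: ler_sum => n _.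
    apply: le_trans (hform_norm h (hk n)) _; rewrite ler_wpM2l //.
    by rewrite lerXn2r ?nnegrE// ltW.
  + move=> k; rewrite (_ : series _ = fun n => e k * series (upow u k ^~ h) n).
      by apply: cvgMl_tmp; case: (hX k) => _ _; apply.
    by apply/funext => n; rewrite !seriesEord /= mulr_sumr.
  + by move=> k n nk; rewrite upow_lt // mulr0.
Qed.

(** Subtracting the constant term puts a function in the form that
   [analytic_comp] requires. *)
Lemma analytic_center p f : analytic_fun p f -> exists c : R,
  exists rho B (u : nat -> V -> R) M, [/\ 0 < rho, expansion p (fun x => f x - c) rho B u M,
     forall h, u 0%N h = 0 & M 0%N = 0].
Proof.
move=> [rho [B [u [M [r0 [hu hB uf]]]]]]; have M0 n := hform_ge0 (hu n).
case: (hu 0%N) => a _ au.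
exists (a 0%N), rho, B, (fun n => if n == 0%N then fun=> 0 else u n),
  (fun n => if n == 0%N then 0 else M n); split=> //; split.
- by move=> [|n] /=; [exact: hform0|].
- move=> N; apply: le_trans (hB N); apply: ler_sum => n _; case: eqP => // _.
  by rewrite mul0r mulr_ge0 // exprn_ge0 // ltW.
- move=> h hr.
  have H : series (u^~ h) n - a 0%N @[n --> \oo] --> f (p + h) - a 0%N.
    by apply: cvgB; [exact: uf|exact: cvg_cst].
  apply: cvg_trans H; apply: near_eq_cvg; exists 1%N => // -[//|n _].
  rewrite !seriesEord /= !big_ord_recl /= add0r.
  by rewrite au big_ord1 !expr0 !mulr1 [a _ + _]addrC addrK.
Qed.

Lemma sin_coeff_le k : `|(odd k)%:R * (-1) ^+ k.-1./2 * k`!%:R^-1| <= k`!%:R^-1 :> R.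
Proof.
rewrite !normrM normrX normrN1 expr1n mulr1 normfV normr_nat.
by case: (odd k); rewrite normr_nat ?mul1r ?mul0r // invr_ge0.
Qed.

Lemma cos_coeff_le k : `|(~~ odd k)%:R * (-1) ^+ k./2 * k`!%:R^-1| <= k`!%:R^-1 :> R.
Proof.
rewrite !normrM normrX normrN1 expr1n mulr1 normfV normr_nat.
by case: (odd k); rewrite normr_nat ?mul1r ?mul0r // invr_ge0.
Qed.

(** The addition formulas restore the constant term that the composition
   with the power series requires to be zero. *)
Lemma analytic_sincos p f : analytic_fun p f ->
  analytic_fun p (fun x => sin (f x)) /\ analytic_fun p (fun x => cos (f x)).
Proof.
move=> /analytic_center[c H].
have hs : analytic_fun p (fun x => sin (f x - c)).
  apply: (analytic_comp sin_coeff_le _ H) => x.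
  by have := @is_cvg_series_sin_coeff R x; rewrite sin_coeffE unlock sin_coeffE.
have hc : analytic_fun p (fun x => cos (f x - c)).
  apply: (analytic_comp cos_coeff_le _ H) => x.
  by have := @is_cvg_series_cos_coeff R x; rewrite cos_coeffE unlock cos_coeffE.
split.
  rewrite (_ : (fun x => _) = fun x => sin (f x - c) * cos c + cos (f x - c) * sin c).
    by apply: analyticD; apply: analyticM => //; exact: analytic_cst.
  by apply/funext => x; rewrite -sinD subrK.
rewrite (_ : (fun x => _) = fun x => cos (f x - c) * cos c + sin (f x - c) * - sin c).
  by apply: analyticD; apply: analyticM => //; exact: analytic_cst.
by apply/funext => x; rewrite mulrN -cosD subrK.
Qed.

Lemma mkplaneE (z : R * R) : mkplane z = z.1 *: mkplane (1, 0) + z.2 *: mkplane (0, 1).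
Proof. by apply/rowP => i; rewrite !mxE; case: (i == 0) => /=; ring. Qed.

Lemma norm_mkplane_le (z : R * R) : `|mkplane z| <= `|z.1| + `|z.2|.
Proof.
rewrite [leLHS]mx_normrE; apply/bigmax_leP; split; first by rewrite addr_ge0.
by move=> i _; rewrite mxE; case: ifP => _; rewrite ?lerDl ?lerDr.
Qed.

Lemma analytic_at_mkplane (f g : V -> R) p : analytic_fun p f -> analytic_fun p g ->
  analytic_at (fun x => mkplane (f x, g x)) p.
Proof.
move=> /analytic_common H /H[r [B [C [u [v [M [L [r0 [hu MB uf] [hv LC vg]]]]]]]]].
have /choice[a ha] : forall n, exists a : nat -> R, \sum_(i < n.+1) `|a i| <= M n /\
  forall h, u n h = \sum_(i < n.+1) a i * (h 0 0 ^+ i * h 0 1 ^+ (n - i)).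
  by move=> n; case: (hu n) => a; exists a.
have /choice[b hb] : forall n, exists b : nat -> R, \sum_(i < n.+1) `|b i| <= L n /\
  forall h, v n h = \sum_(i < n.+1) b i * (h 0 0 ^+ i * h 0 1 ^+ (n - i)).
  by move=> n; case: (hv n) => b; exists b.
exists (fun i j => mkplane (a (i + j)%N i, b (i + j)%N i)), r; split=> //.
  apply: (@nondecreasing_is_cvgn R).
    apply/nondecreasing_seqP => n; rewrite seriesSr lerDl sumr_ge0 // => i _.
    by rewrite mulr_ge0 // exprn_ge0 // ltW.
  exists (B + C) => _ [N _ <-]; rewrite seriesEord /=.
  apply: le_trans (lerD (MB N) (LC N)); rewrite -big_split; apply: ler_sum => n _ /=.
  rewrite -mulr_suml -mulrDl ler_wpM2r ?exprn_ge0 ?(ltW r0)//.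
  apply: le_trans (lerD (ha n).1 (hb n).1); rewrite -big_split.
  apply: ler_sum => i _; rewrite subnKC; last by rewrite -ltnS.
  exact: norm_mkplane_le.
move=> h hr.
rewrite (_ : series _ = fun N => series (u^~ h) N *: mkplane (1, 0)
  + series (v^~ h) N *: mkplane (0, 1)).
  rewrite [X in _ --> X]mkplaneE; apply: cvgD; apply: cvgZr_tmp; [exact: uf|exact: vg].
apply/funext => N; rewrite !seriesEord /= !scaler_suml -big_split.
apply: eq_bigr => n _ /=; rewrite (ha n).2 (hb n).2 !scaler_suml -big_split.
apply: eq_bigr => i _; rewrite subnKC; last by rewrite -ltnS.
rewrite mkplaneE scalerDr !scalerA.
by rewrite ![_ * (h _ _ ^+ _ * _)]mulrC.
Qed.
End AnalyticAlgebra.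

(** * Elementary functions of two variables *)

Section Elementary.
Variable R : realType.
Local Notation V := (plane R).
Implicit Types (x p v : V) (f g : V -> R).

(** The lifts of all maps of the construction have coordinates in this class,
   which is closed under partial derivatives. *)
Inductive elementary : (V -> R) -> Prop :=
| elementary_affine a b c : elementary (fun x => a + b * x 0 0 + c * x 0 1)
| elementaryD f g : elementary f -> elementary g -> elementary (fun x => f x + g x)
| elementaryM f g : elementary f -> elementary g -> elementary (fun x => f x * g x)
| elementary_sin f : elementary f -> elementary (fun x => sin (f x))
| elementary_cos f : elementary f -> elementary (fun x => cos (f x)).

Lemma elementary_analytic f p : elementary f -> analytic_fun p f.
Proof.
elim=> {f} [a b c|f g _ hf _ hg|f g _ hf _ hg|f _ hf|f _ hf].
- exact: analytic_affine.
- exact: analyticD.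
- exact: analyticM.
- by case: (analytic_sincos hf).
- by case: (analytic_sincos hf).
Qed.

Definition has_deriv f x v (d : R) := differentiable f x /\ 'D_v f x = d.

Lemma has_derivD f g x v d e : has_deriv f x v d -> has_deriv g x v e ->
  has_deriv (fun x => f x + g x) x v (d + e).
Proof.
move=> [df <-] [dg <-]; split; first exact: differentiableD.
by rewrite deriveD //; exact: diff_derivable.
Qed.

Lemma has_derivM f g x v d e : has_deriv f x v d -> has_deriv g x v e ->
  has_deriv (fun x => f x * g x) x v (f x * e + g x * d).
Proof.
move=> [df <-] [dg <-]; split; first exact: differentiableM.
by rewrite deriveM //; exact: diff_derivable.
Qed.

Lemma has_deriv_cst (a : R) x v : has_deriv (fun=> a) x v 0.
Proof. by split; [exact: differentiable_cst|exact: derive_cst]. Qed.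

Lemma has_deriv_coord i x v : has_deriv (fun x => x 0 i) x v (v 0 i).
Proof.
have d : differentiable (fun x : V => x 0 i) x by exact: differentiable_coord.
split=> //; rewrite deriveE //.
have L : linear (fun x : V => x 0 i) by move=> a u w; rewrite !mxE.
pose l : {linear V -> R} := HB.pack (fun x : V => x 0 i)
  (GRing.isLinear.Build _ _ _ _ _ L).
have := @diff_lin R V R l x; rewrite /l /= => -> //.
exact: coord_continuous.
Qed.

Lemma has_deriv_affine (a b c : R) x v :
  has_deriv (fun x => a + b * x 0 0 + c * x 0 1) x v (b * v 0 0 + c * v 0 1).
Proof.
have := has_derivD (has_derivD (has_deriv_cst a x v)
  (has_derivM (has_deriv_cst b x v) (has_deriv_coord 0 x v)))
  (has_derivM (has_deriv_cst c x v) (has_deriv_coord 1 x v)).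
by rewrite !mulr0 !addr0 add0r.
Qed.

Lemma has_deriv_comp1 f (s : R -> R) s' x v d : has_deriv f x v d ->
  is_derive (f x) 1 s s' -> has_deriv (fun x => s (f x)) x v (s' * d).
Proof.
move=> [df <-] hs; have ds : differentiable s (f x).
  by apply/derivable1_diffP; exact: ex_derive.
have dsf : differentiable (s \o f) x by exact: differentiable_comp.
split=> //; rewrite deriveE // diff_comp //= diff1E // deriveE //.
by rewrite derive1E derive_val mulrC.
Qed.

Lemma has_deriv_sin f x v d : has_deriv f x v d ->
  has_deriv (fun x => sin (f x)) x v (cos (f x) * d).
Proof. by move=> h; apply: has_deriv_comp1 h _; exact: is_derive_sin. Qed.

Lemma has_deriv_cos f x v d : has_deriv f x v d ->
  has_deriv (fun x => cos (f x)) x v (- sin (f x) * d).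
Proof. by move=> h; apply: has_deriv_comp1 h _; exact: is_derive_cos. Qed.

Lemma elementary_cst a : elementary (fun=> a).
Proof.
by have := elementary_affine a 0 0; under eq_fun do rewrite !mul0r !addr0.
Qed.

Lemma elementary_deriv f v : elementary f -> exists2 df, elementary df &
  forall x, has_deriv f x v (df x).
Proof.
elim=> {f} [a b c|f g ef [df edf hf] eg [dg edg hg]|f g ef [df edf hf] eg [dg edg hg]|f ef [df edf hf]|f ef [df edf hf]].
- exists (fun=> b * v 0 0 + c * v 0 1); first exact: elementary_cst.
  by move=> x; exact: has_deriv_affine.
- exists (fun x => df x + dg x); first exact: elementaryD.
  by move=> x; exact: has_derivD.
- exists (fun x => f x * dg x + g x * df x).
    by apply: elementaryD; exact: elementaryM.
  by move=> x; exact: has_derivM.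
- exists (fun x => cos (f x) * df x).
    by apply: elementaryM => //; exact: elementary_cos.
  by move=> x; exact: has_deriv_sin.
- exists (fun x => - sin (f x) * df x).
    under eq_fun do rewrite -mulN1r.
    apply: elementaryM => //; apply: elementaryM; first exact: elementary_cst.
    exact: elementary_sin.
  by move=> x; exact: has_deriv_cos.
Qed.

Lemma elementary_differentiable f x : elementary f -> differentiable f x.
Proof. by case/(elementary_deriv 0) => df _ /(_ x)[]. Qed.

Lemma elementary_continuous f : elementary f -> continuous f.
Proof. by move=> ef x; apply: differentiable_continuous; exact: elementary_differentiable. Qed.

Definition lip_at f p := exists C : R,
  \forall x \near p & y \near p, `|f x - f y| <= C * `|x - y|.

Lemma lip_sin (a b : R) : `|sin a - sin b| <= `|a - b|.
Proof.
wlog ab : a b / a <= b => [H|].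
  by case: (leP a b) => [|/ltW] /H//; rewrite distrC [leRHS]distrC.
have [|c _ E] := @MVT_segment R sin cos a b ab.
  by apply: continuous_subspaceT => x; exact: continuous_sin.
by rewrite distrC E normrM distrC ler_piMl // cos_max.
Qed.

Lemma lip_cos (a b : R) : `|cos a - cos b| <= `|a - b|.
Proof.
rewrite -!sinDpihalf; apply: le_trans (lip_sin _ _) _.
by rewrite opprD addrACA subrr addr0.
Qed.

Lemma near_both (P Q : set V) p : (\forall x \near p, P x) -> (\forall y \near p, Q y) ->
  \forall x \near p & y \near p, P x /\ Q y.
Proof. by move=> hP hQ; exists (P, Q). Qed.

Lemma lip_atD f g p : lip_at f p -> lip_at g p -> lip_at (fun x => f x + g x) p.
Proof.
move=> [C hC] [D hD]; exists (C + D).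
apply: filterS2 hC hD => -[x y] /= hx hy; rewrite opprD addrACA mulrDl.
by apply: le_trans (ler_normD _ _) (lerD _ _).
Qed.

Lemma near_bounded f p : {for p, continuous f} ->
  \forall x \near p, `|f x| <= `|f p| + 1.
Proof.
move/cvgrPdist_le => /(_ _ ltr01); apply: filterS => x hx.
by rewrite -[f x](subrK (f p)) (le_trans (ler_normD _ _)) // addrC lerD2l distrC.
Qed.

Lemma lip_atM f g p : {for p, continuous f} -> {for p, continuous g} ->
  lip_at f p -> lip_at g p -> lip_at (fun x => f x * g x) p.
Proof.
move=> cf cg [C hC] [D hD].
exists ((`|f p| + 1) * D + C * (`|g p| + 1)).
have := near_both (near_bounded cf) (near_bounded cg).
apply: filterS3 hC hD => -[x y] /= hx hy [bf bg].
have -> : f x * g x - f y * g y = f x * (g x - g y) + (f x - f y) * g y by ring.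
apply: le_trans (ler_normD _ _) _; rewrite [leRHS]mulrDl !normrM; apply: lerD.
  rewrite -mulrA; exact: ler_pM.
by rewrite mulrAC; apply: ler_pM.
Qed.

Lemma elementary_lip f p : elementary f -> lip_at f p.
Proof.
elim=> {f} [a b c|f g ef hf eg hg|f g ef hf eg hg|f _ [C hf]|f _ [C hf]].
- exists (`|b| + `|c|); exists (setT, setT); first by split; exact: filterT.
  move=> -[x y] _ /=.
  have -> : a + b * x 0 0 + c * x 0 1 - (a + b * y 0 0 + c * y 0 1) =
     b * (x - y) 0 0 + c * (x - y) 0 1 by rewrite !mxE; ring.
  apply: le_trans (ler_normD _ _) _; rewrite !normrM mulrDl.
  by rewrite lerD // ler_wpM2l // norm_coord_le.
- exact: lip_atD.
- by apply: lip_atM => //; exact: elementary_continuous.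
- by exists C; apply: filterS hf => -[x y] /=; apply: le_trans (lip_sin _ _).
- by exists C; apply: filterS hf => -[x y] /=; apply: le_trans (lip_cos _ _).
Qed.

Lemma differentiable_mkplane f g x : differentiable f x -> differentiable g x ->
  differentiable (fun x => mkplane (f x, g x)) x.
Proof.
move=> df dg; under eq_fun do rewrite mkplaneE.
by apply: differentiableD; exact: differentiableZl.
Qed.

Lemma derive_mkplane f g x v d e : has_deriv f x v d -> has_deriv g x v e ->
  'D_v (fun x => mkplane (f x, g x)) x = mkplane (d, e).
Proof.
move=> [df <-] [dg <-].
have D := differentiable_mkplane df dg.
rewrite derive_mx; last exact: diff_derivable.
apply/rowP => i; rewrite !mxE; case: ifP => i0; congr ('D_v _ x);
  by apply/funext => y; rewrite mxE ?(ord1 0) i0.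
Qed.

(** The class is closed under partial derivatives, and its members are locally
   Lipschitz. This gives the Hoelder condition for every exponent [a <= 1],
   since [t <= t `^ a] for [t <= 1]. *)
Lemma elementary_class_on k (a : R) f g : a <= 1 ->
  elementary f -> elementary g -> class_on k a setT (fun x => mkplane (f x, g x)).
Proof.
move=> a1; elim: k f g => [|k IH] f g ef eg /=.
  move=> p _; split.
    apply: differentiable_continuous; apply: differentiable_mkplane;
      exact: elementary_differentiable.
  have [C hC] := elementary_lip p ef; have [D hD] := elementary_lip p eg.
  exists (`|C| + `|D|).
  have nb : \forall x \near p & y \near p, `|x - y| <= 1.
    have h : \forall x \near p, `|x - p| <= 1/2.
      have : (id : V -> V) @ p --> p by exact: cvg_id.
      move/cvgrPdist_le => /(_ (1/2)); rewrite divr_gt0 // => /(_ isT).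
      by apply: filterS => x /=; rewrite distrC.
    have := near_both h h; apply: filterS => -[x y] /= [hx hy].
    have -> : x - y = (x - p) - (y - p) by rewrite opprB addrA subrK.
    apply: le_trans (ler_normB _ _) _; rewrite [leRHS](_ : 1 = 1/2 + 1/2); last by lra.
    exact: lerD.
  apply: filterS3 nb hC hD => -[x y] /= xy1 hx hy.
  have xyp : `|x - y| <= `|x - y| `^ a.
    have [->|nz] := eqVneq (`|x - y|) 0; first exact: powR_ge0.
    by rewrite ger1_powR // xy1 andbT lt_neqAle eq_sym nz normr_ge0.
  have -> : mkplane (f x, g x) - mkplane (f y, g y) = mkplane (f x - f y, g x - g y).
    by apply/rowP => i; rewrite !mxE; case: ifP.
  have bnd (c : R) : c * `|x - y| <= `|c| * `|x - y| `^ a.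
    by apply: le_trans (ler_wpM2r (normr_ge0 _) (ler_norm c)) _; exact: ler_wpM2l.
  apply: le_trans (norm_mkplane_le _) _ => /=; rewrite mulrDl.
  by apply: lerD; [apply: le_trans hx _|apply: le_trans hy _].
split=> [p _|v].
  by apply: differentiable_mkplane; exact: elementary_differentiable.
have [df edf hf] := elementary_deriv v ef; have [dg edg hg] := elementary_deriv v eg.
rewrite (_ : 'D_v _ = fun x => mkplane (df x, dg x)); first exact: IH.
by apply/funext => x; exact: derive_mkplane.
Qed.
End Elementary.

(** * Maps of the torus that preserve its Haar measure *)

Section UnitSquare.
Variable R : realType.
Local Notation lam := (@lebesgue_measure R).
Local Notation T1 := (measurableTypeR R).
Local Notation P2 := (T1 * T1)%type.
Local Notation mu := (@product_measure1 _ _ T1 T1 R lam lam).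
Implicit Types (B : set R) (S : set P2).

Lemma lebesgue_measure_translation B c : measurable (B : set T1) ->
  lam [set x | B (x + c)] = lam B.
Proof.
move=> mB; apply/esym; pose f : R -> T1 := fun x => x + c.
have mf : measurable_fun [set: T1] f.
  apply: (@continuous_measurable_fun _ f) => x.
  by apply: cvgD; [exact: cvg_id|exact: cvg_cst].
rewrite -[RHS]/(pushforward lam f B).
apply: (@lebesgue_measure_unique R (pushforward lam f)) => //= _ [[a b]] _ <-.
rewrite /pushforward.
rewrite (_ : f @^-1` _ = [set` `]a - c, b - c]%R]); last first.
  apply/seteqP; split => x /=; rewrite !in_itv /= => /andP[h1 h2]; apply/andP;
    move: h1 h2; rewrite /f => h1 h2; lra.
rewrite !lebesgue_measure_itv /= !lte_fin ltrD2r.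
by case: ifP => // _; rewrite -!EFinB; congr (_%:E); ring.
Qed.

Lemma measurable_translation B c : measurable (B : set T1) ->
  measurable ([set x | B (x + c)] : set T1).
Proof.
move=> mB; have mf : measurable_fun [set: T1] (fun x : T1 => (x + c : T1)).
  apply: (@continuous_measurable_fun _ (fun x => x + c)) => x.
  by apply: cvgD; [exact: cvg_id|exact: cvg_cst].
by rewrite -[X in measurable X]setTI; apply: mf.
Qed.

Definition periodic1 B := forall x, B (x + 1) <-> B x.

Lemma periodic1_nat B (n : nat) x : periodic1 B -> B (x + n%:R) <-> B x.
Proof.
move=> pB; elim: n x => [|n IH] x; first by rewrite addr0.
by rewrite -natr1 addrA pB IH.
Qed.

Lemma periodic1_int B (k : int) x : periodic1 B -> B (x + k%:~R) <-> B x.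
Proof.
move=> pB; case: k => n; first by rewrite -pmulrn; exact: periodic1_nat.
rewrite NegzE mulrNz -pmulrn.
by rewrite -[in X in _ <-> X](subrK n.+1%:R x) periodic1_nat.
Qed.

Definition unit_itv : set R := [set x | 0 <= x < 1].

Lemma measurable_unit_itv : measurable (unit_itv : set T1).
Proof.
rewrite (_ : unit_itv = [set` `[0, 1[%R]); first exact: measurable_itv.
by apply/seteqP; split => x /=; rewrite in_itv.
Qed.

(** Cut the unit interval into two pieces, which the rotation moves by [c] and
   by [c - 1]. *)
Lemma lebesgue_measure_rotation B c : measurable (B : set T1) -> periodic1 B ->
  lam (unit_itv `&` [set x | B (x + c)]) = lam (unit_itv `&` B).
Proof.
move=> mB pB; wlog /andP[c0 c1] : c / 0 <= c < 1 => [H|].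
  have fl := floor_le c; have fl1 := lt_succ_floor c.
  rewrite -(H (c - (Num.floor c)%:~R)); last first.
    by apply/andP; move: fl fl1; rewrite intrD; split; lra.
  congr (lam (_ `&` _)); apply/seteqP; split => x /=.
    by move=> h; rewrite addrA -mulrNz periodic1_int.
  by rewrite addrA -mulrNz periodic1_int.
pose L := [set x : R | 0 <= x < c] `&` B.
pose H := [set x : R | c <= x < 1] `&` B.
have mitv (a b : R) : measurable ([set x | a <= x < b] : set T1).
  rewrite (_ : [set x | _] = [set` `[a, b[%R]); first exact: measurable_itv.
  by apply/seteqP; split => x /=; rewrite in_itv.
have mL : measurable (L : set T1) by apply: measurableI.
have mH : measurable (H : set T1) by apply: measurableI.
have -> : unit_itv `&` B = L `|` H.
  apply/seteqP; split => x /=; rewrite /unit_itv /L /H /=.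
    move=> [/andP[x0 x1] Bx]; case: (ltP x c) => xc.
      by left; split=> //; rewrite x0.
    by right; split=> //; rewrite x1 andbT.
  move=> [] [/andP[h1 h2] Bx]; split=> //; apply/andP; split; lra.
have -> : unit_itv `&` [set x | B (x + c)] =
    [set x | L (x + (c - 1))] `|` [set x | H (x + c)].
  have E x : B (x + (c - 1)) <-> B (x + c).
    have -> : x + c = x + (c - 1) + 1 by ring.
    by rewrite pB.
  apply/seteqP; split => x /=; rewrite /unit_itv /L /H /= E.
    move=> [/andP[x0 x1] Bx]; case: (ltP x (1 - c)) => xc.
      by right; split=> //; apply/andP; split; lra.
    by left; split=> //; apply/andP; split; lra.
  by move=> [] [/andP[h1 h2] Bx]; split=> //; apply/andP; split; lra.
rewrite !measureU //=; try exact: measurable_translation.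
- by congr (_ + _)%E; apply: lebesgue_measure_translation.
- by apply/seteqP; split => x //= -[[/andP[? ?] _] [/andP[? ?] _]]; lra.
- by apply/seteqP; split => x //= -[[/andP[? ?] _] [/andP[? ?] _]]; lra.
Qed.

Definition unit_square : set P2 := [set z | 0 <= z.1 < 1 /\ 0 <= z.2 < 1].

Lemma unit_squareE : unit_square = unit_itv `*` unit_itv.
Proof. by []. Qed.

Lemma measurable_unit_square : measurable unit_square.
Proof. by rewrite unit_squareE; apply: measurableX; exact: measurable_unit_itv. Qed.

Definition square_measure S := (lam \x lam)%E (unit_square `&` S).

Definition periodic2 S :=
  (forall x, periodic1 (xsection S x)) /\ (forall y, periodic1 (ysection S y)).

Lemma square_measureE1 S : measurable S -> square_measure S =
  (\int[lam]_(x in unit_itv) lam (unit_itv `&` xsection S x))%E.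
Proof.
move=> mS; rewrite /square_measure /product_measure1 [RHS]integral_mkcond.
apply: eq_integral => x _ /=; rewrite patchE; case: ifPn => xi.
  by congr (lam _); apply/seteqP; split => y; rewrite /xsection /= ?inE /=;
    move: xi; rewrite inE => xi; [move=> [[]]|move=> []].
rewrite (_ : xsection _ _ = set0) ?measure0 //.
apply/seteqP; split => y //=; rewrite /xsection /= inE /= => -[[xi' _] _].
by move/negP: xi; apply; rewrite inE.
Qed.

Lemma square_measureE2 S : measurable S -> square_measure S =
  (\int[lam]_(y in unit_itv) lam (unit_itv `&` ysection S y))%E.
Proof.
move=> mS; have mUS : measurable (unit_square `&` S).
  by apply: measurableI => //; exact: measurable_unit_square.
have := @indic_fubini_tonelli _ _ T1 T1 R lam lam _ mUS.
rewrite indic_fubini_tonelli_FE // indic_fubini_tonelli_GE //.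
rewrite /square_measure /product_measure1 => ->.
rewrite [RHS]integral_mkcond.
apply: eq_integral => y _ /=; rewrite patchE; case: ifPn => yi.
  by congr (lam _); apply/seteqP; split => x; rewrite /ysection /= ?inE /=;
    move: yi; rewrite inE => yi; [move=> [[]]|move=> []].
rewrite (_ : ysection _ _ = set0) ?measure0 //.
apply/seteqP; split => x //=; rewrite /ysection /= inE /= => -[[_ yi'] _].
by move/negP: yi; apply; rewrite inE.
Qed.

Lemma measurable_preimage (f : P2 -> P2) S : measurable_fun setT f ->
  measurable S -> measurable (f @^-1` S).
Proof. by move=> mf mS; rewrite -[X in measurable X]setTI; apply: mf. Qed.

Lemma measurable_shear2 (tau : R -> R) : continuous tau ->
  measurable_fun setT (fun z : P2 => (z.1, z.2 + tau z.1) : P2).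
Proof.
move=> ct; apply: measurable_fun_pair; first exact: measurable_fst.
apply: measurable_funD; first exact: measurable_snd.
apply: measurableT_comp; last exact: measurable_fst.
exact: continuous_measurable_fun.
Qed.

Lemma measurable_shear1 (tau : R -> R) : continuous tau ->
  measurable_fun setT (fun z : P2 => (z.1 + tau z.2, z.2) : P2).
Proof.
move=> ct; apply: measurable_fun_pair; last exact: measurable_snd.
apply: measurable_funD; first exact: measurable_fst.
apply: measurableT_comp; last exact: measurable_snd.
exact: continuous_measurable_fun.
Qed.

(** A shear rotates every section, so that its effect disappears after
   integrating over the sections in its direction. *)
Lemma square_measure_shear2 S (tau : R -> R) : continuous tau -> measurable S ->
  periodic2 S -> square_measure [set z | S (z.1, z.2 + tau z.1)] = square_measure S.
Proof.
move=> ct mS [pS _]; have m := measurable_preimage (measurable_shear2 ct) mS.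
rewrite !square_measureE1 //; apply: eq_integral => x _.
rewrite -[RHS](lebesgue_measure_rotation (tau x)) //.
exact: measurable_xsection.
Qed.

Lemma square_measure_shear1 S (tau : R -> R) : continuous tau -> measurable S ->
  periodic2 S -> square_measure [set z | S (z.1 + tau z.2, z.2)] = square_measure S.
Proof.
move=> ct mS [_ pS]; have m := measurable_preimage (measurable_shear1 ct) mS.
rewrite !square_measureE2 //; apply: eq_integral => y _.
rewrite -[RHS](lebesgue_measure_rotation (tau y)) //.
exact: measurable_ysection.
Qed.

Lemma square_measure_translation S (w : P2) : measurable S -> periodic2 S ->
  square_measure [set z | S (z.1 + w.1, z.2 + w.2)] = square_measure S.
Proof.
move=> mS pS.
have cc (c : R) : continuous (fun _ : R => c) by move=> x; exact: cvg_cst.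
rewrite -(square_measure_shear1 (cc w.1) mS pS).
rewrite -(@square_measure_shear2 [set z | S (z.1 + w.1, z.2)] (fun=> w.2)) //.
  exact: measurable_preimage (measurable_shear1 (cc w.1)) mS.
case: pS => pS1 pS2; split=> [x|y] t; rewrite /xsection /ysection /= !inE /=.
  by have := pS1 (x + w.1) t; rewrite /xsection /= !inE.
by rewrite addrAC; have := pS2 y (t + w.1); rewrite /ysection /= !inE.
Qed.

Lemma square_measure_setT : (lam \x lam)%E unit_square = 1%E.
Proof.
have mI := measurable_unit_itv.
have l1 : lam unit_itv = 1%E.
  rewrite (_ : unit_itv = [set` `[0, 1[%R]).
    by rewrite lebesgue_measure_itv /= lte_fin ltr01 oppr0 adde0.
  by apply/seteqP; split => x /=; rewrite in_itv.
transitivity (lam unit_itv * lam unit_itv)%E; last by rewrite l1 mule1.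
exact: product_measure1E.
Qed.

Lemma sigma_finite_plane : sigma_finite setT mu.
Proof.
have /sigma_finiteP[F [TF ndF Foo]] := sigma_finiteT lam.
exists (fun n => F n `*` F n) => [|n]; last first.
  have [mF Fn] := Foo n; split; first exact: measurableX.
  by rewrite product_measure1E // lte_mul_pinfty // ge0_fin_numE.
apply/seteqP; split => // -[x y] _.
have [i _ Fx] : (\bigcup_i F i) x by rewrite -TF.
have [j _ Fy] : (\bigcup_i F i) y by rewrite -TF.
exists (maxn i j) => //; split.
  by move: x Fx; exact/subsetPset/ndF/leq_maxl.
by move: y Fy; exact/subsetPset/ndF/leq_maxr.
Qed.

(** A surjective endomorphism preserves the Haar measure: for every [u], the
   measure of [{z | g z + u \in S}] is that of [g^-1 S], because [u] is the
   image of some [w] and translation by [w] preserves the measure.  Averaging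
   over [u] first gives, by Fubini, the measure of [S] for each fixed [z]. *)
Lemma square_measure_endo S (g : P2 -> P2) : measurable_fun setT g ->
  (forall z w, g (z.1 + w.1, z.2 + w.2) = ((g z).1 + (g w).1, (g z).2 + (g w).2)) ->
  (forall u, exists w, g w = u) ->
  measurable S -> periodic2 S -> periodic2 (g @^-1` S) ->
  square_measure (g @^-1` S) = square_measure S.
Proof.
move=> mg gD gs mS pS pgS;
have mU := measurable_unit_square.
have mgS := measurable_preimage mg mS.
pose add (uz : P2 * P2) : P2 := (uz.1.1 + (g uz.2).1, uz.1.2 + (g uz.2).2).
have madd : measurable_fun setT add.
  have m1 : measurable_fun setT (fun uz : P2 * P2 => uz.1 : P2) by exact: measurable_fst.
  have m2 : measurable_fun setT (fun uz : P2 * P2 => g uz.2 : P2).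
    by apply: measurableT_comp => //; exact: measurable_snd.
  apply: measurable_fun_pair; apply: measurable_funD.
  - by apply: (measurableT_comp (@measurable_fst _ _ T1 T1)).
  - by apply: (measurableT_comp (@measurable_fst _ _ T1 T1)).
  - by apply: (measurableT_comp (@measurable_snd _ _ T1 T1)).
  - by apply: (measurableT_comp (@measurable_snd _ _ T1 T1)).
pose W : set (P2 * P2) := (unit_square `*` unit_square) `&` add @^-1` S.
have mW : measurable W.
  apply: measurableI; first exact: measurableX.
  by rewrite -[X in measurable X]setTI; apply: madd.
pose nu : {sigma_finite_measure set P2 -> \bar R} := HB.pack mu
  (Measure_isSigmaFinite.Build _ _ _ mu sigma_finite_plane).
have FE := @indic_fubini_tonelli_FE _ _ P2 P2 R nu _ mW.
have GE := @indic_fubini_tonelli_GE _ _ P2 P2 R nu _ mW.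
have := @indic_fubini_tonelli _ _ P2 P2 R nu nu _ mW; rewrite FE GE.
have muE X : nu X = mu X by [].
move: nu muE {FE GE} => nu muE.
rewrite (_ : (\int[nu]_x (nu \o xsection W) x)%E =
  (\int[nu]_(u in unit_square) (cst (square_measure (g @^-1` S))) u)%E); last first.
  rewrite [RHS]integral_mkcond; apply: eq_integral => u _; rewrite patchE.
  case: ifPn => uU.
    have [w gw] := gs u.
    rewrite /= muE -(square_measure_translation w mgS pgS) /square_measure.
    congr (mu _); apply/seteqP; split => z; rewrite /xsection /= ?inE /=;
      move: uU; rewrite inE => uU.
      by move=> [[_ zU]]; rewrite /add /= => h; split=> //; rewrite gD gw addrC [_ + u.2]addrC.
    by move=> [zU]; rewrite gD gw addrC [_ + u.2]addrC => h.
  have x0 : xsection W u = set0.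
    apply/seteqP; split => z //=; rewrite /xsection /= inE /= => -[[uU' _] _].
    by move/negP: uU; apply; rewrite inE.
  by rewrite /= x0 measure0.
rewrite (_ : (\int[nu]_x (nu \o ysection W) x)%E =
  (\int[nu]_(u in unit_square) (cst (square_measure S)) u)%E); last first.
  rewrite [RHS]integral_mkcond; apply: eq_integral => z _; rewrite patchE.
  case: ifPn => zU.
    rewrite /= muE -(square_measure_translation (g z) mS pS) /square_measure.
    by congr (mu _); apply/seteqP; split => u; rewrite /ysection /= ?inE /=;
      move: zU; rewrite inE => zU; [move=> [[]]|move=> []].
  have y0 : ysection W z = set0.
    apply/seteqP; split => u //=; rewrite /ysection /= inE /= => -[[_ zU'] _].
    by move/negP: zU; apply; rewrite inE.
  by rewrite /= y0 measure0.
rewrite integral_cst // integral_cst //; set k := (X in (_ * X)%E = _).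
have -> : k = 1%E by exact: etrans (muE _) square_measure_setT.
set l := (X in _ = (_ * X)%E -> _).
have -> : l = 1%E by exact: etrans (muE _) square_measure_setT.
by rewrite !mule1.
Qed.

(** The sigma-algebra of the product measure is generated by rectangles; an open
   set belongs to it as a countable union of rational boxes. *)
Lemma open_measurable_plane (U : set (R * R)) : open U -> measurable (U : set P2).
Proof.
move=> oU.
pose box (q : rat * rat * (rat * rat)) : set P2 :=
  [set` `]ratr q.1.1, ratr q.1.2[%R] `*` [set` `]ratr q.2.1, ratr q.2.2[%R].
have -> : U = \bigcup_q (if pselect (box q `<=` U) then box q else set0).
  apply/seteqP; split => [[x y] Uxy|[x y] [q _]]; last first.
    by case: pselect => // h /h.
  have [[A B] /= [nA nB] AB] : nbhs (x, y) U by apply: open_nbhs_nbhs.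
  have ratbox (a : R) (C : set R) : nbhs a C -> exists q : rat * rat,
      ratr q.1 < a < ratr q.2 /\ [set` `]ratr q.1, ratr q.2[%R] `<=` C.
    move=> /nbhs_ballP[e /= e0 eC].
    have ae : a - e < a by lra.
    have ea : a < a + e by lra.
    have [q1] := rat_in_itvoo ae; have [q2] := rat_in_itvoo ea.
    rewrite !in_itv /= => /andP[a2 e2] /andP[e1 a1].
    exists (q1, q2) => /=; split; first by rewrite a1 a2.
    move=> t; rewrite /= in_itv /= => /andP[t1 t2]; apply: eC.
    by rewrite /ball /= ltr_distlC; apply/andP; split; lra.
  have [p [xp pA]] := ratbox _ _ nA; have [q [yq qB]] := ratbox _ _ nB.
  have pqU : box (p, q) `<=` U.
    by move=> z [] /pA Az /qB Bz; rewrite [z]surjective_pairing; apply: AB.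
  exists (p, q) => //; case: (pselect (box (p, q) `<=` U)) => // _.
apply: countable_bigcupT_measurable => [|q]; first exact: countableP.
set b := is_left _; case: b; last exact: measurable0.
by apply: measurableX; exact: measurable_itv.
Qed.
End UnitSquare.

(** * Maps of the torus given by lifts *)

Section TorusLift.
Variable R : realType.
Local Notation V := (plane R).
Local Notation T2 := (torus R).
Local Open Scope quotient_scope.
Implicit Types (x y n : V) (F G : V -> V).

Lemma tprojP x y : tproj x = tproj y <-> lattice (x - y).
Proof.
pose S := GRing.ZmodClosed.clone _ (@lattice R) _.
have E := @Quotient.idealrBE _ S x y.
split=> h; first by have : x == y %[mod Quotient.quot S] by [apply/eqP]; rewrite -E.
by have : x - y \in S by []; rewrite E => /eqP.
Qed.

Lemma tproj_repr (q : T2) : tproj (repr q) = q.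
Proof. by rewrite /tproj reprK. Qed.

Lemma repr_tproj x : lattice (repr (tproj x) - x).
Proof. by apply/tprojP; exact: tproj_repr. Qed.

Lemma plane_eta x : x = mkplane (x 0 0, x 0 1).
Proof. by apply/rowP => -[[|[|]] //= i]; rewrite mxE /=; congr (x _ _); apply/val_inj. Qed.

Lemma plane_eqP x y : x 0 0 = y 0 0 -> x 0 1 = y 0 1 -> x = y.
Proof. by move=> h0 h1; rewrite (plane_eta x) h0 h1 -plane_eta. Qed.

Lemma mkplane0 z : mkplane z 0 0 = z.1 :> R. Proof. by rewrite mxE. Qed.
Lemma mkplane1 z : mkplane z 0 1 = z.2 :> R. Proof. by rewrite mxE. Qed.

Lemma latticeE n : lattice n = (n 0 0 \is a Num.int) && (n 0 1 \is a Num.int).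
Proof.
apply/idP/andP => [/mxOverP h|[h0 h1]]; first by split.
by apply/mxOverP => i j; rewrite (ord1 i); case: j => [[|[|]] //= j];
  [move: h0|move: h1]; congr (n _ _ \is a _); apply/val_inj.
Qed.

Lemma latticeP n : reflect (exists k l : int, n = mkplane (k%:~R, l%:~R)) (lattice n).
Proof.
rewrite latticeE; apply: (iffP andP) => [[/intrP[k hk] /intrP[l hl]]|[k [l ->]]].
  by exists k, l; rewrite -hk -hl -plane_eta.
by rewrite mkplane0 mkplane1 !intr_int.
Qed.

Lemma tproj_continuous : continuous (@tproj R).
Proof. exact: pi_continuous. Qed.

Lemma tproj_open (U : set V) : open U -> open (@tproj R @` U).
Proof.
move=> oU; rewrite /open /= /quotient_open.
rewrite (_ : _ @^-1` _ = \bigcup_(n in [set n | lattice n]) ((fun x => x + n) @^-1` U)).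
  apply: bigcup_open => n _.
  have c : continuous (fun x : V => x + n).
    by move=> x; apply: (@continuousD _ V V id (cst n)); [move=> A|exact: cst_continuous].
  by move/continuousP: c; apply.
apply/seteqP; split=> [x [y Uy /tprojP yx]|x [n /= nL Uxn]].
  by exists (y - x) => //=; rewrite addrC subrK.
by exists (x + n) => //; apply/tprojP; rewrite addrAC subrr add0r.
Qed.

Definition equivariant F := forall x y, lattice (x - y) -> lattice (F x - F y).

Definition tmap F : T2 -> T2 := fun q => tproj (F (repr q)).

Lemma tmapE F x : equivariant F -> tmap F (tproj x) = tproj (F x).
Proof. by move=> eF; apply/tprojP/eF/repr_tproj. Qed.

Lemma tmap_comp F G : equivariant F -> tmap F \o tmap G = tmap (F \o G).
Proof. by move=> eF; apply/funext => q; exact: tmapE. Qed.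

Lemma equivariant_comp F G : equivariant F -> equivariant G -> equivariant (F \o G).
Proof. by move=> eF eG x y h; apply/eF/eG. Qed.

Lemma equivariant_iter F k : equivariant F -> equivariant (iter k F).
Proof. by move=> eF; elim: k => // k IH x y h /=; apply/eF/IH. Qed.

Lemma tmap_iter F k : equivariant F -> iter k (tmap F) = tmap (iter k F).
Proof.
move=> eF; elim: k => [|k IH]; first by apply/funext => q; rewrite /tmap /= tproj_repr.
by apply/funext => q; rewrite /= IH -[LHS]/((tmap F \o tmap _) q) tmap_comp.
Qed.

Lemma tmap_continuous F : equivariant F -> continuous F -> continuous (tmap F).
Proof.
move=> eF cF; apply/(@quotient_continuous V _ _ (tmap F)).
rewrite (_ : _ \o _ = @tproj R \o F).
  by move=> x; apply: continuous_comp; [exact: cF|exact: tproj_continuous].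
by apply/funext => x; exact: tmapE.
Qed.

Definition pullback (A : set T2) : set (R * R) := [set z | A (tproj (mkplane z))].

Lemma torus_measureE A : torus_measure A = square_measure (pullback A).
Proof.
rewrite /torus_measure /square_measure; congr (_ _).
by apply/seteqP; split => z /= [] => [? ? ?|[? ?] ?]; repeat split.
Qed.

Lemma mkplane_continuous : continuous (@mkplane R).
Proof.
move=> z; rewrite (_ : @mkplane R = fun z => z.1 *: mkplane (1, 0) + z.2 *: mkplane (0, 1)).
  by apply: cvgD; apply: cvgZr_tmp; [exact: cvg_fst|exact: cvg_snd].
by apply/funext => w; rewrite mkplaneE.
Qed.

Lemma pullback_measurable A : torus_borel A ->
  measurable (pullback A : set (measurableTypeR R * measurableTypeR R)).
Proof.
pose G := [set A | measurable (pullback A : set (measurableTypeR R * measurableTypeR R))].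
apply: (@smallest_sub _ (sigma_algebra setT) [set A : set T2 | open A] G).
  split.
  - by rewrite /G /= (_ : pullback set0 = set0) //; exact: measurable0.
  - move=> B mB; rewrite /G /= setTD (_ : pullback _ = ~` pullback B) //.
    exact: measurableC.
  - move=> B mB; rewrite /G /= (_ : pullback _ = \bigcup_k pullback (B k)) //.
    by apply: bigcupT_measurable => k; exact: mB.
move=> B oB; apply: open_measurable_plane.
have c : continuous (@tproj R \o @mkplane R).
  by move=> z; apply: continuous_comp; [exact: mkplane_continuous|exact: tproj_continuous].
by move/continuousP: c; apply.
Qed.

Lemma tproj_shift x n : lattice n -> tproj (x + n) = tproj x.
Proof. by move=> h; apply/tprojP; rewrite addrAC subrr add0r. Qed.

Lemma pullback_periodic A : periodic2 (pullback A).
Proof.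
split=> [x t|y t]; rewrite /xsection /ysection /pullback /= !inE /=.
  rewrite (_ : mkplane (x, t + 1) = mkplane (x, t) + mkplane (0, 1)).
    by rewrite tproj_shift // latticeE mkplane0 mkplane1 /= int_num0 int_num1.
  by apply/rowP => i; rewrite !mxE; case: ifP; rewrite ?addr0.
rewrite (_ : mkplane (t + 1, y) = mkplane (t, y) + mkplane (1, 0)).
  by rewrite tproj_shift // latticeE mkplane0 mkplane1 /= int_num0 int_num1.
by apply/rowP => i; rewrite !mxE; case: ifP; rewrite ?addr0.
Qed.

Lemma torus_borel_preimage (f : T2 -> T2) A : continuous f -> torus_borel A ->
  torus_borel (f @^-1` A).
Proof.
move=> cf; pose G := [set A : set T2 | torus_borel (f @^-1` A)].
have [s0 sD sU] : sigma_algebra setT (@torus_borel R) by exact: smallest_sigma_algebra.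
apply: (@smallest_sub _ (sigma_algebra setT) [set A : set T2 | open A] G).
  split.
  - by rewrite /G /= preimage_set0.
  - by move=> B; rewrite /G /= !setTD preimage_setC -setTD; exact: sD.
  - by move=> B hB; rewrite /G /= preimage_bigcup; exact: sU.
move=> B oB; apply: sub_gen_smallest => /=.
by move/continuousP: cf; apply.
Qed.

Lemma preserves_measure_comp F G : equivariant F -> continuous F ->
  preserves_measure (tmap F) -> preserves_measure (tmap G) ->
  preserves_measure (tmap (F \o G)).
Proof.
move=> eF cF pF pG A bA; rewrite -tmap_comp // comp_preimage pG ?pF //.
exact: torus_borel_preimage (tmap_continuous eF cF) bA.
Qed.

Definition vshear (tau : R -> R) (x : V) : V := mkplane (x 0 0, x 0 1 + tau (x 0 0)).
Definition hshear (tau : R -> R) (x : V) : V := mkplane (x 0 0 + tau (x 0 1), x 0 1).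
Definition ilin (M : 'M[int]_2) (x : V) : V := x *m map_mx intr M.

Definition periodic_fun (tau : R -> R) := forall (k : int) t, tau (t + k%:~R) = tau t.

Lemma equivariant_vshear tau : periodic_fun tau -> equivariant (vshear tau).
Proof.
move=> pt x y /latticeP[k [l E]]; apply/latticeP; exists k, l.
have -> : x = y + mkplane (k%:~R, l%:~R) by rewrite -E addrC subrK.
apply/rowP => i; rewrite !mxE; case: ifP => _ /=; first by ring.
by rewrite pt; ring.
Qed.

Lemma equivariant_hshear tau : periodic_fun tau -> equivariant (hshear tau).
Proof.
move=> pt x y /latticeP[k [l E]]; apply/latticeP; exists k, l.
have -> : x = y + mkplane (k%:~R, l%:~R) by rewrite -E addrC subrK.
apply/rowP => i; rewrite !mxE; case: ifP => _ /=; last by ring.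
by rewrite pt; ring.
Qed.

Lemma lattice_ilin M n : lattice n -> lattice (ilin M n).
Proof.
move=> nL; apply/mxOverP => i j; rewrite mxE; apply: rpred_sum => k _.
by rewrite rpredM // ?mxE ?intr_int //; move/mxOverP: nL; apply.
Qed.

Lemma equivariant_ilin M : equivariant (ilin M).
Proof. by move=> x y h; rewrite /ilin -mulmxBl; exact: lattice_ilin. Qed.

Lemma preserves_vshear tau : periodic_fun tau -> continuous tau ->
  preserves_measure (tmap (vshear tau)).
Proof.
move=> pt ct A bA; rewrite !torus_measureE.
rewrite -(square_measure_shear2 ct (pullback_measurable bA) (pullback_periodic A)).
congr square_measure; apply/funext => z; rewrite /pullback /= tmapE.
  by rewrite /vshear mkplane0 mkplane1.
exact: equivariant_vshear.
Qed.

Lemma preserves_hshear tau : periodic_fun tau -> continuous tau ->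
  preserves_measure (tmap (hshear tau)).
Proof.
move=> pt ct A bA; rewrite !torus_measureE.
rewrite -(square_measure_shear1 ct (pullback_measurable bA) (pullback_periodic A)).
congr square_measure; apply/funext => z; rewrite /pullback /= tmapE.
  by rewrite /hshear mkplane0 mkplane1.
exact: equivariant_hshear.
Qed.

Lemma mulmx_row2 x (A : 'M[R]_2) j : (x *m A) 0 j = x 0 0 * A 0 j + x 0 1 * A 1 j.
Proof.
rewrite mxE !big_ord_recl big_ord0 addr0.
by rewrite (_ : lift ord0 ord0 = 1); last exact/val_inj.
Qed.

Lemma ilin_unit M : \det M != 0 -> (map_mx intr M : 'M[R]_2) \in unitmx.
Proof. by move=> dM; rewrite unitmxE det_map_mx unitfE intr_eq0. Qed.

Lemma preserves_ilin M : \det M != 0 -> preserves_measure (tmap (ilin M)).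
Proof.
move=> dM A bA; rewrite !torus_measureE.
pose A' := map_mx intr M : 'M[R]_2.
pose g (z : measurableTypeR R * measurableTypeR R) : measurableTypeR R * measurableTypeR R :=
  (z.1 * A' 0 0 + z.2 * A' 1 0, z.1 * A' 0 1 + z.2 * A' 1 1).
have gE z : mkplane (g z) = ilin M (mkplane z).
  by apply: plane_eqP; rewrite /ilin mulmx_row2 !mkplane0 !mkplane1.
have pE : pullback (tmap (ilin M) @^-1` A) = g @^-1` pullback A.
  by apply/funext => z; rewrite /pullback /= tmapE ?gE //; exact: equivariant_ilin.
rewrite pE; apply: square_measure_endo.
- by apply: measurable_fun_pair; apply: measurable_funD;
    apply: measurable_funM; try exact: measurable_fst; try exact: measurable_snd;
    exact: measurable_cst.
- by move=> z w; rewrite /g /=; congr pair; ring.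
- move=> u; pose w : V := mkplane u *m invmx A'.
  exists (w 0 0, w 0 1).
  have : mkplane (g (w 0 0, w 0 1)) = mkplane u.
    by rewrite gE -plane_eta /ilin mulmxKV // ilin_unit.
  move=> /rowP E; have := E 0; have := E 1; rewrite !mkplane0 !mkplane1.
  by move=> E1 E0; rewrite [g _]surjective_pairing E1 E0 -surjective_pairing.
- exact: pullback_measurable.
- exact: pullback_periodic.
- by rewrite -pE; exact: pullback_periodic.
Qed.

(** The projection is open, hence so is its product with the identity of the
   parameter space, and continuity descends to the quotient. *)
Lemma tmap_homotopy_continuous (H : R -> V -> V) :
  (forall t, equivariant (H t)) -> continuous (fun z : R * V => H z.1 z.2) ->
  continuous (fun z : R * T2 => tmap (H z.1) z.2).
Proof.
move=> eH cH [t q] U nU.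
have c : continuous (fun z : R * V => tproj (H z.1 z.2)).
  by move=> z; apply: (continuous_comp (cH z)); exact: tproj_continuous.
have [[A B] /= [nA nB] AB] := c (t, repr q) U nU.
exists (A, @tproj R @` (B^°)) => /=; last first.
  move=> [t' q'] /= [At' [y By <-]]; rewrite tmapE //.
  by apply: (AB (t', y)); split=> //=; exact: interior_subset.
split=> //; apply: open_nbhs_nbhs; split; last by exists (repr q); rewrite ?tproj_repr.
by apply: tproj_open; exact: open_interior.
Qed.

Lemma row2_mulP (A B : 'M[R]_2) : (forall v : 'rV[R]_2, v *m A = v *m B) -> A = B.
Proof.
move=> h; apply/matrixP => i j.
by have /rowP/(_ j) := h (delta_mx 0 i); rewrite -!rowE !mxE.
Qed.

(** Two local lifts differ by a continuous function with values in the lattice,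
   which is locally constant. *)
Lemma torus_jacobian_tmap F q : equivariant F -> differentiable F (repr q : V) ->
  torus_jacobian (tmap F) q = 'J F (repr q).
Proof.
move=> eF dF; set x0 : V := repr q.
have ex : is_torus_jacobian (tmap F) q ('J F x0).
  exists F; split=> //; apply: (@filterS _ (nbhs x0) _ setT) => [x _|]; last exact: filterT.
    exact: tmapE.
have := getPex (ex_intro _ _ ex : exists A, is_torus_jacobian (tmap F) q A).
rewrite -/(torus_jacobian _ _) => -[G [nG dG <-]].
have dK : differentiable (F - G) x0 by exact: differentiableB.
have nK : \forall x \near x0, F x - G x = F x0 - G x0.
  have lat x : tmap F (tproj x) = tproj (G x) -> lattice (F x - G x).
    by rewrite tmapE // => /tprojP.
  have l0 : lattice (F x0 - G x0) by apply: lat; exact: nbhs_singleton nG.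
  have /cvgrPdist_lt/(_ _ ltr01) : (F - G) @ x0 --> (F - G) x0.
    exact: differentiable_continuous.
  apply: filterS2 nG => x /lat lx; set n := (F - G) x0 - (F - G) x => n1.
  have ln : lattice n by apply: (rpredB l0 lx : _ \in @lattice R).
  apply/esym/eqP; rewrite -subr_eq0 -/(n); apply/eqP.
  move: ln; rewrite latticeE => /andP[/intrP[k hk] /intrP[l hl]].
  have small (m : int) j : n 0 j = m%:~R -> n 0 j = 0.
    move=> hm; have := le_lt_trans (norm_coord_le n 0 j) n1.
    by rewrite hm -intr_norm ltrz1 => h; have -> : m = 0 by lia.
  by rewrite (plane_eta n) (small k) // (small l) //; apply/rowP => i; rewrite !mxE; case: ifP.
apply: row2_mulP => v.
have jE (H : V -> V) : differentiable H x0 -> v *m 'J H x0 = 'D_v H x0.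
  by move=> dH; exact: esym (deriveEjacobian v dH).
suff E : 'D_v F x0 = 'D_v G x0.
  by apply: etrans (jE G dG) _; apply: etrans (esym E) _; exact: esym (jE F dF).
have : 'D_v (F - G) x0 = 0.
  by rewrite -(derive_cst (F x0 - G x0) x0 v); apply: near_eq_derive.
rewrite deriveB; try exact: diff_derivable.
by move/eqP; rewrite subr_eq0 => /eqP.
Qed.
End TorusLift.

(** * Coincidences of the slope along the cosets of a finite group *)

Section Slope.
Variable R : realType.
Implicit Types (x y z t b d q : R).

Lemma cos_shift_int (k : int) t : cos (t + 2 * pi * k%:~R) = cos t :> R.
Proof.
have h (n : nat) u : cos (u + 2 * pi * n%:R) = cos u :> R.
  rewrite (_ : 2 * pi * n%:R = (pi *+ 2) *+ n); last by ring.
  exact: (periodicn (@cosD2pi R)).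
case: k => n; first by rewrite -pmulrn h.
by rewrite NegzE mulrNz -pmulrn -(h n.+1) mulrN subrK.
Qed.

Lemma sin_shift_int (k : int) t : sin (t + 2 * pi * k%:~R) = sin t :> R.
Proof. by rewrite -!cosBpihalf addrAC cos_shift_int. Qed.

(** The derivative of the vertical shear, up to a factor. *)
Definition slope x : R := cos (2 * pi * x) + cos (4 * pi * x) / 8.

Lemma slope_cos x : slope x = cos (2 * pi * x) + (2 * cos (2 * pi * x) ^+ 2 - 1) / 8.
Proof.
rewrite /slope (_ : 4 * pi * x = (2 * pi * x) *+ 2); last by ring.
by rewrite cos_mulr2n; ring.
Qed.

Lemma slope_le2 x : `|slope x| <= 2.
Proof.
have h1 := cos_max (2 * pi * x); have h2 := cos_max (4 * pi * x).
apply: le_trans (ler_normD _ _) _; rewrite normrM normfV [`|8|]ger0_norm //.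
lra.
Qed.

Lemma slope_shift_int (k : int) x : slope (x + k%:~R) = slope x.
Proof. by rewrite !slope_cos mulrDr cos_shift_int. Qed.

(** The slope is the value of the polynomial [u + (2 * u ^+ 2 - 1) / 8] at
   [u = cos (2 * pi * x)]. The derivative of this polynomial is at least [1 / 2]
   on the interval from [-1] to [1], and a difference of cosines factors into
   sines. *)
Lemma slope_dist x y : `|sin (pi * (x + y))| * `|sin (pi * (x - y))| <= `|slope x - slope y|.
Proof.
rewrite !slope_cos.
have -> : 2 * pi * x = pi * (x + y) + pi * (x - y) by ring.
have -> : 2 * pi * y = pi * (x + y) - pi * (x - y) by ring.
have C1 := cos_max (pi * (x + y) + pi * (x - y)).
have C2 := cos_max (pi * (x + y) - pi * (x - y)).
have E : cos (pi * (x + y) + pi * (x - y)) - cos (pi * (x + y) - pi * (x - y)) =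
  - (2 * (sin (pi * (x + y)) * sin (pi * (x - y)))) by rewrite cosD cosB; ring.
move: E C1 C2; set u := cos (_ + _); set v := cos (_ - _) => E.
rewrite !ler_norml => /andP[u1 u2] /andP[v1 v2].
rewrite -normrM.
have -> : u + (2 * u ^+ 2 - 1) / 8 - (v + (2 * v ^+ 2 - 1) / 8) =
   (u - v) * (1 + (u + v) / 4) by field.
rewrite E; set P := sin _ * sin _.
rewrite (_ : - (2 * P) * _ = P * (- (2 * (1 + (u + v) / 4)))); last by ring.
rewrite [leRHS]normrM normrN -[leLHS]mulr1 ler_wpM2l // ger0_norm; lra.
Qed.

Lemma sin_sub_le x y : `|sin (x - y)| <= `|sin x| + `|sin y| :> R.
Proof.
rewrite sinB; apply: le_trans (ler_normB _ _) _; rewrite !normrM.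
by apply: lerD; [rewrite ler_piMr // cos_max|rewrite ler_piMl // cos_max].
Qed.

Lemma finite_min_gt0 (I : finType) (P : pred I) (f : I -> R) :
  (forall i, P i -> 0 < f i) -> exists2 q : R, 0 < q <= 1 & forall i, P i -> q <= f i.
Proof.
move=> f0; exists (\big[Num.min/1]_(i | P i) f i).
  apply/andP; split; last exact: bigmin_le_id.
  by apply: lt_bigmin => //; exact: ltr01.
by move=> i Pi; apply: bigmin_le_cond.
Qed.

Lemma coset_gap (m : nat) : (0 < m)%N -> exists2 q : R, 0 < q <= 1 &
  forall j j' : 'I_m, j != j' -> q <= `|sin (pi * ((j%:R - j'%:R) / m%:R))|.
Proof.
move=> m0.
pose f (jj : 'I_m * 'I_m) : R := `|sin (pi * ((jj.1%:R - jj.2%:R) / m%:R))|.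
have [|q q0 h] := @finite_min_gt0 _ (fun jj : 'I_m * 'I_m => jj.1 != jj.2) f; last first.
  by exists q => // j j' ne; exact: (h (j, j')).
move=> [j j'] /= ne; rewrite /f /=.
  wlog lt : j j' ne / (j' < j)%N => [H|].
    move: (ne); rewrite -val_eqE /= neq_ltn => /orP[lt|lt]; last exact: H.
    rewrite -normrN -sinN -mulrN -mulNr opprB; apply: H => //.
    by rewrite eq_sym.
  rewrite normr_gt0 gt_eqF // sin_gt0_pi //.
  have mR : 0 < m%:R :> R by rewrite ltr0n.
  have -> : j%:R - j'%:R = (j - j')%N%:R :> R by rewrite natrB // ltnW.
  have k0 : 0 < (j - j')%N%:R :> R by rewrite ltr0n subn_gt0.
  have km : (j - j')%N%:R < m%:R :> R.
    by rewrite ltr_nat; apply: leq_ltn_trans (leq_subr _ _) (ltn_ord j).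
  apply/andP; split; first by rewrite mulr_gt0 ?pi_gt0 // divr_gt0.
  by rewrite gtr_pMr ?pi_gt0 // ltr_pdivrMr // mul1r.
Qed.

Lemma cos_cube_root (t : R) : cos (t * 3%:R) = 1 -> cos t != 1 -> cos t = - (1 / 2).
Proof.
move=> thm w01; set w0 := cos t in w01 *.
have : (w0 - 1) * (2 * w0 + 1) ^+ 2 = 0.
  move: thm; rewrite (_ : t * 3%:R = t *+ 2 + t); last by ring.
  rewrite cosD cos_mulr2n sin_mulr2n -/w0.
  have := sin2cos2 t; rewrite -/w0; set s := sin t => s2 E3.
  have {}E3 : (w0 ^+ 2 * 2 - 1) * w0 - 2 * w0 * s ^+ 2 = 1 by apply: etrans E3; ring.
  have -> : (w0 - 1) * (2 * w0 + 1) ^+ 2 = (w0 ^+ 2 * 2 - 1) * w0 - 2 * w0 * (1 - w0 ^+ 2) - 1 by ring.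
  by rewrite -s2 E3 subrr.
by move/eqP; rewrite mulf_eq0 subr_eq0 (negPf w01) sqrf_eq0 /= => /eqP h; lra.
Qed.

Section Coset.
Variables (m : nat) (q : R) (d : R).
Hypothesis m0 : (0 < m)%N.
Hypothesis q01 : 0 < q <= 1.
Hypothesis gap : forall j j' : 'I_m, j != j' -> q <= `|sin (pi * ((j%:R - j'%:R) / m%:R))|.
Hypothesis d0 : 0 < d.
Hypothesis dq : 4 * d < q ^+ 2.

Local Notation pt b j := (b + j%:R / m%:R).

Lemma coincidence_sum b (j j' : 'I_m) : j != j' ->
  `|slope (pt b j) - slope (pt b j')| < 2 * d ->
  `|sin (pi * (pt b j + pt b j'))| <= 2 * d / q.
Proof.
move=> /gap hq hd; have [q0 _] := andP q01.
rewrite ler_pdivlMr //; apply: ltW; apply: le_lt_trans hd.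
apply: le_trans (slope_dist _ _); rewrite ler_wpM2l //.
by rewrite (_ : pt b j - pt b j' = (j%:R - j'%:R) / m%:R) //; field; rewrite pnatr_eq0 -lt0n.
Qed.

(** Two coincidences force [x + y] to be nearly an integer, and this fixes [y]
   within a coset when [x] is given: a third point would be too close to [y]. *)
Lemma card_coincidences b (bad : pred 'I_m) :
  (forall j j', bad j -> bad j' -> `|slope (pt b j) - slope (pt b j')| < 2 * d) ->
  (#|bad| <= 2)%N.
Proof.
move=> H; rewrite leqNgt; apply/negP => /card_gt2P[x [y [z [[xb yb zb] [xy yz zx]]]]].
have [q0 _] := andP q01.
have h1 := coincidence_sum xy (H _ _ xb yb).
have h2 : `|sin (pi * (pt b x + pt b z))| <= 2 * d / q.
  by apply: coincidence_sum; [rewrite eq_sym|exact: H].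
have := gap yz.
have -> : pi * ((y%:R - z%:R) / m%:R) =
   pi * (pt b x + pt b y) - pi * (pt b x + pt b z) by field; rewrite pnatr_eq0 -lt0n.
move/le_trans => /(_ _ (sin_sub_le _ _)) h3.
have : q <= 4 * d / q by apply: le_trans h3 _; move: h1 h2; lra.
by rewrite ler_pdivlMr // -expr2 leNgt dq.
Qed.

(** In a coset of order 3 or 4 two points [x], [y] with [x + y] an integer
   satisfy [cos (4 * pi * x) \in {-1, -1/2, 0}], and no such point is a zero of
   the slope: this is what the second harmonic is for. Indeed
   [w = cos (4 * pi * x)] satisfies [w + 1 - w ^+ 2 / 32 = 0] at a zero of the
   slope, and none of the three values is a root. *)
Lemma card_slope_zeros b : m = 3%N \/ m = 4%N -> d < q / 1000 ->
  (#|[pred j : 'I_m | (`|slope (pt b j)| < d)%R]| <= 1)%N.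
Proof.
move=> m34 dq'; rewrite leqNgt; apply/negP => /card_gt1P[x [y [xb yb xy]]].
have [q0 q1] := andP q01.
move: xb yb; rewrite !inE => xb yb.
have xyd : `|slope (pt b x) - slope (pt b y)| < 2 * d.
  by apply: le_lt_trans (ler_normB _ _) _; lra.
have hs := coincidence_sum xy xyd.
have mR : m%:R != 0 :> R by rewrite pnatr_eq0 -lt0n.
pose th := 2 * pi * ((x%:R - y%:R) / m%:R) : R.
pose w0 := cos th; pose w := cos (4 * pi * pt b x).
have sq : q <= `|sin (pi * ((x%:R - y%:R) / m%:R))| by exact: gap.
have w01 : w0 != 1.
  rewrite /w0 /th (_ : 2 * pi * _ = (pi * ((x%:R - y%:R) / m%:R)) *+ 2); last first.
    by ring.
  rewrite cos_mulr2n cos2sin2; apply/eqP => E.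
  have : sin (pi * ((x%:R - y%:R) / m%:R)) ^+ 2 = 0 :> R by move: E; rewrite mulr2n; lra.
  by move/eqP; rewrite sqrf_eq0 => /eqP E2; move: sq; rewrite E2 normr0; lra.
have thm : cos (th * m%:R) = 1.
  rewrite /th (_ : _ * m%:R = 0 + 2 * pi * ((Posz x - Posz y)%:~R)).
    by rewrite cos_shift_int cos0.
  by rewrite intrB -!pmulrn; field.
have w0v : [|| w0 == - 1, w0 == 0 | w0 == - (1 / 2)].
  case: m34 => E; rewrite E in thm.
    by apply/or3P/Or33/eqP; exact: cos_cube_root.
  have : (2 * w0 ^+ 2 - 1) ^+ 2 = 1.
    move: thm; rewrite (_ : th * 4%:R = (th *+ 2) *+ 2); last by ring.
    rewrite !cos_mulr2n -/w0 => E4.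
    have : 2 * (2 * w0 ^+ 2 - 1) ^+ 2 - 1 = 1 by apply: etrans E4; ring.
    lra.
  move=> E5; have /eqP : 4 * (w0 * w0) * ((w0 - 1) * (w0 + 1)) = 0.
    by apply: etrans (_ : (2 * w0 ^+ 2 - 1) ^+ 2 - 1 = 0); [ring|rewrite E5 subrr].
  rewrite !mulf_eq0 pnatr_eq0 /= orbb subr_eq0 (negPf w01) /= => /orP[/eqP->|].
    by rewrite eqxx orbT.
  by rewrite addr_eq0 => ->.
have ww : `|w - w0| <= 4 * d / q.
  have -> : w - w0 = - (2 * (sin (pi * (pt b x + pt b y)) * sin (pi * (pt b x + pt b y) + th))).
    rewrite /w /w0.
    have -> : 4 * pi * pt b x = (pi * (pt b x + pt b y) + th) + pi * (pt b x + pt b y).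
      by rewrite /th; field.
    have -> : cos th = cos ((pi * (pt b x + pt b y) + th) - pi * (pt b x + pt b y)).
      by congr cos; ring.
    by rewrite cosD cosB; ring.
  rewrite normrN !normrM [`|2|]ger0_norm //.
  have s1 := sin_max (pi * (pt b x + pt b y) + th).
  have : `|sin (pi * (pt b x + pt b y))| * `|sin (pi * (pt b x + pt b y) + th)|
      <= 2 * d / q * 1 by apply: ler_pM.
  lra.
have Ew : w + 1 - w ^+ 2 / 32 = 2 * slope (pt b x) ^+ 2 - slope (pt b x) * w / 2.
  have : w = 2 * cos (2 * pi * pt b x) ^+ 2 - 1.
    rewrite /w (_ : 4 * pi * pt b x = (2 * pi * pt b x) *+ 2).
      by rewrite cos_mulr2n; ring.
    by ring.
  by rewrite /slope -/w; set C := cos _ => ->; field.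
have w1 : `|w| <= 1 by exact: cos_max.
have dd : 4 * d / q < 4 / 1000 by rewrite ltr_pdivrMr //; lra.
have d1 : d < 1 / 1000 by lra.
move: Ew; set s := slope _ => Ew.
have {}xb : `|s| < d by [].
have rhs : `|2 * s ^+ 2 - s * w / 2| <= 3 * d.
  apply: le_trans (ler_normB _ _) _; rewrite !normrM normfV.
  rewrite [`|2|]ger0_norm //.
  have H1 : `|s| * `|s| <= d * 1 by apply: ler_pM => //; lra.
  have H2 : `|s| * `|w| <= d * 1 by apply: ler_pM => //; lra.
  have g (u v : R) : u <= d * 1 -> v <= d * 1 -> 2 * u + v / 2 <= 3 * d.
    by move=> hu hv; have := d0; lra.
  exact: g.
rewrite -Ew in rhs.
move: rhs ww w1; rewrite !ler_norml => /andP[r1 r2] /andP[e1 e2] /andP[wl wu].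
have w2a : 0 <= w ^+ 2 by exact: sqr_ge0.
have w2b : w ^+ 2 <= 1 by rewrite -[leRHS](expr1n _ 2) -real_normK ?num_real // lerXn2r ?nnegrE // ler_norml wl wu.
suff : (1 : R) <= 0 by rewrite ler10.
have d0' := d0.
case/or3P: w0v => /eqP wE; rewrite wE in e1 e2.
- have : 0 <= (- w - (1 - 4 / 1000)) * (- w + (1 - 4 / 1000)).
    by apply: mulr_ge0; lra.
  rewrite (_ : _ * _ = w ^+ 2 - (1 - 4 / 1000) ^+ 2); last by ring.
  rewrite expr2 [in X in 0 <= _ - X]expr2; lra.
- lra.
- lra.
Qed.

End Coset.

Lemma sin_lower (u : R) : `|u| <= 1 -> cos 1 * `|u| <= `|sin u|.
Proof.
wlog u0 : u / 0 <= u => [H|].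
  case: (leP 0 u) => [|/ltW] u0; first exact: H.
  by rewrite -normrN -[`|sin u|]normrN -sinN; apply: H; rewrite ?normrN ?oppr_ge0.
rewrite ger0_norm // => u1.
have [|x xI E] := @MVT_segment R sin cos 0 u u0.
  by apply: continuous_subspaceT => x; exact: continuous_sin.
move: xI; rewrite in_itv /= => /andP[x0 xu].
move: E; rewrite sin0 !subr0 => ->; rewrite normrM [`|u|]ger0_norm // ler_wpM2r //.
apply: le_trans (ler_norm _).
have x1 : x <= 1 by apply: le_trans u1.
have pi1 : 1 <= pi :> R by apply: le_trans (@pi_ge2 R); rewrite ler1n.
have h1 : (1 : R) \in `[0, pi] by rewrite in_itv /= ler01.
have hx : x \in `[0, pi] by rewrite in_itv /= x0 (le_trans x1).
by move: x1; rewrite le_eqVlt => /orP[/eqP-> //|x1]; rewrite ltW // ltr_cos.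
Qed.

Lemma norm_sin_shift_pi (k : int) (t : R) : `|sin (t + pi * k%:~R)| = `|sin t|.
Proof.
apply/eqP; rewrite -(@eqrXn2 _ 2) // !real_normK ?num_real // !sin2cos2.
have h (x : R) : cos x ^+ 2 = (cos (x *+ 2) + 1) / 2 by rewrite cos_mulr2n; field.
by rewrite !h (_ : (t + pi * k%:~R) *+ 2 = t *+ 2 + 2 * pi * k%:~R) ?cos_shift_int //; ring.
Qed.

Lemma norm_sin3 (t : R) : `|sin (3 * t)| <= 3 * `|sin t|.
Proof.
have -> : sin (3 * t) = sin t * (3 - 4 * sin t ^+ 2).
  rewrite (_ : 3 * t = t *+ 2 + t); last by ring.
  rewrite sinD cos_mulr2n sin_mulr2n cos2sin2 .
  have := cos2sin2 t; set C := cos t; set S := sin t => h.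
  by transitivity (2 * C ^+ 2 * S + (1 - 2 * S ^+ 2) * S); [ring|rewrite h; ring].
rewrite normrM mulrC ler_wpM2r // ler_norml.
have s0 := sqr_ge0 (sin t).
have s1 : sin t ^+ 2 <= 1 by rewrite sin2cos2 lerBlDr lerDl sqr_ge0.
by apply/andP; split; lra.
Qed.

Lemma cos_third : cos (2 * pi / 3) = - (1 / 2) :> R.
Proof.
apply: cos_cube_root.
  rewrite (_ : _ * 3%:R = 0 + 2 * pi * (1%:Z)%:~R) ?cos_shift_int ?cos0 //; by field.
rewrite (_ : 2 * pi / 3 = (pi / 3) *+ 2); last by field.
rewrite cos_mulr2n cos2sin2; apply/eqP => E.
have p0 := @pi_gt0 R.
have : 0 < sin (pi / 3) :> R by apply: sin_gt0_pi; apply/andP; split; lra.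
move=> h; have := mulr_gt0 h h; rewrite -expr2; move: E; rewrite mulr2n; lra.
Qed.

(** The values at three equidistant points have sum [0] and sum of squares
   [3 / 2], so that they cannot be close to each other. *)
Lemma thirds_spread (z : R) : exists i j : 'I_3,
  1 <= `|sin (2 * pi * (z + i%:R / 3%:R)) - sin (2 * pi * (z + j%:R / 3%:R))|.
Proof.
pose s (i : 'I_3) := sin (2 * pi * (z + i%:R / 3%:R)).
case: (pselect (exists i j, 1 <= `|s i - s j|)) => // H; exfalso.
have lt i j : (s i - s j) ^+ 2 < 1.
  rewrite -[ltRHS](expr1n _ 2) -real_normK ?num_real // ltrXn2r ?nnegrE //.
  by rewrite ltNge; apply/negP => h; apply: H; exists i, j.
pose A := sin (2 * pi * z); pose B := cos (2 * pi * z); pose t := sin (2 * pi / 3) : R.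
have t2 : t ^+ 2 = 3 / 4 by rewrite /t sin2cos2 cos_third; field.
have e0 : s 0 = A by rewrite /s /A mul0r addr0.
have e1 : s 1 = - A / 2 + B * t.
  rewrite /s (_ : nat_of_ord (1 : 'I_3) = 1%N) //.
  rewrite (_ : 2 * pi * (z + 1 / 3%:R) = 2 * pi * z + 2 * pi / 3); last by field.
  by rewrite sinD cos_third -/A -/B -/t; field.
have e2 : s ord_max = - A / 2 - B * t.
  rewrite /s /= (_ : 2 * pi * (z + 2%:R / 3%:R) =
    2 * pi * z - 2 * pi / 3 + 2 * pi * (1%:Z)%:~R); last by field.
  by rewrite sin_shift_int sinB cos_third -/A -/B -/t; field.
have AB : B ^+ 2 + A ^+ 2 = 1 by exact: cos2Dsin2.
have h1 := lt 1 ord_max; have h2 := lt 0 1; have h3 := lt 0 ord_max.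
rewrite e1 e2 in h1; rewrite e0 e1 in h2; rewrite e0 e2 in h3.
have E1 : (- A / 2 + B * t - (- A / 2 - B * t)) ^+ 2 = 4 * B ^+ 2 * t ^+ 2 by field.
have E2 : (A - (- A / 2 + B * t)) ^+ 2 + (A - (- A / 2 - B * t)) ^+ 2 = 9 / 2 * A ^+ 2 + 2 * B ^+ 2 * t ^+ 2 by field.
rewrite t2 in E1 E2.
suff : (1 : R) <= 0 by rewrite ler10.
lra.
Qed.

Lemma card_rows (p m : nat) (bad : pred ('I_p * 'I_m)) :
  #|bad| = (\sum_(i < p) #|[pred j | bad (i, j)]|)%N.
Proof.
rewrite -sum1_card.
under [RHS]eq_bigr do rewrite -sum1_card.
by rewrite pair_big_dep /=; apply: eq_bigl => -[i j].
Qed.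

(** The abscissa, in the coordinates of the shears, at which the vertical shear
   acts on the preimage with index [ij]. *)
Definition branch_pt (p m : nat) (c : int) (eta b z : R) (ij : 'I_p * 'I_m) : R :=
  b + c%:~R * (ij.1%:R / p%:R) - eta * sin (2 * pi * (z + ij.1%:R / p%:R)) + ij.2%:R / m%:R.

(** [k0] bounds the number of branches on which the slope is small and [k1]
   the number of those on which it is close to a prescribed value. For [m = 3]
   a family of six coincidences would contain two in each of the three rows.
   Each pair forces [b + c * i / 3 - eta * sin (2 * pi * (z + i / 3))] to be
   nearly in the lattice generated by [1 / 6]; tripling the angles removes the
   dependence on [c * i / 3] and on [j], and then the values of the sine at
   three equidistant points would have to be close to each other. *)
Lemma slope_counting (p m : nat) (c : int) (eta : R) :
    (0 < p)%N -> (3 <= m)%N -> (m = 3%N -> p = 3%N) -> (4 < p * m)%N ->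
    0 < eta -> 12 * pi * eta <= 1 ->
  exists (d : R) (k0 k1 : nat), [/\ 0 < d, (k0 + k1 < p * m)%N & forall b z : R,
    (#|[pred ij | (`|slope (branch_pt c eta b z ij)| < d)%R] : pred ('I_p * 'I_m)| <= k0)%N /\
    forall bad : pred ('I_p * 'I_m), (forall i j j', bad (i, j) -> bad (i, j') ->
      `|slope (branch_pt c eta b z (i, j)) - slope (branch_pt c eta b z (i, j'))| < 2 * d) ->
    (#|bad| <= k1)%N].
Proof.
move=> p0 m3 mp3 pm4 eta0 eta1.
have m0 : (0 < m)%N by apply: leq_trans m3.
have [q q01 gap] := coset_gap m0; have [q0 q1] := andP q01.
have c1 : 0 < cos 1 :> R by exact: cos1_gt0.
have pi0 := @pi_gt0 R.
pose e := cos 1 * (pi * eta) : R.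
have e0 : 0 < e by rewrite !mulr_gt0.
pose d := Num.min (q ^+ 2 / 8) (Num.min (q / 2000) (e * q / 4)).
have d0 : 0 < d.
  have q2 : 0 < q ^+ 2 by exact: exprn_gt0.
  have eq0 : 0 < e * q by exact: mulr_gt0.
  rewrite /d !lt_min; apply/andP; split; [|apply/andP; split];
    apply: divr_gt0; rewrite ?ltr0n //.
have dq : 4 * d < q ^+ 2.
  have : d <= q ^+ 2 / 8 by rewrite ge_min lexx.
  have : 0 < q ^+ 2 by exact: exprn_gt0.
  lra.
have dq' : d < q / 1000.
  have : d <= q / 2000 by rewrite !ge_min lexx orbT.
  lra.
have de : d <= e * q / 4 by rewrite !ge_min lexx !orbT.
have ptE b z (i : 'I_p) (j : 'I_m) : branch_pt c eta b z (i, j) =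
  (b + c%:~R * (i%:R / p%:R) - eta * sin (2 * pi * (z + i%:R / p%:R))) + j%:R / m%:R by [].
have row2 b (z : R) (bad : pred ('I_p * 'I_m)) : (forall i j j', bad (i, j) -> bad (i, j') ->
      `|slope (branch_pt c eta b z (i, j)) - slope (branch_pt c eta b z (i, j'))| < 2 * d) ->
    forall i, (#|[pred j | bad (i, j)]| <= 2)%N.
  move=> H i; apply: (card_coincidences m0 q01 gap dq) => j j' /= bj bj'.
  by have := H _ _ _ bj bj'; rewrite !ptE; apply.
exists d; exists (if (m <= 4)%N then p else (p * 2)%N).
exists (if m == 3%N then 5%N else (p * 2)%N).
split=> // [|b z].
  case: eqP => [m3'|/eqP m3']; first by rewrite m3' (mp3 m3').
  case: ifP => h4.
    have -> : m = 4%N by apply/eqP; rewrite eqn_leq h4 ltn_neqAle eq_sym m3'.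
    by rewrite -[X in (X + _)%N]muln1 -mulnDr ltn_pmul2l.
  by rewrite -mulnDr ltn_pmul2l // ltnNge h4.
split.
  rewrite card_rows; case: ifP => h4.
    apply: (@leq_trans (\sum_(i < p) 1)%N); last by rewrite sum_nat_const card_ord muln1.
    apply: leq_sum => i _.
    have m34 : m = 3%N \/ m = 4%N.
      by move: m3 h4; clear; case: m => [|[|[|[|[|]]]]] //; [left|right].
    have := card_slope_zeros m0 q01 gap d0
      (b + c%:~R * (i%:R / p%:R) - eta * sin (2 * pi * (z + i%:R / p%:R))) m34 dq'.
    by apply: leq_trans; rewrite leq_eqVlt; apply/orP; left; apply/eqP; apply: eq_card.
  apply: (@leq_trans (\sum_(i < p) 2)%N); last by rewrite sum_nat_const card_ord.
  apply: leq_sum => i _.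
  apply: (row2 b z [pred ij | (`|slope (branch_pt c eta b z ij)| < d)%R]) => {i} i j j' /= h1 h2.
  by apply: le_lt_trans (ler_normB _ _) _; lra.
move=> bad H; have {row2} row2 := row2 _ _ _ H; rewrite card_rows.
case: ifP => [/eqP m3'|_]; last first.
  apply: (@leq_trans (\sum_(i < p) 2)%N); last by rewrite sum_nat_const card_ord.
  by apply: leq_sum => i _; exact: row2.
rewrite leqNgt; apply/negP => big.
have p3 := mp3 m3'; subst p m.
have full i : #|[pred j | bad (i, j)]| = 2%N.
  apply/eqP; rewrite eqn_leq row2 /= leqNgt; apply/negP => lt2.
  move: big; rewrite (bigD1 i) //= ltnNge; apply/negP; rewrite negbK.
  have : (\sum_(k < 3 | k != i) #|[pred j | bad (k, j)]| <= \sum_(k < 3 | k != i) 2)%N.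
    by apply: leq_sum => k _; exact: row2.
  rewrite sum_nat_const cardC1 card_ord => h.
  exact: leq_add lt2 h.
have nr (i : 'I_3) : `|sin (6 * pi * (b - eta * sin (2 * pi * (z + i%:R / 3%:R))))| <= 6 * d / q.
  have [j [j' [bj bj' jj']]] : exists j j', [/\ bad (i, j), bad (i, j') & j != j'].
    have /card_gt1P[j [j' [bj bj' jj']]] : (1 < #|[pred j | bad (i, j)]|)%N by rewrite full.
    by exists j, j'.
  have := H _ _ _ bj bj'; rewrite !ptE.
  move/(coincidence_sum m0 q01 gap jj') => h.
  have := norm_sin3 (pi * (branch_pt c eta b z (i, j) + branch_pt c eta b z (i, j'))).
  rewrite !ptE => h'; have := le_trans h' (ler_wpM2l (ler0n _ 3) h).
  rewrite (_ : 3 * (pi * _) = 6 * pi * (b - eta * sin (2 * pi * (z + i%:R / 3%:R)))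
    + pi * ((2 * c * (i : nat) + (j : nat) + (j' : nat))%:~R)); last first.
    by rewrite !intrD !intrM -!pmulrn; field.
  by rewrite norm_sin_shift_pi => /le_trans; apply; rewrite -mulrA [3 * _]mulrA -natrM mulrA.
have [i [j h]] := thirds_spread z.
move: h (nr i) (nr j); set si := sin (2 * pi * _); set sj := sin (2 * pi * _) => h hi hj.
have sij : `|si - sj| <= 2.
  by apply: le_trans (ler_normB _ _) _; have := sin_max (2 * pi * (z + i%:R / 3%:R));
    have := sin_max (2 * pi * (z + j%:R / 3%:R)); rewrite -/si -/sj; lra.
pose u := 6 * pi * eta * (si - sj).
have pe0 : 0 < pi * eta by rewrite mulr_gt0.
have uE : `|u| = 6 * (pi * eta) * `|si - sj|.
  by rewrite /u -[6 * pi * eta]mulrA normrM ger0_norm // mulr_ge0 // ltW.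
have u1 : `|u| <= 1.
  have : 6 * (pi * eta) * `|si - sj| <= 6 * (pi * eta) * 2 by rewrite ler_wpM2l // mulr_ge0 // ltW.
  by rewrite uE; move: eta1; rewrite -mulrA; lra.
have u2 : 6 * (pi * eta) <= `|u| by rewrite uE ler_peMr // mulr_ge0 // ltW.
have := sin_lower u1.
have -> : u = 6 * pi * (b - eta * sj) - 6 * pi * (b - eta * si) by rewrite /u; ring.
have h2 := sin_sub_le (6 * pi * (b - eta * sj)) (6 * pi * (b - eta * si)).
move=> /le_trans /(_ h2); apply/negP; rewrite -ltNge.
apply: le_lt_trans (lerD hj hi) _.
rewrite -(_ : u = 6 * pi * (b - eta * sj) - 6 * pi * (b - eta * si)); last by rewrite /u; ring.
apply: (@lt_le_trans _ _ (cos 1 * (6 * (pi * eta)))); last by rewrite ler_wpM2l // ltW.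
have dq2 : d / q <= e / 4 by rewrite ler_pdivrMr // mulrAC.
have -> : cos 1 * (6 * (pi * eta)) = 6 * e by rewrite /e; ring.
rewrite -!mulrA; lra.
Qed.
End Slope.

(** * One step of the derivative cocycle *)

Section OneStep.
Variable R : realType.

Definition maxabs (w1 w2 : R) := Num.max `|w1| `|w2|.

Lemma maxabs_gt0 (w1 w2 : R) : (w1 != 0) || (w2 != 0) -> 0 < maxabs w1 w2.
Proof. by rewrite /maxabs lt_max !normr_gt0. Qed.

Variables b00 b01 b10 b11 : R.
Hypothesis b10_neq0 : b10 != 0.
Hypothesis det_neq0 : b00 * b11 - b01 * b10 != 0.

Definition abs_sum := `|b00| + `|b01| + `|b10| + `|b11|.
Definition cone_width := `|b10| / (4 * abs_sum).
Local Notation M := abs_sum.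
Local Notation beta := `|b10|.
Local Notation kappa := cone_width.

(** Directions that the next shear moves to nearly vertical ones; the vertical
   direction itself is mapped inside this cone because [b10 != 0]. *)
Definition good (w1 w2 : R) := kappa * `|w2| <= `|w1|.

Let beta0 : 0 < beta. Proof. by rewrite normr_gt0. Qed.
Let betaM : beta <= M.
Proof.
have h0 := normr_ge0 b00; have h1 := normr_ge0 b01; have h2 := normr_ge0 b11.
by rewrite /abs_sum; have := h0; have := h1; have := h2; lra.
Qed.
Let M0 : 0 < M. Proof. exact: lt_le_trans betaM. Qed.

Lemma cone_width_bounds : 0 < kappa <= 1 / 4.
Proof.
have M0' := M0; have bM := betaM.
rewrite /cone_width divr_gt0 ?mulr_gt0 //= ler_pdivrMr ?mulr_gt0 //; lra.
Qed.

Let n1 (r1 r2 : R) := r1 * b00 + r2 * b10.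
Let n2 (r1 r2 : R) := r1 * b01 + r2 * b11.

Lemma image_vertical (r1 r2 : R) : `|r1| <= beta / (2 * M) * `|r2| ->
  beta / 2 * `|r2| <= `|n1 r1 r2| /\ good (n1 r1 r2) (n2 r1 r2).
Proof.
have M0' := M0; have bM := betaM; have b0 := beta0.
move=> hr.
have a0 := normr_ge0 b00; have a1 := normr_ge0 b01; have a3 := normr_ge0 b11.
have rr0 := normr_ge0 r2.
have r1M : `|r1| * M <= beta / 2 * `|r2|.
  apply: le_trans (ler_wpM2r (ltW M0') hr) _.
  by rewrite le_eqVlt; apply/orP; left; apply/eqP; field; rewrite gt_eqF.
have r1r2 : `|r1| <= `|r2|.
  apply: le_trans hr _; rewrite ler_piMl // ler_pdivrMr ?mulr_gt0 //; lra.
have h1 : beta / 2 * `|r2| <= `|n1 r1 r2|.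
  have : `|r2 * b10| <= `|n1 r1 r2| + `|r1 * b00|.
    rewrite (_ : r2 * b10 = n1 r1 r2 - r1 * b00); last by rewrite /n1; ring.
    exact: ler_normB.
  rewrite !normrM => h.
  have : `|r1| * `|b00| <= `|r1| * M.
    by rewrite ler_wpM2l // /abs_sum; have := normr_ge0 b10; lra.
  lra.
split=> //; rewrite /good; apply: le_trans _ h1.
have : `|n2 r1 r2| <= 2 * M * `|r2|.
  apply: le_trans (ler_normD _ _) _; rewrite !normrM.
  have : `|r1| * `|b01| <= `|r2| * M.
    by apply: ler_pM => //; rewrite /abs_sum; have := normr_ge0 b10; lra.
  have : `|r2| * `|b11| <= `|r2| * M.
    by rewrite ler_wpM2l // /abs_sum; have := normr_ge0 b10; lra.
  lra.
have [k0 _] := andP cone_width_bounds.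
move=> /(ler_wpM2l (ltW k0)) /le_trans; apply.
by rewrite le_eqVlt; apply/orP; left; apply/eqP; rewrite /cone_width; field; rewrite gt_eqF.
Qed.

Let lambda := `|b00 * b11 - b01 * b10| / (2 * M).

Lemma image_lower (r1 r2 : R) :
  lambda * `|r1| <= maxabs (n1 r1 r2) (n2 r1 r2) /\
  lambda * `|r2| <= maxabs (n1 r1 r2) (n2 r1 r2).
Proof.
have M0' := M0.
set N := maxabs _ _; set D := b00 * b11 - b01 * b10.
have N1 : `|n1 r1 r2| <= N by rewrite /N /maxabs le_max lexx.
have N2 : `|n2 r1 r2| <= N by rewrite /N /maxabs le_max lexx orbT.
have N0 : 0 <= N by apply: le_trans N1.
have key (r x y : R) : r * D = n1 r1 r2 * x - n2 r1 r2 * y -> `|x| <= M -> `|y| <= M ->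
    lambda * `|r| <= N.
  move=> E hx hy; rewrite /lambda -/D mulrAC ler_pdivrMr ?mulr_gt0 // mulrC -normrM E.
  apply: le_trans (ler_normB _ _) _; rewrite !normrM.
  have : `|n1 r1 r2| * `|x| <= N * M by apply: ler_pM.
  have : `|n2 r1 r2| * `|y| <= N * M by apply: ler_pM.
  lra.
have a0 := normr_ge0 b00; have a1 := normr_ge0 b01; have a2 := normr_ge0 b10; have a3 := normr_ge0 b11.
split.
- by apply: (key _ b11 b10); [rewrite /D /n1 /n2; ring|rewrite /abs_sum; lra|rewrite /abs_sum; lra].
- apply: (key _ (- b01) (- b00)); rewrite ?normrN /abs_sum; [|lra|lra].
  by rewrite /D /n1 /n2; ring.
Qed.

(** One branch of the inverse derivative acts on the direction [(w1, w2)] by a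
   weak horizontal shear [g], a strong vertical shear [T * s] and the fixed
   matrix of the [b]'s. Any vector is contracted at most by a factor of the order
   of [T], the size of the inverse shear. A good vector has a first coordinate of
   the order of its norm, which the vertical shear preserves; this excludes
   contraction, and a slope away from [0] turns it into an expansion by [T].
   The last bound covers any vector whose second coordinate is not almost
   cancelled by the vertical shear. *)
Lemma one_step (delta : R) : 0 < delta -> exists k T0 : R, [/\ 0 < k <= 1, 1 <= T0 &
  forall T g s w1 w2 : R, T0 <= T -> `|g| <= kappa / 2 -> `|s| <= 2 ->
  let r1 := w1 - g * w2 in let r2 := w2 - T * s * r1 in
  let x := r1 * b00 + r2 * b10 in let y := r1 * b01 + r2 * b11 in
  [/\ k * maxabs w1 w2 <= T * maxabs x y,
      good w1 w2 -> k * maxabs w1 w2 <= maxabs x y,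
      good w1 w2 -> delta <= `|s| -> k * T * maxabs w1 w2 <= maxabs x y /\ good x y &
      T * delta * `|r1| <= `|w2 - T * s * r1| -> k * maxabs w1 w2 <= maxabs x y /\ good x y]].
Proof.
move=> d0; have [k0 k4] := andP cone_width_bounds; have M0' := M0; have b0 := beta0.
have l0 : 0 < lambda by rewrite /lambda divr_gt0 ?normr_gt0 ?mulr_gt0.
(* One constant for each of the four bounds. *)
pose kA := lambda / 4; pose kB := lambda * kappa / 2; pose kC := beta * delta * kappa / 8.
pose kD := beta / 2 / (2 + 2 / delta).
have D0 : 0 < 2 + 2 / delta by rewrite addr_gt0 // divr_gt0.
have kA0 : 0 < kA by rewrite /kA divr_gt0.
have kB0 : 0 < kB by rewrite /kB divr_gt0 // mulr_gt0.
have kC0 : 0 < kC by rewrite /kC; apply: divr_gt0 => //; apply: mulr_gt0 => //; exact: mulr_gt0.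
have kD0 : 0 < kD by rewrite /kD; apply: divr_gt0 => //; exact: divr_gt0.
pose k := Num.min 1 (Num.min (Num.min kA kB) (Num.min kC kD)).
have kk : [/\ k <= 1, k <= kA, k <= kB, k <= kC & k <= kD].
  by rewrite /k; split; rewrite !ge_min lexx ?orbT.
have k_gt0 : 0 < k by rewrite /k !lt_min ltr01 kA0 kB0 kC0.
pose T0 := 1 + 4 / (kappa * delta) + 4 * M / (beta * delta).
have t1 : 0 < 4 / (kappa * delta) by rewrite divr_gt0 // mulr_gt0.
have t2 : 0 < 4 * M / (beta * delta) by rewrite divr_gt0 // mulr_gt0.
have T01 : 1 <= T0 by rewrite /T0; lra.
exists k, T0; split=> //; first by case: kk => ->; rewrite k_gt0.
move=> T g s w1 w2 TT gk s2 r1 r2 x y.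
have T1 : 1 <= T by apply: le_trans TT.
have T0' : 0 < T by lra.
have Tkd : 4 <= T * (kappa * delta).
  have kd0 : 0 < kappa * delta by exact: mulr_gt0.
  have : 4 / (kappa * delta) <= T by apply: le_trans TT; rewrite /T0; lra.
  by rewrite ler_pdivrMr.
have Tbd : 4 * M <= T * (beta * delta).
  have bd0 : 0 < beta * delta by exact: mulr_gt0.
  have : 4 * M / (beta * delta) <= T by apply: le_trans TT; rewrite /T0; lra.
  by rewrite ler_pdivrMr.
have [L1 L2] := image_lower r1 r2.
move: L1 L2; rewrite -/x -/y; set N := maxabs x y; set W := maxabs w1 w2 => L1 L2.
have W0 : 0 <= W by rewrite /W /maxabs le_max normr_ge0.
have Nx : `|x| <= N by rewrite /N /maxabs le_max lexx.
have N0 : 0 <= N by apply: le_trans Nx.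
have [n10 n20 m10 m20] : [/\ 0 <= `|w1|, 0 <= `|w2|, 0 <= `|r1| & 0 <= `|r2|] by split.
have Wle (c : R) : `|w1| <= c -> `|w2| <= c -> W <= c by rewrite /W /maxabs ge_max => -> ->.
have w1r : `|w1| <= `|r1| + `|w2|.
  rewrite {1}(_ : w1 = r1 + g * w2); last by rewrite /r1; ring.
  apply: le_trans (ler_normD _ _) _; rewrite lerD2l normrM ler_piMl //; lra.
have w2r : `|w2| <= `|r2| + 2 * T * `|r1|.
  rewrite {1}(_ : w2 = r2 + T * s * r1); last by rewrite /r2; ring.
  apply: le_trans (ler_normD _ _) _; rewrite lerD2l !normrM ler_wpM2r //.
  by rewrite (ger0_norm (ltW T0')) mulrC ler_wpM2r // ltW.
have gd : good w1 w2 -> `|w1| <= 2 * `|r1| /\ W <= `|w1| / kappa.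
  rewrite /good => gw; split.
    have : `|w1| <= `|r1| + `|g| * `|w2|.
      rewrite {1}(_ : w1 = r1 + g * w2); last by rewrite /r1; ring.
      by rewrite -normrM; exact: ler_normD.
    have : `|g| * `|w2| <= kappa / 2 * `|w2| by rewrite ler_wpM2r.
    lra.
  apply: Wle; rewrite ler_pdivlMr //; last by rewrite mulrC.
  by rewrite ler_piMr //; lra.
split.
- have hW : W <= 4 * T * (N / lambda).
    have h1 : `|r1| <= N / lambda by rewrite ler_pdivlMr // mulrC.
    have h2 : `|r2| <= N / lambda by rewrite ler_pdivlMr // mulrC.
    set Q := N / lambda in h1 h2 *.
    have TQ : Q <= T * Q by rewrite ler_peMl //; apply: le_trans h1.
    have Tr : T * `|r1| <= T * Q by rewrite ler_wpM2l // ltW.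
    by apply: Wle; lra.
  apply: le_trans (ler_wpM2l (ltW k_gt0) hW) _.
  apply: (@le_trans _ _ (kA * (4 * T * (N / lambda)))).
    apply: ler_wpM2r; last by case: kk.
    by apply: mulr_ge0; [apply: mulr_ge0 => //; exact: ltW|apply: divr_ge0 => //; exact: ltW].
  by rewrite le_eqVlt; apply/orP; left; apply/eqP; rewrite /kA; field; rewrite gt_eqF.
- move=> /gd[h1 h2]; apply: le_trans L1; apply: le_trans (ler_wpM2l (ltW k_gt0) h2) _.
  apply: (@le_trans _ _ (kB * (`|w1| / kappa))).
    apply: ler_wpM2r; last by case: kk.
    by apply: divr_ge0 => //; exact: ltW.
  rewrite (_ : kB * (`|w1| / kappa) = lambda * (`|w1| / 2)); last first.
    by rewrite /kB; field; rewrite gt_eqF.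
  by rewrite ler_wpM2l ?(ltW l0) //; lra.
- move=> /gd[h1 h2] ds.
  have kw2 : kappa * `|w2| <= 2 * `|r1|.
    apply: le_trans h1; rewrite -ler_pdivlMl // mulrC; apply: le_trans h2.
    by rewrite /W /maxabs le_max lexx orbT.
  have hr2 : T * delta / 2 * `|r1| <= `|r2|.
    have e1 : T * delta * `|r1| <= `|r2| + `|w2|.
      apply: (@le_trans _ _ (`|w2 - r2|)); last by rewrite [leRHS]addrC; exact: ler_normB.
      rewrite (_ : w2 - r2 = T * s * r1); last by rewrite /r2; ring.
      by rewrite !normrM (ger0_norm (ltW T0')) ler_wpM2r // ler_wpM2l // ltW.
    have e2 : `|w2| <= T * delta / 2 * `|r1|.
      rewrite -(ler_pM2l k0); apply: le_trans kw2 _.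
      rewrite (_ : kappa * (T * delta / 2 * `|r1|) = (T * (kappa * delta)) / 2 * `|r1|); last by field.
      by rewrite ler_wpM2r //; lra.
    lra.
  have [|v1 v2] := @image_vertical r1 r2.
    rewrite -[leLHS]mul1r; apply: (@le_trans _ _ (beta / (2 * M) * (T * delta / 2 * `|r1|))); last first.
      apply: ler_wpM2l => //; apply: divr_ge0; first exact: ltW.
      by apply: mulr_ge0 => //; exact: ltW.
    rewrite mulrA ler_wpM2r //.
    rewrite (_ : beta / (2 * M) * (T * delta / 2) = T * (beta * delta) / (4 * M)); last first.
      by field; rewrite gt_eqF.
    by rewrite ler_pdivlMr ?mulr_gt0 // mul1r.
  split=> //; apply: le_trans Nx; apply: le_trans v1.
  apply: (@le_trans _ _ (kC * T * W)).
    by apply: ler_wpM2r => //; apply: ler_wpM2r; [exact: ltW|case: kk].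
  apply: (@le_trans _ _ (kC * T * (2 * `|r1| / kappa))).
    apply: ler_wpM2l; first by apply: mulr_ge0; exact: ltW.
    by apply: le_trans h2 _; apply: ler_wpM2r => //; rewrite invr_ge0 ltW.
  rewrite (_ : kC * T * (2 * `|r1| / kappa) = beta / 2 * (T * delta / 2 * `|r1|)); last first.
    by rewrite /kC; field; rewrite gt_eqF.
  by rewrite ler_wpM2l // divr_ge0 // ltW.
- rewrite -/r2 => hr2.
  have r12 : `|r1| <= `|r2| / (T * delta) by rewrite ler_pdivlMr ?mulr_gt0 // mulrC.
  have bM := betaM.
  have Td : 1 <= T * delta.
    rewrite -(ler_pM2l b0) mulr1.
    by rewrite (_ : beta * (T * delta) = T * (beta * delta)); [lra|ring].
  have [|v1 v2] := @image_vertical r1 r2.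
    apply: le_trans r12 _; rewrite mulrC ler_wpM2r //.
    rewrite -[leLHS]mul1r ler_pdivrMr ?mulr_gt0 // mulrAC ler_pdivlMr ?mulr_gt0 //.
    by rewrite (_ : beta * (T * delta) = T * (beta * delta)); [lra|ring].
  split=> //; apply: le_trans Nx; apply: le_trans v1.
  have r11 : `|r1| <= `|r2|.
    by apply: le_trans hr2; rewrite ler_peMl.
  have Tr : T * `|r1| <= `|r2| / delta.
    by rewrite ler_pdivlMr // mulrAC.
  have WW : W <= (2 + 2 / delta) * `|r2|.
    rewrite (_ : (2 + 2 / delta) * `|r2| = 2 * `|r2| + 2 * (`|r2| / delta)); last by field; rewrite gt_eqF.
    by apply: Wle; lra.
  apply: le_trans (ler_wpM2l (ltW k_gt0) WW) _.
  apply: (@le_trans _ _ (kD * ((2 + 2 / delta) * `|r2|))).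
    apply: ler_wpM2r; last by case: kk.
    by apply: mulr_ge0 => //; exact: ltW.
  by rewrite /kD mulrA divfK ?gt_eqF.
Qed.

End OneStep.

(** * The averaged growth of a potential *)

Section Averaging.
Variable R : realType.

Lemma sum_if_const (I : finType) (b : pred I) (x y : R) :
  \sum_i (if b i then x else y) = #|b|%:R * x + (#|I|%:R - #|b|%:R) * y.
Proof.
rewrite (bigID b) /=; congr (_ + _).
  rewrite (eq_bigr (fun=> x)); last by move=> i ->.
  by rewrite sumr_const mulr_natl.
rewrite (eq_bigr (fun=> y)); last by move=> i /negPf ->.
rewrite sumr_const -natrB ?max_card // mulr_natl; congr (_ *+ _).
rewrite -(cardC b) addKn; apply: eq_card => i; by rewrite !inE.
Qed.

Definition reward (d k1 : nat) (T : R) := (k1%:R + 1 / 2) / (d%:R - k1%:R) * ln T.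

Definition potential (A : R) (g : bool) (W : R) := ln W + (if g then A else 0).

(** The rewards and the losses: from a good direction a fraction of at least
   [1 - k0 / d] of the branches gains [ln T] and stays good; from any direction
   a fraction of at least [1 - k1 / d] becomes good without loss, and the others
   lose at most [ln T], all up to the constant [ln k].  Rewarding good directions with a suitable multiple of
   [ln T] makes the average positive in both cases as soon as [k0 + k1 < d]. *)
Lemma average_growth (I : finType) (k0 k1 : nat) (k T W : R) (Wi : I -> R)
    (g : bool) (gi : I -> bool) (bad0 bad1 : pred I) :
    (k0 + k1 < #|I|)%N -> 0 < k <= 1 -> 1 <= T -> 0 < W -> (forall i, 0 < Wi i) ->
    2 * (#|I|%:R * - ln k + 1) <= ln T ->
    (forall i, k * W <= T * Wi i) ->
    (g -> forall i, k * W <= Wi i) ->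
    (g -> forall i, ~~ bad0 i -> k * T * W <= Wi i /\ gi i) ->
    (forall i, ~~ bad1 i -> k * W <= Wi i /\ gi i) ->
    (#|bad0| <= k0)%N -> (#|bad1| <= k1)%N ->
  #|I|%:R * potential (reward #|I| k1 T) g W + 1 <=
    \sum_i potential (reward #|I| k1 T) (gi i) (Wi i).
Proof.
move=> kd /andP[k_gt0 k_le1] T1 W0 Wi0 bigT h1 h2 h3 h4 c0 c1.
have T0 : 0 < T by apply: lt_le_trans T1.
pose A := reward #|I| k1 T; rewrite -/A.
set d : R := #|I|%:R in bigT *.
have L0 : 0 <= ln T by apply: ln_ge0.
have c_ge0 : 0 <= - ln k by rewrite oppr_ge0 ln_le0.
have d1 : k1%:R + 1 <= d by rewrite natr1 ler_nat; apply: leq_ltn_trans kd; rewrite leq_addl.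
have d01 : k0%:R + k1%:R + 1 <= d by rewrite -natrD natr1 ler_nat.
have k1_ge0 : 0 <= k1%:R :> R by [].
have k0_ge0 : 0 <= k0%:R :> R by [].
pose a : R := (k1%:R + 1 / 2) / (d - k1%:R).
have a0 : 0 <= a by apply: divr_ge0; lra.
have aE : a * (d - k1%:R) = k1%:R + 1 / 2 by rewrite /a divfK // gt_eqF //; lra.
have A0 : 0 <= A by rewrite /A; apply: mulr_ge0.
have AE : A = a * ln T by [].
have lnle (x y : R) : 0 < x -> x <= y -> ln x <= ln y.
  by move=> x0 xy; rewrite ler_ln ?posrE //; apply: lt_le_trans xy.
have kW0 : 0 < k * W by rewrite mulr_gt0.
have lkW : ln (k * W) = ln k + ln W by rewrite lnM ?posrE.
case: g h2 h3 => h2 h3 /=.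
  apply: (@le_trans _ _ (\sum_i (ln k + ln W + (if bad0 i then 0 else ln T + A)))).
    rewrite big_split /= sumr_const sum_if_const mulr0 add0r -/d.
    have b0 : #|bad0|%:R <= k0%:R :> R by rewrite ler_nat.
    have e1 : (d - k0%:R) * (ln T + A) <= (d - #|bad0|%:R) * (ln T + A).
      by rewrite ler_wpM2r ?addr_ge0 // lerD2l lerN2.
    have -> : (ln k + ln W) *+ #|I| = d * (ln k + ln W) by rewrite mulr_natl.
    apply: le_trans (lerD (lexx _) e1); rewrite /potential.
    have e2 : 1 / 2 <= (d - k0%:R) - k0%:R * a.
      have : k0%:R * a <= (d - k1%:R - 1) * a by rewrite ler_wpM2r //; lra.
      have : (d - k1%:R - 1) * a = k1%:R + 1 / 2 - a by rewrite -aE; ring.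
      lra.
    have e3 : 1 / 2 * ln T <= (d - k0%:R - k0%:R * a) * ln T by rewrite ler_wpM2r.
    rewrite (_ : d * (ln k + ln W) + (d - k0%:R) * (ln T + A) =
      d * (ln W + A) - d * - ln k + (d - k0%:R - k0%:R * a) * ln T); first lra.
    by rewrite AE; ring.
  apply: ler_sum => i _; rewrite /potential; case: ifP => bi.
    rewrite addr0 -lkW; apply: le_trans (lnle _ _ kW0 (h2 isT i)) _.
    by rewrite lerDl; case: ifP.
  have [e ->] := h3 isT i (negbT bi).
  rewrite addrA lerD2r; apply: le_trans (lnle _ _ _ e); last by rewrite !mulr_gt0.
  by rewrite lnM ?posrE ?mulr_gt0 // lnM ?posrE //; lra.
apply: (@le_trans _ _ (\sum_i (ln k + ln W + (if bad1 i then - ln T else A)))).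
  rewrite big_split /= sumr_const sum_if_const -/d.
  have b1 : #|bad1|%:R <= k1%:R :> R by rewrite ler_nat.
  have -> : (ln k + ln W) *+ #|I| = d * (ln k + ln W) by rewrite mulr_natl.
  have e1 : #|bad1|%:R * (ln T + A) <= k1%:R * (ln T + A) by rewrite ler_wpM2r ?addr_ge0.
  have e2 : d * A - k1%:R * (ln T + A) = 1 / 2 * ln T.
    rewrite AE (_ : _ - _ = (a * (d - k1%:R) - k1%:R) * ln T); last by ring.
    by rewrite aE; ring.
  rewrite /potential addr0.
  rewrite [leRHS](_ : _ = d * ln W - d * - ln k + (d * A - #|bad1|%:R * (ln T + A))); last by ring.
  lra.
apply: ler_sum => i _; rewrite /potential; case: ifP => bi.
  apply: (@le_trans _ _ (ln (Wi i))); last by rewrite lerDl; case: ifP.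
  have := lnle _ _ kW0 (h1 i); rewrite lkW lnM ?posrE //; lra.
have [e ->] := h4 i (negbT bi).
by rewrite lerD2r -lkW; exact: lnle.
Qed.

End Averaging.

(** * The lift of the map *)

Section Lift.
Variable R : realType.
Local Notation V := (plane R).
Implicit Types (F G : V -> V) (x v w : V).

Definition tau_v (T t : R) : R := T * ((sin (2 * pi * t) + sin (4 * pi * t) / 16) / (2 * pi)).
Definition tau_h (eta t : R) : R := eta * sin (2 * pi * t).

Lemma tau_v_periodic T : periodic_fun (tau_v T).
Proof.
move=> k t; rewrite /tau_v mulrDr sin_shift_int.
rewrite (_ : 4 * pi * (t + k%:~R) = 4 * pi * t + 2 * pi * ((2 * k)%:~R)) ?sin_shift_int //.
by rewrite intrM; ring.
Qed.

Lemma tau_h_periodic eta : periodic_fun (tau_h eta).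
Proof. by move=> k t; rewrite /tau_h mulrDr sin_shift_int. Qed.

Lemma is_derive_sin_mul (a t : R) : is_derive t 1 (fun t : R => sin (a * t)) (a * cos (a * t)).
Proof.
have h : is_derive t 1 ( *%R a) a.
  rewrite (_ : *%R a = a \*: (@id R)) //.
  by apply: is_derive_eq; rewrite /GRing.scale /= mulr1.
have hs : is_derive (a * t) 1 sin (cos (a * t)) by exact: is_derive_sin.
by have := is_derive1_comp hs h; rewrite /GRing.scale /= mulrC.
Qed.

Lemma tau_v_derive (T t : R) : is_derive t 1 (tau_v T) (T * slope t).
Proof.
have h1 := is_derive_sin_mul (2 * pi) t; have h2 := is_derive_sin_mul (4 * pi) t.
have pi0 : pi != 0 :> R by rewrite gt_eqF // pi_gt0.
rewrite (_ : tau_v T = (T / (2 * pi)) \*: (fun t => sin (2 * pi * t)) +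
   (T / (2 * pi) / 16) \*: (fun t => sin (4 * pi * t))).
  apply: is_derive_eq; rewrite /slope /GRing.scale /=.
  by move: pi0 (cos _) (cos _) => + c1 c2 {h1 h2}; move: pi => P P0; field.
apply/funext => s; rewrite /tau_v.
transitivity (T / (2 * pi) * sin (2 * pi * s) + T / (2 * pi) / 16 * sin (4 * pi * s)); last by [].
by move: pi0 (sin _) (sin _) => + c1 c2 {h1 h2}; move: pi => P P0; field.
Qed.

Lemma tau_h_derive (eta t : R) : is_derive t 1 (tau_h eta) (eta * (2 * pi * cos (2 * pi * t))).
Proof.
have h1 := is_derive_sin_mul (2 * pi) t.
rewrite (_ : tau_h eta = eta \*: (fun t => sin (2 * pi * t))); last by apply/funext.
by apply: is_derive_eq.
Qed.

Lemma derive_continuous (f df : R -> R) : (forall t : R, is_derive t 1 f (df t)) -> continuous f.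
Proof.
move=> h t; apply: differentiable_continuous; apply/derivable1_diffP.
by have ht := h t; exact: ex_derive.
Qed.

Lemma tau_v_continuous T : continuous (tau_v T).
Proof. exact: derive_continuous (tau_v_derive T). Qed.

Lemma tau_h_continuous eta : continuous (tau_h eta).
Proof. exact: derive_continuous (tau_h_derive eta). Qed.

Definition elementary2 F := elementary (fun x => F x 0 0) /\ elementary (fun x => F x 0 1).

Lemma elementary2_id : elementary2 id.
Proof.
split.
  have := @elementary_affine R 0 1 0; under eq_fun do rewrite add0r mul1r mul0r addr0; exact.
have := @elementary_affine R 0 0 1; under eq_fun do rewrite add0r mul1r mul0r add0r; exact.
Qed.

Lemma elementaryZ (a : R) (f : V -> R) : elementary f -> elementary (fun x => a * f x).
Proof. by move=> ef; apply: elementaryM => //; exact: elementary_cst. Qed.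

Lemma elementary2_mul F (A : 'M[R]_2) : elementary2 F -> elementary2 (fun x => F x *m A).
Proof.
move=> [f0 f1]; split; under eq_fun do rewrite mulmx_row2;
  by apply: elementaryD; under eq_fun do rewrite mulrC; exact: elementaryZ.
Qed.

Lemma elementary2_vshear T F : elementary2 F -> elementary2 (vshear (tau_v T) \o F).
Proof.
move=> [f0 f1]; split; rewrite /vshear /=.
  by under eq_fun do rewrite mkplane0.
under eq_fun do rewrite mkplane1 /= /tau_v.
apply: elementaryD => //; apply: elementaryZ; under eq_fun do rewrite mulrC.
apply: elementaryZ; apply: elementaryD; first by apply: elementary_sin; exact: elementaryZ.
by under eq_fun do rewrite mulrC; apply: elementaryZ; apply: elementary_sin; exact: elementaryZ.
Qed.

Lemma elementary2_hshear eta F : elementary2 F -> elementary2 (hshear (tau_h eta) \o F).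
Proof.
move=> [f0 f1]; split; rewrite /hshear /=; last by under eq_fun do rewrite mkplane1.
under eq_fun do rewrite mkplane0 /= /tau_h.
by apply: elementaryD => //; apply: elementaryZ; apply: elementary_sin; exact: elementaryZ.
Qed.

Lemma elementary2_eta F : F = fun x => mkplane (F x 0 0, F x 0 1).
Proof. by apply/funext => x; rewrite -plane_eta. Qed.

Lemma elementary2_analytic F x : elementary2 F -> analytic_at F x.
Proof.
move=> [f0 f1]; rewrite (elementary2_eta F).
by apply: analytic_at_mkplane; exact: elementary_analytic.
Qed.

Lemma elementary2_continuous F : elementary2 F -> continuous F.
Proof.
move=> [f0 f1] x; rewrite (elementary2_eta F); apply: differentiable_continuous.
by apply: differentiable_mkplane; exact: elementary_differentiable.
Qed.

Lemma elementary2_Cr (r : \bar R) F : (1 <= r)%E -> elementary2 F -> Cr_on r setT F.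
Proof.
move=> r1 [f0 f1]; rewrite (elementary2_eta F); case: r r1 => [s||] //= s1.
  apply: elementary_class_on => //.
  have s0 : 0 <= s by rewrite lee_fin in s1; apply: le_trans s1.
  by have /andP[_ /ltW] := truncn_itv s0; rewrite lerBlDr addrC natr1.
by move=> k; apply: elementary_class_on => //; exact: ler01.
Qed.

Definition vderiv F x v w := has_deriv (fun y => F y 0 0) x v (w 0 0) /\
  has_deriv (fun y => F y 0 1) x v (w 0 1).

Lemma vderiv_id x v : vderiv id x v v.
Proof. by split; exact: has_deriv_coord. Qed.

Lemma vderiv_mul F x v w (A : 'M[R]_2) : vderiv F x v w ->
  vderiv (fun y => F y *m A) x v (w *m A).
Proof.
move=> [h0 h1]; split; rewrite mulmx_row2; under eq_fun do rewrite mulmx_row2.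
  have := has_derivD (has_derivM h0 (has_deriv_cst (A 0 0) x v)) (has_derivM h1 (has_deriv_cst (A 1 0) x v)).
  by rewrite !mulr0 !add0r ![A _ _ * _]mulrC.
have := has_derivD (has_derivM h0 (has_deriv_cst (A 0 1) x v)) (has_derivM h1 (has_deriv_cst (A 1 1) x v)).
by rewrite !mulr0 !add0r ![A _ _ * _]mulrC.
Qed.

Definition upper (a : R) : 'M[R]_2 := \matrix_(i, j) (if i == j then 1 else if i == 0 then a else 0).
Definition lower (a : R) : 'M[R]_2 := \matrix_(i, j) (if i == j then 1 else if i == 0 then 0 else a).

Lemma mul_upper x a : x *m upper a = mkplane (x 0 0, x 0 1 + a * x 0 0).
Proof.
by apply: plane_eqP; rewrite mulmx_row2 ?mkplane0 ?mkplane1 !mxE /=; ring.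
Qed.

Lemma mul_lower x a : x *m lower a = mkplane (x 0 0 + a * x 0 1, x 0 1).
Proof.
by apply: plane_eqP; rewrite mulmx_row2 ?mkplane0 ?mkplane1 !mxE /=; ring.
Qed.

Lemma vderiv_vshear tau t' F x v w : vderiv F x v w -> is_derive (F x 0 0) 1 tau t' ->
  vderiv (vshear tau \o F) x v (w *m upper t').
Proof.
move=> [h0 h1] ht; split; rewrite mul_upper ?mkplane0 ?mkplane1 /vshear /=.
  by under eq_fun do rewrite mkplane0.
under eq_fun do rewrite mkplane1 /=.
by apply: has_derivD => //; exact: has_deriv_comp1.
Qed.

Lemma vderiv_hshear tau t' F x v w : vderiv F x v w -> is_derive (F x 0 1) 1 tau t' ->
  vderiv (hshear tau \o F) x v (w *m lower t').
Proof.
move=> [h0 h1] ht; split; rewrite mul_lower ?mkplane0 ?mkplane1 /hshear /=; last first.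
  by under eq_fun do rewrite mkplane1.
under eq_fun do rewrite mkplane0 /=.
by apply: has_derivD => //; exact: has_deriv_comp1.
Qed.

Lemma vderiv_derive F x v w : vderiv F x v w -> differentiable F x /\ 'D_v F x = w.
Proof.
move=> [h0 h1]; rewrite (elementary2_eta F); split.
  by apply: differentiable_mkplane; [case: h0|case: h1].
by rewrite (derive_mkplane h0 h1) -plane_eta.
Qed.

Lemma vderiv_jacobian F x (J : 'M[R]_2) : (forall v, vderiv F x v (v *m J)) ->
  differentiable F x /\ 'J F x = J.
Proof.
move=> h; have [dF _] := vderiv_derive (h 0); split=> //.
apply: row2_mulP => v; have [_ <-] := vderiv_derive (h v).
exact: esym (deriveEjacobian v dF).
Qed.

Definition shear_lift (P1 P2 : 'M[int]_2) (T eta : R) : V -> V :=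
  ilin P2 \o (hshear (tau_h eta) \o (vshear (tau_v T) \o ilin P1)).

Lemma elementary2_lift P1 P2 T eta : elementary2 (shear_lift P1 P2 T eta).
Proof.
apply: elementary2_mul; apply: elementary2_hshear; apply: elementary2_vshear.
exact: elementary2_mul elementary2_id.
Qed.

Lemma equivariant_lift P1 P2 T eta : equivariant (shear_lift P1 P2 T eta).
Proof.
apply: equivariant_comp; first exact: equivariant_ilin.
apply: equivariant_comp; first exact: equivariant_hshear (tau_h_periodic eta).
apply: equivariant_comp; first exact: equivariant_vshear (tau_v_periodic T).
exact: equivariant_ilin.
Qed.

Section ParameterContinuity.
Variable W : topologicalType.
Implicit Types f g : W -> R.

Lemma continuous_add f g : continuous f -> continuous g -> continuous (fun x : W => f x + g x).
Proof. by move=> cf cg x; apply: cvgD; [exact: cf|exact: cg]. Qed.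

Lemma continuous_mul f g : continuous f -> continuous g -> continuous (fun x : W => f x * g x).
Proof. by move=> cf cg x; apply: cvgM; [exact: cf|exact: cg]. Qed.

Lemma continuous_const (a : R) : continuous (fun _ : W => a).
Proof. by move=> x; exact: cvg_cst. Qed.

Lemma continuous_after f (s : R -> R) : continuous s -> continuous f ->
  continuous (fun x : W => s (f x)).
Proof. by move=> cs cf x; apply: continuous_comp; [exact: cf|exact: cs]. Qed.

Definition continuous2 (F : W -> V) :=
  continuous (fun x : W => F x 0 0) /\ continuous (fun x : W => F x 0 1).

Lemma continuous2_continuous (F : W -> V) : continuous2 F -> continuous F.
Proof.
move=> [c0 c1] x.
rewrite (_ : F = fun x : W => F x 0 0 *: mkplane (1, 0) + F x 0 1 *: mkplane (0, 1)).
  by apply: cvgD; apply: cvgZr_tmp; [exact: c0|exact: c1].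
by apply/funext => y; rewrite [LHS]plane_eta mkplaneE.
Qed.

Lemma continuous2_mul (F : W -> V) (A : 'M[R]_2) : continuous2 F -> continuous2 (fun x : W => F x *m A).
Proof.
move=> [c0 c1]; split; under eq_fun do rewrite mulmx_row2;
  by apply: continuous_add; apply: continuous_mul => //; exact: continuous_const.
Qed.

Lemma continuous2_vshear (F : W -> V) (a : W -> R) : continuous a -> continuous2 F ->
  continuous2 (fun x : W => vshear (tau_v (a x)) (F x)).
Proof.
move=> ca [c0 c1]; split.
  by under eq_fun do rewrite /vshear mkplane0.
under eq_fun do rewrite /vshear mkplane1 /= /tau_v -[_ / (2 * pi)]mul1r.
apply: continuous_add => //; apply: continuous_mul => //.
have := @continuous_after (fun x : W => F x 0 0) _ (@tau_v_continuous 1) c0.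
by rewrite /tau_v.
Qed.

Lemma continuous2_hshear (F : W -> V) (a : W -> R) : continuous a -> continuous2 F ->
  continuous2 (fun x : W => hshear (tau_h (a x)) (F x)).
Proof.
move=> ca [c0 c1]; split; last by under eq_fun do rewrite /hshear mkplane1.
under eq_fun do rewrite /hshear mkplane0 /= /tau_h -[sin _]mul1r.
apply: continuous_add => //; apply: continuous_mul => //.
have := @continuous_after (fun x : W => F x 0 1) _ (@tau_h_continuous 1) c1.
by rewrite /tau_h.
Qed.

End ParameterContinuity.

Lemma lift_family_continuous (P1 P2 : 'M[int]_2) (T eta : R) :
  continuous (fun z : R * V => shear_lift P1 P2 (z.1 * T) (z.1 * eta) z.2).
Proof.
apply: continuous2_continuous; apply: continuous2_mul.
have c (a : R) : continuous (fun z : R * V => z.1 * a).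
  by apply: continuous_mul; [move=> z; exact: cvg_fst|exact: continuous_const].
apply: continuous2_hshear => //; apply: continuous2_vshear => //.
apply: continuous2_mul; split; move=> z.
  by apply: (@continuous_comp _ _ _ snd (fun x : V => x 0 0)); [exact: cvg_snd|exact: coord_continuous].
by apply: (@continuous_comp _ _ _ snd (fun x : V => x 0 1)); [exact: cvg_snd|exact: coord_continuous].
Qed.
End Lift.

(** * Inverse branches and the derivative cocycle *)

Lemma det2 (K : comNzRingType) (A : 'M[K]_2) : \det A = A 0 0 * A 1 1 - A 0 1 * A 1 0.
Proof.
rewrite (expand_det_row _ 0) !big_ord_recl big_ord0 /cofactor !det_mx11 !mxE /=.
have -> : lift 0 0 = 1 :> 'I_2 by exact: val_inj.
have -> : lift 1 0 = 0 :> 'I_2 by exact: val_inj.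
by rewrite addr0 expr0 expr1 !mul1r mulN1r mulrN.
Qed.

Section Branches.
Variable R : realType.
Local Notation V := (plane R).
Local Notation T2 := (torus R).

Lemma invmx_eq (A B : 'M[R]_2) : A *m B = 1%:M -> invmx A = B.
Proof.
move=> AB; have [uA _] := mulmx1_unit AB.
by rewrite -[LHS]mulmx1 -AB mulKmx.
Qed.

Lemma vshearK (tau : R -> R) : cancel (vshear tau) (vshear (fun t => - tau t)).
Proof. by move=> x; apply: plane_eqP; rewrite /vshear ?mkplane0 ?mkplane1 ?mkplane0 //= addrK. Qed.

Lemma vshearKN (tau : R -> R) : cancel (vshear (fun t => - tau t)) (vshear tau).
Proof. by move=> x; apply: plane_eqP; rewrite /vshear ?mkplane0 ?mkplane1 ?mkplane0 //= subrK. Qed.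

Lemma hshearK (tau : R -> R) : cancel (hshear tau) (hshear (fun t => - tau t)).
Proof. by move=> x; apply: plane_eqP; rewrite /hshear ?mkplane0 ?mkplane1 ?mkplane0 //= addrK. Qed.

Lemma hshearKN (tau : R -> R) : cancel (hshear (fun t => - tau t)) (hshear tau).
Proof. by move=> x; apply: plane_eqP; rewrite /hshear ?mkplane0 ?mkplane1 ?mkplane0 //= subrK. Qed.

Lemma ilinK (P Q : 'M[int]_2) : P *m Q = 1%:M -> cancel (@ilin R P) (ilin Q).
Proof. by move=> PQ x; rewrite /ilin -mulmxA -map_mxM PQ map_mx1 mulmx1. Qed.

Lemma det_upper (a : R) : \det (upper a) = 1.
Proof. by rewrite det2 !mxE /= mulr0 subr0 mulr1. Qed.

Lemma det_lower (a : R) : \det (lower a) = 1.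
Proof. by rewrite det2 !mxE /= mul0r subr0 mulr1. Qed.

Lemma upper_mulN (a : R) : upper a *m upper (- a) = 1%:M.
Proof.
apply: row2_mulP => v; rewrite mulmxA mulmx1 !mul_upper.
by apply: plane_eqP; rewrite ?mkplane0 ?mkplane1 /=; rewrite ?mkplane0 //=; ring.
Qed.

Lemma lower_mulN (a : R) : lower a *m lower (- a) = 1%:M.
Proof.
apply: row2_mulP => v; rewrite mulmxA mulmx1 !mul_lower.
by apply: plane_eqP; rewrite ?mkplane0 ?mkplane1 /=; rewrite ?mkplane1 //=; ring.
Qed.

Variables (P1 Q1 P2 : 'M[int]_2) (T eta : R).
Hypothesis PQ : P1 *m Q1 = 1%:M.
Hypothesis P2_neq0 : \det P2 != 0.

Local Notation rP2 := (map_mx intr P2 : 'M[R]_2).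
Local Notation F := (shear_lift P1 P2 T eta).
Local Notation f := (tmap F).

Let QP : Q1 *m P1 = 1%:M. Proof. exact: mulmx1C. Qed.
Let uP2 : rP2 \in unitmx. Proof. exact: ilin_unit. Qed.

Definition unshear (x : V) : V :=
  vshear (fun t => - tau_v T t) (hshear (fun t => - tau_h eta t) x).
Definition lift_inv (x : V) : V := ilin Q1 (unshear (x *m invmx rP2)).

Lemma lift_invK : cancel lift_inv F.
Proof.
move=> x; rewrite /lift_inv /shear_lift /= (ilinK QP) vshearKN hshearKN /ilin.
by rewrite mulmxKV.
Qed.

Lemma liftK : cancel F lift_inv.
Proof.
move=> x; rewrite /lift_inv /shear_lift /= /unshear {1}/ilin mulmxK // hshearK vshearK.
exact: ilinK.
Qed.

Lemma elementary2_lift_inv : elementary2 lift_inv.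
Proof.
have e (a : R) G : elementary2 G -> elementary2 (hshear (fun t => - tau_h a t) \o G).
  move=> eG; rewrite (_ : (fun t => _) = tau_h (- a)); first exact: elementary2_hshear.
  by apply/funext => t; rewrite /tau_h mulNr.
have e' (a : R) G : elementary2 G -> elementary2 (vshear (fun t => - tau_v a t) \o G).
  move=> eG; rewrite (_ : (fun t => _) = tau_v (- a)); first exact: elementary2_vshear.
  by apply/funext => t; rewrite /tau_v mulNr.
apply: elementary2_mul; apply: e'; apply: e.
exact: elementary2_mul (elementary2_id R).
Qed.

Lemma equivariant_unshear : equivariant unshear.
Proof.
apply: (equivariant_comp (F := vshear _)).
  by apply: equivariant_vshear => k t; rewrite tau_v_periodic.
by apply: equivariant_hshear => k t; rewrite tau_h_periodic.
Qed.

Lemma local_Cr_diffeo_lift (r : \bar R) : (1 <= r)%E -> local_Cr_diffeo r f.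
Proof.
move=> r1 x; exists setT, setT, F; split=> //.
  by move=> y _; exact: tmapE (equivariant_lift _ _ _ _).
split; try exact: openT.
- split=> [y _ //|y z _ _ E|y _]; first by rewrite -(liftK y) E liftK.
  by exists (lift_inv y) => //; exact: lift_invK.
- exact: elementary2_Cr (elementary2_lift _ _ _ _).
- exists lift_inv; first by move=> y _; exact: liftK.
  exact: elementary2_Cr elementary2_lift_inv.
Qed.

Lemma preserves_lift : preserves_measure f.
Proof.
have dP1 : \det P1 != 0.
  apply/eqP => d0; have := congr1 determinant PQ; rewrite det_mulmx d0 mul0r det1.
  by move/eqP; rewrite eq_sym oner_eq0.
have c2 := elementary2_continuous.
apply: preserves_measure_comp.
- exact: equivariant_ilin.
- exact: c2 (elementary2_mul _ (elementary2_id R)).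
- exact: preserves_ilin.
apply: preserves_measure_comp.
- exact: equivariant_hshear (tau_h_periodic eta).
- exact: c2 (elementary2_hshear eta (elementary2_id R)).
- exact: preserves_hshear (tau_h_periodic eta) (@tau_h_continuous R eta).
apply: preserves_measure_comp.
- exact: equivariant_vshear (tau_v_periodic T).
- exact: c2 (elementary2_vshear T (elementary2_id R)).
- exact: preserves_vshear (tau_v_periodic T) (@tau_v_continuous R T).
exact: preserves_ilin.
Qed.

Definition lift_jac (x : V) : 'M[R]_2 :=
  map_mx intr P1 *m upper (T * slope (ilin P1 x 0 0))
    *m lower (eta * (2 * pi * cos (2 * pi * vshear (tau_v T) (ilin P1 x) 0 1))) *m rP2.

Lemma vderiv_lift G x v w : vderiv G x v w -> vderiv (F \o G) x v (w *m lift_jac (G x)).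
Proof.
move=> h; rewrite /lift_jac !mulmxA; apply: vderiv_mul.
apply: (@vderiv_hshear _ (tau_h eta) _ (vshear (tau_v T) \o (ilin P1 \o G))); last exact: tau_h_derive.
apply: (@vderiv_vshear _ (tau_v T) _ (ilin P1 \o G)); last exact: tau_v_derive.
exact: vderiv_mul.
Qed.

Fixpoint iter_jac (n : nat) (x : V) : 'M[R]_2 :=
  if n is n'.+1 then iter_jac n' x *m lift_jac (iter n' F x) else 1%:M.

Lemma vderiv_iter n x v : vderiv (iter n F) x v (v *m iter_jac n x).
Proof.
elim: n => [|n IH] /=; first by rewrite mulmx1; exact: vderiv_id.
by rewrite mulmxA; exact: vderiv_lift IH.
Qed.

Lemma torus_jacobian_iter n (y : T2) : torus_jacobian (iter n f) y = iter_jac n (repr y).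
Proof.
have eF := equivariant_lift P1 P2 T eta.
have [dF JF] := vderiv_jacobian (vderiv_iter n (repr y)).
by rewrite tmap_iter // torus_jacobian_tmap //; exact: equivariant_iter.
Qed.

Lemma lift_jac_periodic x y : lattice (x - y) -> lift_jac x = lift_jac y.
Proof.
move=> xy; rewrite /lift_jac.
have /latticeP[k [l E]] := equivariant_ilin P1 xy.
have /latticeP[k' [l' E']] := equivariant_vshear (tau_v_periodic T) (equivariant_ilin P1 xy).
have -> : ilin P1 x 0 0 = ilin P1 y 0 0 + k%:~R.
  by have := congr1 (fun z : V => z 0 0) E; rewrite !mxE /= => /eqP; rewrite subr_eq addrC => /eqP.
have -> : vshear (tau_v T) (ilin P1 x) 0 1 = vshear (tau_v T) (ilin P1 y) 0 1 + l'%:~R.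
  have := congr1 (fun z : V => z 0 1) E'; rewrite [X in X = _ -> _]mxE [X in _ + X]mxE mkplane1.
  by move=> /eqP; rewrite subr_eq addrC => /eqP.
by rewrite slope_shift_int [2 * pi * (_ + l'%:~R)]mulrDr cos_shift_int.
Qed.

Definition lift_jac_inv (s g : R) : 'M[R]_2 :=
  invmx rP2 *m lower (- g) *m upper (- (T * s)) *m map_mx intr Q1.

Lemma invmx_lift_jac x : invmx (lift_jac x) =
  lift_jac_inv (slope (ilin P1 x 0 0))
    (eta * (2 * pi * cos (2 * pi * vshear (tau_v T) (ilin P1 x) 0 1))).
Proof.
apply: invmx_eq; rewrite /lift_jac /lift_jac_inv; set s := slope _; set g := eta * _.
rewrite -!mulmxA (mulmxA rP2) mulmxV // mul1mx (mulmxA (lower g)) lower_mulN mul1mx.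
by rewrite (mulmxA (upper _)) upper_mulN mul1mx -map_mxM PQ map_mx1.
Qed.

Lemma det_lift_jac x : \det (lift_jac x) = (\det (P1 *m P2))%:~R.
Proof.
by rewrite /lift_jac !det_mulmx det_upper det_lower !mulr1 !det_map_mx -intrM.
Qed.

Lemma det_iter_jac n x : \det (iter_jac n x) = (\det (P1 *m P2))%:~R ^+ n.
Proof. by elim: n => [|n IH] /=; rewrite ?det1 // det_mulmx IH det_lift_jac exprSr. Qed.

Lemma iter_jac_unit n x : iter_jac n x \in unitmx.
Proof.
rewrite unitmxE det_iter_jac unitrX // unitfE intr_eq0 det_mulmx mulf_neq0 //.
apply/eqP => d0; have := congr1 determinant PQ; rewrite det_mulmx d0 mul0r det1.
by move/eqP; rewrite eq_sym oner_eq0.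
Qed.

Variables (p m : nat) (c : int).
Hypotheses (p_gt0 : (0 < p)%N) (m_gt0 : (0 < m)%N).
Notation I := ('I_p * 'I_m)%type.

(** Representatives, in the coordinates of the shears, of the cosets modulo the
   lattice of the preimage of the lattice under [P2]. They are indexed by a
   product because the quotient is a product of two cyclic groups. *)
Definition offset (ij : I) : V :=
  mkplane (c%:~R * (ij.1%:R / p%:R) + ij.2%:R / m%:R, ij.1%:R / p%:R).

Hypothesis offset_lattice : forall ij, lattice (offset ij *m rP2).
Hypothesis offset_all : forall n : V, lattice n -> exists ij, lattice (n *m invmx rP2 - offset ij).

Lemma frac_int_inj (k : nat) (i j : 'I_k) :
  (i%:R / k%:R - j%:R / k%:R : R) \is a Num.int -> i = j.
Proof.
move=> /intrP[z hz]; have k0 : (0 < k)%N by apply: leq_ltn_trans (ltn_ord i).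
have E : (i : int) - (j : int) = z * k.
  apply: (@intr_inj R); rewrite intrB intrM -!pmulrn -hz; field.
  by rewrite pnatr_eq0 -lt0n.
have dv : (k %| `|(i : int) - (j : int)|)%N by rewrite E abszM dvdn_mull.
have lt : (`|(i : int) - (j : int)| < k)%N.
  by have := ltn_ord i; have := ltn_ord j; clear; lia.
have z0 : `|(i : int) - (j : int)|%N = 0%N.
  by apply/eqP; rewrite eqn0Ngt; apply/negP => pos; move: dv; rewrite gtnNdvd.
by apply: val_inj; move: z0; clear; case: i j => i /= _ [j /= _]; lia.
Qed.

Lemma offset_inj ij ij' : lattice (offset ij - offset ij') -> ij = ij'.
Proof.
case: ij ij' => [i j] [i' j']; rewrite latticeE !mxE /= => /andP[h0 /frac_int_inj E].
rewrite -{i'}E in h0 *; congr pair; apply: frac_int_inj.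
by move: h0; rewrite opprD addrACA subrr add0r.
Qed.

Definition branch (q : T2) (ij : I) : T2 := tproj (lift_inv (repr q + offset ij *m rP2)).

Lemma branchK q ij : f (branch q ij) = q.
Proof.
rewrite tmapE; last exact: equivariant_lift.
by rewrite lift_invK tproj_shift ?tproj_repr.
Qed.

Lemma branch_inj q : injective (branch q).
Proof.
move=> ij ij' /tprojP /(equivariant_ilin P1); rewrite /lift_inv !(ilinK QP).
move=> /(equivariant_vshear (tau_v_periodic T)); rewrite /unshear !vshearKN.
move=> /(equivariant_hshear (tau_h_periodic eta)); rewrite !hshearKN -mulmxBl.
by rewrite opprD addrACA subrr add0r -mulmxBl mulmxK // => /offset_inj.
Qed.

Lemma branch_surj q y : f y = q -> exists ij, y = branch q ij.
Proof.
move=> fy; have : lattice (F (repr y) - repr q).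
  by apply/tprojP; rewrite tproj_repr -fy.
move=> /offset_all[ij hij]; exists ij; rewrite -[LHS]tproj_repr; apply/tprojP.
rewrite -{1}(liftK (repr y)) /lift_inv; apply: equivariant_ilin; apply: equivariant_unshear.
by move: hij; rewrite mulmxBl mulmxDl (mulmxK uP2 (offset ij)) opprD addrA.
Qed.

(** The fibre of the [n]-th iterate, listed along the tree of branches so that
   sums over it unfold one generation at a time. *)
Fixpoint preimages (n : nat) (q : T2) : seq T2 :=
  if n is n'.+1 then [seq y | ij <- enum {: I}, y <- preimages n' (branch q ij)] else [:: q].

Lemma mem_preimages n q y : (y \in preimages n q) = (iter n f y == q).
Proof.
elim: n q y => [|n IH] q y /=; first by rewrite inE.
apply/allpairsPdep/eqP => [[ij [z [_ +]]]|E].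
  by rewrite IH => /eqP E ->; rewrite E branchK.
have [ij hij] := branch_surj E; exists ij, y; rewrite mem_enum; split=> //.
by rewrite IH hij.
Qed.

Lemma preimages_uniq n q : uniq (preimages n q).
Proof.
elim: n q => [//|n IH] q /=; apply: allpairs_uniq_dep => [|ij _|]; first exact: enum_uniq.
  exact: IH.
move=> _ _ /allpairsPdep[ij [y [_ + ->]]] /allpairsPdep[ij' [y' [_ + ->]]] /= E.
rewrite -{y'}E !mem_preimages => /eqP E1 /eqP E2.
by rewrite (branch_inj (etrans (esym E1) E2)).
Qed.

Lemma fiber_sumE N n q v : fiber_sum N (iter n f) (q, v) =
  \sum_(y <- preimages n q) ln (N (v *m invmx (iter_jac n (repr y)))) / (\det (P1 *m P2))%:~R ^+ n.
Proof.
rewrite /fiber_sum /= (_ : iter n f @^-1` [set q] = [set` preimages n q]).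
  rewrite -fsbig_seq ?preimages_uniq //; apply: eq_bigr => y _.
  by rewrite torus_jacobian_iter det_iter_jac.
by apply/seteqP; split => y /=; rewrite mem_preimages => /eqP.
Qed.

(** The inverse Jacobian on a branch, as a function of the base point only. *)
Definition branch_jac_inv (q : T2) (ij : I) : 'M[R]_2 :=
  let u := (repr q : V) *m invmx rP2 in
  lift_jac_inv (slope (branch_pt c eta (u 0 0) (u 0 1) ij))
    (eta * (2 * pi * cos (2 * pi * (u 0 1 + ij.1%:R / p%:R)))).

Lemma lift_jac_branch q ij : invmx (lift_jac (repr (branch q ij))) = branch_jac_inv q ij.
Proof.
rewrite (lift_jac_periodic (repr_tproj _)) invmx_lift_jac /branch_jac_inv.
rewrite /lift_inv (ilinK QP) /unshear vshearKN mulmxDl mulmxK //.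
set u := repr q *m _.
have -> : vshear (fun t => - tau_v T t) (hshear (fun t => - tau_h eta t) (u + offset ij)) 0 0 =
   branch_pt c eta (u 0 0) (u 0 1) ij.
  rewrite /vshear /hshear /branch_pt /tau_h !(mkplane0, mkplane1) /= ?(mkplane0, mkplane1) !mxE /=.
  by ring.
by congr (lift_jac_inv _ (_ * (_ * cos (_ * _)))); rewrite /hshear !mxE.
Qed.

Lemma iter_jac_branch n q ij y : y \in preimages n (branch q ij) ->
  invmx (iter_jac n.+1 (repr y)) = branch_jac_inv q ij *m invmx (iter_jac n (repr y)).
Proof.
rewrite mem_preimages => /eqP E; rewrite -lift_jac_branch /=.
have u1 := iter_jac_unit n (repr y).
have u2 (x : V) : lift_jac x \in unitmx.
  by have := iter_jac_unit 1 x; rewrite /= mul1mx.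
rewrite (_ : lift_jac (iter n F (repr y)) = lift_jac (repr (branch q ij))); last first.
  apply: lift_jac_periodic; apply/tprojP; rewrite tproj_repr -E tmap_iter //.
  exact: equivariant_lift.
by apply: invmx_eq; rewrite mulmxA mulmxK ?u2 // mulmxV.
Qed.
End Branches.

(** * Growth along inverse branches *)

Section Growth.
Variable R : realType.
Local Notation V := (plane R).
Local Notation T2 := (torus R).

Definition maxnorm (w : V) : R := maxabs (w 0 0) (w 0 1).

Lemma is_norm_ge0 (N : V -> R) : is_norm N -> forall v, 0 <= N v.
Proof.
move=> [ND NZ _] v; have N0 : N 0 = 0 by rewrite -(scale0r (0 : V)) NZ normr0 mul0r.
have NN : N (- v) = N v by rewrite -scaleN1r NZ normrN normr1 mul1r.
by have := ND v (- v); rewrite subrr N0 NN; lra.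
Qed.

(** The unit sphere of the maximum norm is made of segments, so that a lower
   bound on each of them, given by the extreme value theorem in one variable,
   compares a norm with the maximum norm. *)
Lemma norm_line_lower (N : V -> R) (e e' : V) : is_norm N ->
  (forall t : R, e + t *: e' != 0) ->
  exists2 k : R, 0 < k & forall t, `|t| <= 1 -> k <= N (e + t *: e').
Proof.
move=> nN ne; have N0 := is_norm_ge0 nN; case: (nN) => [ND NZ Nz].
have le11 : -1 <= 1 :> R by lra.
have [|t0 _ h] := @EVT_min R (fun t => N (e + t *: e')) (-1) 1 le11.
  apply: continuous_subspaceT => t; apply/cvgrPdist_le => eps eps0.
  have NB u v : `|N u - N v| <= N (u - v).
    have h1 := ND (u - v) v; have h2 := ND (v - u) u; rewrite !subrK in h1 h2.
    have h3 : N (v - u) = N (u - v) by rewrite -opprB -scaleN1r NZ normrN normr1 mul1r.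
    by rewrite ler_norml; apply/andP; split; lra.
  have NE u : N (e + t *: e' - (e + u *: e')) = `|t - u| * N e'.
    by rewrite opprD addrACA subrr add0r -scalerBl NZ.
  have e0 : 0 < eps / (N e' + 1) by rewrite divr_gt0 // ltr_wpDl.
  have : (id : R -> R) @ t --> t by exact: cvg_id.
  move/cvgrPdist_le => /(_ _ e0); apply: filterS => u /= hu.
  apply: le_trans (NB _ _) _; rewrite NE.
  have d0 : 0 < N e' + 1 by rewrite ltr_wpDl.
  move: hu; rewrite ler_pdivlMr // => hu.
  by apply: le_trans hu; rewrite ler_wpM2l // lerDl.
exists (N (e + t0 *: e')).
  rewrite lt_def N0 andbT; apply/eqP => /Nz E.
  by move: (ne t0); rewrite E eqxx.
by move=> t; rewrite ler_norml => t1; apply: h; rewrite in_itv.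
Qed.

Lemma norm_equiv_maxnorm (N : V -> R) : is_norm N -> exists k K : R,
  [/\ 0 < k, 0 < K & forall v, k * maxnorm v <= N v /\ N v <= K * maxnorm v].
Proof.
move=> nN; have N0 := is_norm_ge0 nN; case: (nN) => [ND NZ Nz].
pose e : V := mkplane (1, 0); pose e' : V := mkplane (0, 1).
have vE (v : V) : v = v 0 0 *: e + v 0 1 *: e'.
  by rewrite [LHS]plane_eta mkplaneE.
have [k1 k10 h1] : exists2 k : R, 0 < k & forall t, `|t| <= 1 -> k <= N (e + t *: e').
  apply: norm_line_lower => // t; apply/eqP => /(congr1 (fun w : V => w 0 0)).
  by rewrite !mxE /= mulr0 addr0; apply/eqP; rewrite oner_eq0.
have [k2 k20 h2] : exists2 k : R, 0 < k & forall t, `|t| <= 1 -> k <= N (e' + t *: e).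
  apply: norm_line_lower => // t; apply/eqP => /(congr1 (fun w : V => w 0 1)).
  by rewrite !mxE /= mulr0 addr0; apply/eqP; rewrite oner_eq0.
exists (Num.min k1 k2), (N e + N e' + 1); split.
- by rewrite lt_min k10.
- by rewrite ltr_wpDl // addr_ge0.
move=> v; split; last first.
  have m0 : `|v 0 0| <= maxnorm v by rewrite /maxnorm /maxabs le_max lexx.
  have m1 : `|v 0 1| <= maxnorm v by rewrite /maxnorm /maxabs le_max lexx orbT.
  rewrite {1}(vE v); apply: le_trans (ND _ _) _; rewrite !NZ.
  have a1 : `|v 0 0| * N e <= maxnorm v * N e by rewrite ler_wpM2r.
  have a2 : `|v 0 1| * N e' <= maxnorm v * N e' by rewrite ler_wpM2r.
  have a3 : 0 <= maxnorm v by apply: le_trans m0.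
  by rewrite !mulrDl mul1r; have := N0 e; lra.
have key (a b : R) (u u' : V) (kk : R) : v = a *: u + b *: u' -> 0 <= kk ->
    (forall t, `|t| <= 1 -> kk <= N (u + t *: u')) -> `|b| <= `|a| -> kk * `|a| <= N v.
  move=> E kk0 hk ba; have [a0|a0] := eqVneq a 0; first by rewrite a0 normr0 mulr0.
  have -> : v = a *: (u + (b / a) *: u').
    by rewrite E scalerDr scalerA mulrCA divff // mulr1.
  rewrite NZ mulrC ler_wpM2l // hk // normrM normfV ler_pdivrMr ?normr_gt0 //.
  by rewrite mul1r.
have mk1 : Num.min k1 k2 <= k1 by rewrite ge_min lexx.
have mk2 : Num.min k1 k2 <= k2 by rewrite ge_min lexx orbT.
rewrite /maxnorm /maxabs; case: (leP `|v 0 0| `|v 0 1|) => [ab|/ltW ba].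
  apply: le_trans (ler_wpM2r (normr_ge0 _) mk2) _.
  by apply: (key _ (v 0 0) e' e) => //; [rewrite {1}(vE v) addrC|exact: ltW].
apply: le_trans (ler_wpM2r (normr_ge0 _) mk1) _.
by apply: (key _ (v 0 1) e e') => //; exact: ltW.
Qed.

Variables (P1 Q1 P2 : 'M[int]_2) (p m : nat) (c : int).
Hypothesis PQ : P1 *m Q1 = 1%:M.
Hypothesis P2_neq0 : \det P2 != 0.
Hypothesis twist : (P2 *m P1) 1 0 != 0.
Hypotheses (p_gt0 : (0 < p)%N) (m_ge3 : (3 <= m)%N) (m3 : m = 3%N -> p = 3%N).
Hypothesis pm_gt4 : (4 < p * m)%N.
Hypothesis detP : \det (P1 *m P2) = (p * m)%N.
Notation I := ('I_p * 'I_m)%type.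
Hypothesis offset_lattice : forall ij : I, lattice (offset R c ij *m map_mx intr P2).
Hypothesis offset_all : forall n : V, lattice n ->
  exists ij : I, lattice (n *m invmx (map_mx intr P2) - offset R c ij).

Let m_gt0 : (0 < m)%N. Proof. exact: leq_trans m_ge3. Qed.
Local Notation rP2 := (map_mx intr P2 : 'M[R]_2).
Local Notation rQ1 := (map_mx intr Q1 : 'M[R]_2).
Let uP2 : rP2 \in unitmx. Proof. exact: ilin_unit. Qed.

(** In the coordinates of the shears, this matrix multiplies the vectors between
   two consecutive applications of the inverse shears. *)
Definition transfer : 'M[R]_2 := rQ1 *m invmx rP2.

Lemma transfer_inv : (map_mx intr (P2 *m P1) : 'M[R]_2) *m transfer = 1%:M.
Proof.
rewrite map_mxM /transfer mulmxA -(mulmxA rP2) -map_mxM PQ map_mx1 mulmx1.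
by rewrite mulmxV.
Qed.

Lemma det_transfer_neq0 : transfer 0 0 * transfer 1 1 - transfer 0 1 * transfer 1 0 != 0.
Proof.
rewrite -det2; apply/eqP => d0; have := congr1 determinant transfer_inv.
by rewrite det_mulmx d0 mulr0 det1 => /eqP; rewrite eq_sym oner_eq0.
Qed.

Lemma transfer10_neq0 : transfer 1 0 != 0.
Proof.
apply/eqP => t0; have := det_transfer_neq0; rewrite t0 mulr0 subr0.
have := congr1 (fun A : 'M[R]_2 => A 1 0) transfer_inv; rewrite [X in X = _]mxE.
rewrite !big_ord_recl big_ord0 addr0 (_ : lift ord0 ord0 = 1); last exact: val_inj.
rewrite t0 mulr0 addr0 !mxE /= => /eqP; rewrite mulf_eq0 intr_eq0 => /orP[h|/eqP ->].
  by move: twist; rewrite !mxE h.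
by rewrite mul0r eqxx.
Qed.

Local Notation kappa := (cone_width (transfer 0 0) (transfer 0 1) (transfer 1 0) (transfer 1 1)).
Local Notation goodv w := (good (transfer 0 0) (transfer 0 1) (transfer 1 0) (transfer 1 1)
  ((w : V) 0 0) ((w : V) 0 1)).

Definition pot (A : R) (w : V) : R := potential A (goodv w) (maxnorm w).

Lemma maxnorm_gt0 (w : V) : w != 0 -> 0 < maxnorm w.
Proof.
move=> w0; apply: maxabs_gt0; rewrite -negb_and; apply: contra w0 => /andP[/eqP h0 /eqP h1].
by apply/eqP; apply: plane_eqP; rewrite !mxE.
Qed.

Lemma branch_step (T eta : R) (q : T2) (ij : I) (v : V) (g := eta * (2 * pi *
      cos (2 * pi * ((repr q *m invmx rP2) 0 1 + ij.1%:R / p%:R))))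
    (s := slope (branch_pt c eta ((repr q *m invmx rP2) 0 0) ((repr q *m invmx rP2) 0 1) ij))
    (w := v *m invmx rP2) :
  let r1 := w 0 0 - g * w 0 1 in let r2 := w 0 1 - T * s * r1 in
  v *m branch_jac_inv Q1 P2 T eta c q ij *m invmx rP2 =
  mkplane (r1 * transfer 0 0 + r2 * transfer 1 0, r1 * transfer 0 1 + r2 * transfer 1 1).
Proof.
rewrite /branch_jac_inv /lift_jac_inv -/g -/s !mulmxA -/w mul_lower mul_upper -mulmxA -/transfer.
by apply: plane_eqP; rewrite mulmx_row2 !mkplane0 !mkplane1 /= !mulNr.
Qed.

(** The weak shear [eta] is chosen first, within the bounds of [slope_counting]
   and [one_step]. It determines the distance [d] between the slopes that are
   told apart, this determines the constants of [one_step], and [T] is chosen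
   last. *)
Lemma expanding_parameters : exists T eta A lam : R, [/\ 0 <= A, 0 < lam & 
  forall (q : T2) (v : V), v != 0 ->
    (p * m)%N%:R * (pot A (v *m invmx rP2) + lam) <=
    \sum_(ij : I) pot A (v *m branch_jac_inv Q1 P2 T eta c q ij *m invmx rP2)].
Proof.
have b10 := transfer10_neq0; have db := det_transfer_neq0.
have /andP[k0 k4] := cone_width_bounds (transfer 0 0) (transfer 0 1) (transfer 1 1) b10.
have pi0 := @pi_gt0 R.
pose eta := Num.min (1 / (12 * pi)) (kappa / (4 * pi)) : R.
have eta0 : 0 < eta by rewrite lt_min; apply/andP; split; apply: divr_gt0 => //; exact: mulr_gt0.
have eta1 : 12 * pi * eta <= 1.
  by rewrite mulrC -ler_pdivlMr ?ge_min ?lexx //; exact: mulr_gt0.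
have eta2 : eta * (4 * pi) <= kappa.
  by rewrite -ler_pdivlMr ?ge_min ?lexx ?orbT //; exact: mulr_gt0.
have [d [n0 [n1 [d0 n01 count]]]] := slope_counting c p_gt0 m_ge3 m3 pm_gt4 eta0 eta1.
have [k [T0 [k01 T01 step]]] := one_step b10 db d0.
pose D : R := (p * m)%N%:R.
pose T := Num.max T0 (expR (2 * (D * - ln k + 1))).
have TT : T0 <= T by rewrite le_max lexx.
have T1 : 1 <= T by apply: le_trans TT.
have lnT : 2 * (D * - ln k + 1) <= ln T.
  rewrite -[leLHS]expRK ler_ln ?posrE ?expR_gt0 ?(lt_le_trans ltr01) //.
  by rewrite le_max lexx orbT.
have cI : #|{: I}| = (p * m)%N by rewrite card_prod !card_ord.
have D0 : 0 < D by rewrite ltr0n; apply: leq_trans pm_gt4.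
pose A := reward #|{: I}| n1 T.
exists T, eta, A, D^-1; split; rewrite ?invr_gt0 //.
  apply: mulr_ge0; last exact: ln_ge0.
  apply: divr_ge0; first by apply: addr_ge0.
  rewrite subr_ge0 ler_nat cI.
  by apply: leq_trans (ltnW n01); rewrite leq_addl.
move=> q v v0; set u := repr q *m invmx rP2; set w := v *m invmx rP2.
have w0 : w != 0.
  by apply: contra v0 => /eqP E; rewrite -[v](mulmxKV uP2) -/w E mul0mx.
pose g (ij : I) := eta * (2 * pi * cos (2 * pi * (u 0 1 + ij.1%:R / p%:R))).
pose s (ij : I) := slope (branch_pt c eta (u 0 0) (u 0 1) ij).
pose r1 (ij : I) := w 0 0 - g ij * w 0 1.
pose r2 (ij : I) := w 0 1 - T * s ij * r1 ij.
pose wn (ij : I) : V := v *m branch_jac_inv Q1 P2 T eta c q ij *m invmx rP2.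
have wnE (ij : I) : wn ij = mkplane (r1 ij * transfer 0 0 + r2 ij * transfer 1 0,
    r1 ij * transfer 0 1 + r2 ij * transfer 1 1).
  by rewrite /wn branch_step.
have gk (ij : I) : `|g ij| <= kappa / 2.
  have pi2 : 0 <= 2 * pi :> R by rewrite mulr_ge0 // ltW.
  rewrite /g normrM (ger0_norm (ltW eta0)) normrM (ger0_norm pi2).
  have c1 := cos_max (2 * pi * (u 0 1 + ij.1%:R / p%:R)).
  have : eta * (2 * pi * `|cos (2 * pi * (u 0 1 + ij.1%:R / p%:R))|) <= eta * (2 * pi * 1).
    by rewrite ler_wpM2l ?(ltW eta0) // ler_wpM2l // mulr_ge0 // ltW.
  have e (a b : R) : a * (2 * b * 1) = a * (4 * b) / 2 by field.
  move=> /le_trans; apply; rewrite e ler_wpM2r //.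
have stp (ij : I) := step T (g ij) (s ij) (w 0 0) (w 0 1) TT (gk ij) (slope_le2 _).
have mE (ij : I) : maxnorm (wn ij) = maxabs (r1 ij * transfer 0 0 + r2 ij * transfer 1 0)
    (r1 ij * transfer 0 1 + r2 ij * transfer 1 1).
  by rewrite /maxnorm wnE mkplane0 mkplane1.
have gE (ij : I) : goodv (wn ij) = good (transfer 0 0) (transfer 0 1) (transfer 1 0) (transfer 1 1)
   (r1 ij * transfer 0 0 + r2 ij * transfer 1 0) (r1 ij * transfer 0 1 + r2 ij * transfer 1 1).
  by rewrite wnE mkplane0 mkplane1.
pose bad0 := [pred ij : I | `|s ij| < d].
pose bad1 := [pred ij : I | `|r2 ij| < T * d * `|r1 ij|].
have W0 := maxnorm_gt0 w0.
have [c0 c1] := count (u 0 0) (u 0 1).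
have Wn0 (ij : I) : 0 < maxnorm (wn ij).
  have [h _ _ _] := stp ij; rewrite -/(r1 ij) -/(r2 ij) -mE in h.
  rewrite -(pmulr_rgt0 _ (lt_le_trans ltr01 T1)); apply: lt_le_trans h.
  by case/andP: k01 => k_0 _; rewrite mulr_gt0.
have avg := @average_growth R {: I} n0 n1 k T (maxnorm w) (fun ij => maxnorm (wn ij))
  (goodv w) (fun ij => goodv (wn ij)) bad0 bad1.
rewrite -/D mulrDr divff ?gt_eqF // /D -cI; apply: avg => //.
- by rewrite cI.
- by rewrite cI.
- by move=> ij; rewrite mE; have [] := stp ij.
- by move=> gw ij; rewrite mE; have [_ h _ _] := stp ij; exact: h.
- move=> gw ij; rewrite /bad0 /= -leNgt => sd; rewrite mE gE.
  by have [_ _ h _] := stp ij; exact: h.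
- move=> ij; rewrite /bad1 /= -leNgt => rd; rewrite mE gE.
  by have [_ _ _ h] := stp ij; exact: h.
- apply: c1 => i j j'; rewrite /bad1 /=.
  have -> : r1 (i, j') = r1 (i, j) by [].
  rewrite -/(s (i, j)) -/(s (i, j')) /r2 (_ : r1 (i, j') = r1 (i, j)) //.
  set rr := r1 (i, j) => h h'.
  have T_0 : 0 < T by apply: lt_le_trans T1.
  have rr0 : 0 < `|rr|.
    rewrite lt_def normr_ge0 andbT; apply/eqP => E.
    by move: h; rewrite E mulr0 ltNge normr_ge0.
  rewrite -(ltr_pM2l (mulr_gt0 T_0 rr0)).
  have -> : T * `|rr| * `|s (i, j) - s (i, j')| =
     `|(w 0 1 - T * s (i, j') * rr) - (w 0 1 - T * s (i, j) * rr)|.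
    rewrite -[T in LHS](ger0_norm (ltW T_0)) -!normrM; congr `|_|; ring.
  apply: le_lt_trans (ler_normB _ _) _.
  apply: lt_le_trans (ltrD h' h) _.
  by rewrite le_eqVlt; apply/orP; left; apply/eqP; ring.
Qed.

Lemma potential_growth : exists T eta A lam : R, [/\ 0 <= A, 0 < lam &
  forall n (q : T2) (v : V), v != 0 ->
    (p * m)%N%:R ^+ n * (pot A (v *m invmx rP2) + n%:R * lam) <=
    \sum_(y <- preimages Q1 P2 T eta p m c n q)
      pot A (v *m invmx (iter_jac P1 P2 T eta n (repr y)) *m invmx rP2)].
Proof.
have [T [eta [A [lam [A0 lam0 step]]]]] := expanding_parameters.
exists T, eta, A, lam; split=> // n; set D : R := (p * m)%N%:R.
have D0 : 0 <= D by exact: ler0n.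
elim: n => [|n IH] q v v0.
  by rewrite /= big_seq1 expr0 mul1r mul0r addr0 (invmx_eq (mulmx1 _)) mulmx1.
have -> : \sum_(y <- preimages Q1 P2 T eta p m c n.+1 q)
      pot A (v *m invmx (iter_jac P1 P2 T eta n.+1 (repr y)) *m invmx rP2) =
    \sum_(ij : I) \sum_(y <- preimages Q1 P2 T eta p m c n (branch Q1 P2 T eta c q ij))
      pot A (v *m branch_jac_inv Q1 P2 T eta c q ij *m
        invmx (iter_jac P1 P2 T eta n (repr y)) *m invmx rP2).
  rewrite [LHS]big_allpairs_dep big_enum /=; apply: eq_bigr => ij _.
  rewrite [LHS]big_seq [RHS]big_seq; apply: eq_bigr => y hy.
  by rewrite (iter_jac_branch PQ P2_neq0 offset_lattice offset_all hy) mulmxA.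
have vB0 (ij : I) : v *m branch_jac_inv Q1 P2 T eta c q ij != 0.
  rewrite -(lift_jac_branch T eta PQ P2_neq0 c q ij); apply: contra v0 => /eqP E.
  have := iter_jac_unit T eta PQ P2_neq0 1 (repr (branch Q1 P2 T eta c q ij)).
  rewrite /= mul1mx => uJ.
  by rewrite -[v](mulmxKV uJ) E mul0mx.
apply: (le_trans _ (ler_sum _ (fun (ij : I) _ => IH (branch Q1 P2 T eta c q ij) _ (vB0 ij)))).
rewrite -mulr_sumr big_split /= sumr_const card_prod !card_ord -[_ *+ (p * m)]mulr_natl -/D.
have -> : D ^+ n.+1 * (pot A (v *m invmx rP2) + n.+1%:R * lam) =
    D ^+ n * (D * (pot A (v *m invmx rP2) + lam) + D * (n%:R * lam)).
  by rewrite exprSr -natr1; move: (D ^+ n) => e; ring.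
by rewrite ler_wpM2l ?exprn_ge0 // lerD2r step.
Qed.

Lemma sum_preimages_const T eta n (q : T2) (x : R) :
  \sum_(y <- preimages Q1 P2 T eta p m c n q) x = (p * m)%N%:R ^+ n * x.
Proof.
elim: n q => [|n IH] q; first by rewrite big_seq1 expr0 mul1r.
rewrite [LHS]big_allpairs_dep big_enum /=.
under eq_bigr do rewrite IH.
by rewrite sumr_const card_prod !card_ord exprS -mulrA mulr_natl.
Qed.

Lemma is_norm_mul (N : V -> R) : is_norm N -> is_norm (fun w => N (w *m rP2)).
Proof.
move=> [ND NZ Nz]; split=> [u v|a u|u /Nz u0].
- by rewrite mulmxDl.
- by rewrite -scalemxAl.
- by rewrite -[u](mulmxK uP2) u0 mul0mx.
Qed.

(** The potential differs from the logarithm of the norm by a bounded amount,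
   hence the sums over the fibres of the [n]-th iterate grow linearly in [n], and
   one [n] for which the linear term dominates suffices. *)
Lemma positive_exponent (N : V -> R) : is_norm N ->
  exists T eta : R, (0 < C_X N (tmap (shear_lift P1 P2 T eta)))%E.
Proof.
move=> nN; have [k [K [k0 K0 kK]]] := norm_equiv_maxnorm (is_norm_mul nN).
have [T [eta [A [lam [A0 lam0 growth]]]]] := potential_growth.
exists T, eta; set D : R := (p * m)%N%:R in growth.
have D0 : 0 < D by rewrite ltr0n; apply: leq_trans pm_gt4.
have [n n0 bn] : exists2 n, (0 < n)%N & 1 + ln K + A - ln k <= n%:R * lam.
  exists (Num.truncn ((1 + ln K + A - ln k) / lam)).+1 => //.
  by rewrite -ler_pdivrMr // ltW // truncnS_gt.
have lnle (x y : R) : 0 < x -> x <= y -> ln x <= ln y.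
  by move=> x0 xy; rewrite ler_ln ?posrE //; apply: lt_le_trans xy.
have potb (w : V) : ln (maxnorm w) <= pot A w <= ln (maxnorm w) + A.
  by rewrite /pot /potential; case: ifP => _; lra.
have bound q v : N v = 1 -> 1 <= fiber_sum N (iter n (tmap (shear_lift P1 P2 T eta))) (q, v).
  move=> v1; have NZ : N 0 = 0 by case: nN => _ NZ _; rewrite -(scale0r (0 : V)) NZ normr0 mul0r.
  have v0 : v != 0 by apply/eqP => E; move: v1; rewrite E NZ => /eqP; rewrite eq_sym oner_eq0.
  rewrite (fiber_sumE T eta PQ P2_neq0 offset_lattice offset_all) -mulr_suml.
  rewrite detP -pmulrn -/D ler_pdivlMr ?exprn_gt0 // mul1r.
  have h1 := growth n q v v0.
  have h2 : - ln K <= pot A (v *m invmx rP2).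
    apply: le_trans (_ : ln (maxnorm (v *m invmx rP2)) <= _); last by case/andP: (potb (v *m invmx rP2)).
    rewrite -lnV ?posrE //; apply: lnle; first by rewrite invr_gt0.
    have [_] := kK (v *m invmx rP2); rewrite mulmxKV // v1 => h.
    by rewrite -div1r ler_pdivrMr // mulrC.
  have h3 : \sum_(y <- preimages Q1 P2 T eta p m c n q)
      pot A (v *m invmx (iter_jac P1 P2 T eta n (repr y)) *m invmx rP2) <=
    \sum_(y <- preimages Q1 P2 T eta p m c n q)
      (ln (N (v *m invmx (iter_jac P1 P2 T eta n (repr y)))) + (A - ln k)).
    apply: ler_sum => y _; set J := iter_jac _ _ _ _ _ _.
    have uJ : J \in unitmx by exact: iter_jac_unit PQ P2_neq0 _ _.
    set w := v *m invmx J *m invmx rP2.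
    have w0 : w != 0.
      apply: contra v0 => /eqP E.
      by rewrite -[v](mulmxKV uJ) -[v *m invmx J](mulmxKV uP2) -/w E !mul0mx.
    have [_ pw] := andP (potb w); apply: le_trans pw _.
    have [h _] := kK w; move: h; rewrite {2}/w mulmxKV // => h.
    have m0 := maxnorm_gt0 w0.
    have := lnle _ _ (mulr_gt0 k0 m0) h; rewrite lnM ?posrE //; lra.
  rewrite [leRHS]big_split /= sum_preimages_const -/D in h3.
  have h4 : D ^+ n * (1 + A - ln k) <= D ^+ n * (pot A (v *m invmx rP2) + n%:R * lam).
    by rewrite ler_wpM2l ?exprn_ge0 ?(ltW D0) //; lra.
  have := le_trans h4 (le_trans h1 h3).
  by rewrite -(addrA 1 A) mulrDr mulr1 lerD2r.
apply: (@lt_le_trans _ _ ((n%:R^-1)%:E * ereal_inf [set (fiber_sum N (iter n (tmap (shear_lift P1 P2 T eta))) xv)%:E | xv in unit_tangent N])%E).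
  apply: mule_gt0; first by rewrite lte_fin invr_gt0 ltr0n.
  apply: (@lt_le_trans _ _ 1%E); first by rewrite lte_fin.
  by apply: le_ereal_inf_tmp => _ [[q v] /= hv <-]; rewrite lee_fin; exact: bound.
by apply: ereal_sup_ubound; exists n.
Qed.

Lemma not_bijective T eta : ~ bijective (tmap (@shear_lift R P1 P2 T eta)).
Proof.
move=> [g fg _].
pose i0 := Ordinal p_gt0.
have m1 : (1 < m)%N by exact: leq_trans m_ge3.
have bK := branchK T eta PQ P2_neq0 offset_lattice.
pose q0 : T2 := tproj 0.
have E : branch Q1 P2 T eta c q0 (i0, Ordinal m_gt0) = branch Q1 P2 T eta c q0 (i0, Ordinal m1).
  by apply: (can_inj fg); exact: etrans (bK q0 _) (esym (bK q0 _)).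
by have [] := branch_inj PQ P2_neq0 E.
Qed.
End Growth.

(** * The integer factorization *)

Definition mat2 (K : Type) (a b c d : K) : 'M[K]_2 :=
  \matrix_(i, j) if i == 0 then (if j == 0 then a else b) else (if j == 0 then c else d).

Lemma matrix2P (K : Type) (A B : 'M[K]_2) :
  A 0 0 = B 0 0 -> A 0 1 = B 0 1 -> A 1 0 = B 1 0 -> A 1 1 = B 1 1 -> A = B.
Proof.
move=> h00 h01 h10 h11; apply/matrixP => i j.
have E (k : 'I_2) : k = 0 \/ k = 1 by case: k => [[|[|//]] ?]; [left|right]; exact: val_inj.
by case: (E i) => ->; case: (E j) => ->.
Qed.

Lemma mulmx2E (K : comNzRingType) (A B : 'M[K]_2) i j :
  (A *m B) i j = A i 0 * B 0 j + A i 1 * B 1 j.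
Proof.
by rewrite mxE !big_ord_recl big_ord0 addr0 (_ : lift ord0 ord0 = 1); last exact/val_inj.
Qed.

Lemma det_unimodular (A : 'M[int]_2) : A \in unitmx -> `|\det A| = 1.
Proof. by rewrite unitmxE => /orP[] /eqP ->. Qed.

(** The signs of the elementary divisors are moved into [S]. *)
Lemma smith_form2 (M : 'M[int]_2) : 0 < \det M ->
  exists (L S : 'M[int]_2) (p m : nat), [/\ L \in unitmx, S \in unitmx, (p %| m)%N,
    \det M = (p * m)%N & M = L *m mat2 p%:Z 0 0 m%:Z *m S].
Proof.
move=> M0; have [L uL [S uS [d dvd E]]] := int_Smith_normal_form M.
pose sg (z : int) : int := if z < 0 then -1 else 1.
have sgE z : z = `|z|%N%:Z * sg z.
  by rewrite /sg abszE; case: ltrP => h; rewrite ?mulrN1 ?mulr1 ?(ltr0_norm h) ?opprK ?(ger0_norm h).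
have sgu z : sg z * sg z = 1 by rewrite /sg; case: ifP.
pose p := absz d`_0; pose m := absz d`_1.
pose G := mat2 (sg d`_0) 0 0 (sg d`_1).
have uG : G \in unitmx.
  have /mulmx1_unit[] // : G *m G = 1%:M.
  by apply: matrix2P; rewrite mulmx2E !mxE /= ?mulr0 ?mul0r ?addr0 ?add0r.
have EM : M = L *m mat2 p%:Z 0 0 m%:Z *m (G *m S).
  rewrite E mulmxA -[L *m _ *m G]mulmxA; congr (_ *m _ *m _).
  by apply: matrix2P; rewrite mulmx2E !mxE /= ?mulr0n ?mulr1n ?mulr0 ?mul0r ?addr0 ?add0r.
have uGS : G *m S \in unitmx by rewrite unitmx_mul uG.
have detM : \det M = (p * m)%N.
  rewrite -(gtr0_norm M0) EM !det_mulmx !normrM det_unimodular // mul1r.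
  have := det_unimodular uGS; rewrite det_mulmx normrM => ->; rewrite mulr1.
  by rewrite det2 !mxE /= mulr0 subr0 PoszM ger0_norm.
exists L, (G *m S), p, m; split=> //.
move: dvd; have : (0 < p * m)%N by rewrite -ltz_nat -detM.
rewrite /p /m; case: d {E sgE p m G uG EM uGS detM} => [|a [|b d]] /=; rewrite ?muln0 //.
by move=> _ /andP[].
Qed.

(** The entry measures how much the linear part turns the vertical direction of
   the shears, and it is a polynomial of degree 2 in [c]. It vanishes at [0], [1]
   and [-1] only if [D *m S *m L] is scalar, and then so is [M], which is
   conjugate to it. *)
Lemma twisted_factorization (M : 'M[int]_2) (L D S : 'M[int]_2) :
  L \in unitmx -> M = L *m D *m S -> (forall k : int, M <> k%:M) ->
  exists c : int, (mat2 0 1 1 (- c) *m D *m S *m (L *m mat2 c 1 1 0)) 1 0 != 0.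
Proof.
move=> uL E nsc; pose Y := D *m S *m L.
have YE c : (mat2 0 1 1 (- c) *m D *m S *m (L *m mat2 c 1 1 0)) 1 0 =
    c * Y 0 0 + Y 0 1 - c ^+ 2 * Y 1 0 - c * Y 1 1.
  rewrite (_ : _ *m (L *m _) = mat2 0 1 1 (- c) *m Y *m mat2 c 1 1 0); last by rewrite !mulmxA.
  by rewrite !mulmx2E ![mat2 _ _ _ _ _ _]mxE /=; ring.
have [h0|] := eqVneq ((mat2 0 1 1 (- 0) *m D *m S *m (L *m mat2 0 1 1 0)) 1 0) 0; last by exists 0.
have [h1|] := eqVneq ((mat2 0 1 1 (- 1) *m D *m S *m (L *m mat2 1 1 1 0)) 1 0) 0; last by exists 1.
have [h2|] := eqVneq ((mat2 0 1 1 (- -1) *m D *m S *m (L *m mat2 (-1) 1 1 0)) 1 0) 0; last by exists (-1).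
rewrite !YE in h0 h1 h2.
have e0 : Y 0 1 = 0 by rewrite -h0; ring.
have e1 : Y 0 0 - Y 1 0 - Y 1 1 = 0 by rewrite -h1 e0; ring.
have e2 : Y 1 1 - Y 1 0 - Y 0 0 = 0 by rewrite -h2 e0; ring.
have lin (a b e : int) : a - b - e = 0 -> e - b - a = 0 -> b = 0 /\ e = a by clear; lia.
have [y10 y11] := lin _ _ _ e1 e2.
have Ysc : Y = (Y 0 0)%:M.
  by apply: matrix2P; rewrite ![_%:M _ _]mxE /= ?mulr1n ?mulr0n.
case: (nsc (Y 0 0)); rewrite -[LHS](mulmxK uL).
have -> : M *m L = L *m Y by rewrite E !mulmxA.
by move: Ysc; set k := Y 0 0 => ->; rewrite mul_mx_scalar -scalemxAl mulmxV // scalemx1.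
Qed.

Section Offsets.
Variable R : realType.
Local Notation V := (plane R).
Variables (p m : nat) (c : int) (S S' : 'M[int]_2).
Hypotheses (p_gt0 : (0 < p)%N) (m_gt0 : (0 < m)%N).
Hypothesis SS : S *m S' = 1%:M.
Local Notation P2 := (mat2 0 1 1 (- c) *m mat2 p%:Z 0 0 m%:Z *m S).
Local Notation rP2 := (map_mx intr P2 : 'M[R]_2).

Lemma offset_mul (x y : R) :
  (mkplane (c%:~R * x + y, x) : V) *m rP2 = mkplane (x * p%:R, y * m%:R) *m map_mx intr S.
Proof.
rewrite map_mxM mulmxA map_mxM mulmxA; congr (_ *m _).
by apply: plane_eqP; rewrite !mulmx_row2 !mxE /= -?pmulrn; ring.
Qed.

Lemma smith_offset_lattice (ij : 'I_p * 'I_m) : lattice (offset R c ij *m rP2).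
Proof.
rewrite /offset offset_mul; apply: lattice_ilin; rewrite latticeE !mxE /=.
by rewrite !divfK ?pnatr_eq0 -?lt0n // !rpred_nat.
Qed.

(** Euclidean division of the coordinates of [n *m S'] by [p] and [m]. *)
Lemma smith_offset_all (n : V) : lattice n ->
  exists ij : 'I_p * 'I_m, lattice (n *m invmx rP2 - offset R c ij).
Proof.
move=> nl; have S'S : S' *m S = 1%:M by exact: mulmx1C.
have uP2 : rP2 \in unitmx.
  have dS : \det S != 0.
    by apply/eqP => d0; have := congr1 determinant SS; rewrite det_mulmx d0 mul0r det1.
  apply: ilin_unit; rewrite det_mulmx mulf_neq0 // det_mulmx !det2 !mxE /=.
  by rewrite !mul0r subr0 sub0r mulr1 mulN1r oppr_eq0 mulf_neq0 // eqz_nat -lt0n.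
have /latticeP[a [b ab]] := lattice_ilin S' nl.
have pz : p%:Z != 0 by rewrite eqz_nat -lt0n.
have mz : m%:Z != 0 by rewrite eqz_nat -lt0n.
have digit (k : nat) (z : int) : (0 < k)%N -> exists i : 'I_k, z = (z %/ k)%Z * k + i.
  move=> k0; have kz : k%:Z != 0 by rewrite eqz_nat -lt0n.
  have h0 := modz_ge0 z kz; have h1 := ltz_pmod z (_ : 0 < k%:Z); rewrite ltz_nat in h1.
  have h2 := h1 k0; have lt : (`|(z %% k)%Z| < k)%N by rewrite -ltz_nat gez0_abs.
  by exists (Ordinal lt); rewrite /= gez0_abs // -divz_eq.
have [i hi] := digit p a p_gt0; have [j hj] := digit m b m_gt0.
exists (i, j); set k := (a %/ p)%Z in hi; set l := (b %/ m)%Z in hj.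
have -> : n = (mkplane (c%:~R * (k%:~R + i%:R / p%:R) + (l%:~R + j%:R / m%:R), k%:~R + i%:R / p%:R) : V) *m rP2.
  rewrite offset_mul -[LHS](ilinK S'S) ab /ilin; congr (mkplane (_, _) *m _).
    by rewrite hi mulrDl divfK ?pnatr_eq0 -?lt0n // intrD intrM.
  by rewrite hj mulrDl divfK ?pnatr_eq0 -?lt0n // intrD intrM.
rewrite mulmxK //.
have -> : (mkplane (c%:~R * (k%:~R + i%:R / p%:R) + (l%:~R + j%:R / m%:R), k%:~R + i%:R / p%:R) : V) -
  offset R c (i, j) = mkplane ((c * k + l)%:~R, k%:~R).
  by apply: plane_eqP; rewrite !mxE /= ?intrD ?intrM; ring.
by apply/latticeP; exists (c * k + l), k.
Qed.

End Offsets.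

(** * The map and its homotopy *)

Section Homotopy.
Variable R : realType.
Local Notation V := (plane R).
Local Notation T2 := (torus R).
Variables (E P1 P2 : 'M[int]_2).
Hypothesis PE : P1 *m P2 = E^T.

Lemma shear_lift0 : tmap (shear_lift P1 P2 0 0) = torus_endo E :> (T2 -> T2).
Proof.
apply/funext => q; rewrite /tmap /torus_endo; congr tproj.
rewrite map_trmx -PE map_mxM mulmxA /shear_lift /= {1}/ilin; congr (_ *m _).
by apply: plane_eqP; rewrite /hshear /vshear /tau_h /tau_v !mxE /= !mul0r !addr0.
Qed.

Lemma homotopic_through_lift (P : set (T2 -> T2)) (T eta : R) :
  (forall t : R, P (tmap (shear_lift P1 P2 (t * T) (t * eta)))) ->
  homotopic_through P (torus_endo E) (tmap (shear_lift P1 P2 T eta)).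
Proof.
move=> HP; exists (fun t => tmap (shear_lift P1 P2 (t * T) (t * eta))); split=> //.
- apply: continuous_subspaceT.
  apply: (@tmap_homotopy_continuous R (fun t => shear_lift P1 P2 (t * T) (t * eta))).
    by move=> t; exact: equivariant_lift.
  exact: lift_family_continuous.
- by rewrite !mul0r shear_lift0.
- by rewrite !mul1r.
Qed.

Lemma real_analytic_lift (T eta : R) : real_analytic (tmap (@shear_lift R P1 P2 T eta)).
Proof.
move=> x; exists (shear_lift P1 P2 T eta); split; last first.
  exact: elementary2_analytic (elementary2_lift _ _ _ _).
apply: (@filterS _ (nbhs x) _ setT); last exact: filterT.
by move=> y _; exact: tmapE (equivariant_lift _ _ _ _).
Qed.

End Homotopy.

Theorem theorem2 (R : realType) (N : plane R -> R) (r : \bar R)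
    (E : 'M[int]_2)
    (N_norm : is_norm N) (r_ge1 : (1 <= r)%E)
    (E_not_homothety : forall k : int, E <> k%:M)
    (detE_gt4 : 4 < \det E) :
  homotopy_class (torus_endo E) `&` calU N r !=set0 /\
  exists2 f : torus R -> torus R,
    (homotopy_class (torus_endo E) `&` calU N r) f &
    homotopic_through real_analytic (torus_endo E) f.
Proof.
have det0 : 0 < \det E^T by rewrite det_tr; apply: lt_trans detE_gt4.
have [L [S [p [m [uL uS pm detE LDS]]]]] := smith_form2 det0.
have Esc (k : int) : E^T <> k%:M.
  by move=> h; apply: (E_not_homothety k); rewrite -[E]trmxK h tr_scalar_mx.
have [c twist] := twisted_factorization uL LDS Esc.
pose P1 := L *m mat2 c 1 1 0; pose Q1 := mat2 0 1 1 (- c) *m invmx L.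
pose P2 := mat2 0 1 1 (- c) *m mat2 p%:Z 0 0 m%:Z *m S.
have CC : mat2 c 1 1 0 *m mat2 0 1 1 (- c) = 1%:M.
  by apply: matrix2P; rewrite mulmx2E !mxE /=; ring.
have PQ : P1 *m Q1 = 1%:M.
  by rewrite /P1 /Q1 mulmxA -(mulmxA L) CC mulmx1 mulmxV.
have PE : P1 *m P2 = E^T.
  by rewrite /P1 /P2 !mulmxA -(mulmxA L) CC mulmx1 -LDS.
have pm4 : (4 < p * m)%N by rewrite -ltz_nat -detE det_tr.
have detP : \det (P1 *m P2) = (p * m)%N by rewrite PE.
have p_gt0 : (0 < p)%N by case: p pm4 {P2 PE detP pm detE LDS twist}.
have m_gt0 : (0 < m)%N by case: m pm4 {P2 PE detP pm detE LDS twist} => //; rewrite muln0.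
have P2_neq0 : \det P2 != 0.
  by apply/eqP => d0; move: detP; rewrite det_mulmx d0 mulr0 => -[] h; rewrite -h in pm4.
have p_le : (p <= m)%N by exact: dvdn_leq.
have m_ge3 : (3 <= m)%N.
  rewrite leqNgt; apply/negP => m2; have m2' : (m <= 2)%N by [].
  by have := leq_mul (leq_trans p_le m2') m2'; rewrite leqNgt pm4.
have m3 : m = 3%N -> p = 3%N.
  move=> m3; move: pm p_le pm4; rewrite m3; clear; case: p => [|[|[|[|]]]] //.
have SS : S *m invmx S = 1%:M by exact: mulmxV.
have o1 := @smith_offset_lattice R p m c S p_gt0 m_gt0.
have o2 := @smith_offset_all R p m c S (invmx S) p_gt0 m_gt0 SS.
have [T [eta pos]] := positive_exponent PQ P2_neq0 twist p_gt0 m_ge3 m3 pm4 detP o1 o2 N_norm.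
pose f : torus R -> torus R := tmap (shear_lift P1 P2 T eta).
have fU : (homotopy_class (torus_endo E) `&` calU N r) f.
  split; first exact: homotopic_through_lift.
  split=> //; split.
  - exact (local_Cr_diffeo_lift T eta PQ P2_neq0 r_ge1).
  - exact: preserves_lift T eta PQ P2_neq0.
  - exact (not_bijective (T := T) (eta := eta) PQ P2_neq0 p_gt0 m_ge3 o1).
split; first by exists f.
exists f => //; apply: homotopic_through_lift => // t.
exact: real_analytic_lift.
Qed.
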